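(* Let $\lambda$ be a partition of $n$, with conjugate partition $\lambda'$. Then: (a) The images in $R_\lambda$ of the Garsia–Stanton monomials $g_\sigma(\mathbf{x})$, $\sigma\in J^{\mathrm{maj}}_{\lambda'}$, form a vector space basis of $R_\lambda=\mathbb{Q}[x_1,\dots,x_n]/I_\lambda$. (b) These monomials are the leading terms for the descent order, meaning that the set of leading monomials with respect to $\leq_{des}$ of the nonzero elements of $I_\lambda$ is exactly the set of all monomials in $x_1,\dots,x_n$ not belonging to $\{g_\sigma(\mathbf{x}):\sigma\in J^{\mathrm{maj}}_{\lambda'}\}$. (c) For every weak composition $\mu$ of $n$, with Young subgroup $S_\mu\subset S_n$, the images in $R_\lambda$ of the elements $N_\mu g_\sigma(\mathbf{x})$, $\sigma\in J^{\mathrm{maj}}_{\lambda'}\cap \mathrm{Sh}'(\mu)$, form a basis of $N_\mu R_\lambda$.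
   Context: Permutations $\sigma=(\sigma_1,\dots,\sigma_n)\in S_n$ are written in one-line notation. For $\mathbf{a}=(a_1,\dots,a_n)\in\mathbb{Z}_{\ge0}^n$ write $\mathbf{x}^{\mathbf{a}}=x_1^{a_1}\cdots x_n^{a_n}$. Tanisaki ideal: for a partition $\lambda$ of $n$ pad $\lambda'=(\lambda'_1\ge\dots\ge\lambda'_n\ge 0)$ with zeros to length $n$, and put $p^n_m(\lambda)=\lambda'_n+\lambda'_{n-1}+\cdots+\lambda'_{n-m+1}$. The ideal $I_\lambda$ is generated by all $e_d(S)$ with $S\subseteq\{x_1,\dots,x_n\}$ and $d>|S|-p^n_{|S|}(\lambda)$, where $e_d(S)$ is the $d$-th elementary symmetric polynomial in the variables of $S$. The quotient $R_\lambda=\mathbb{Q}[x_1,\dots,x_n]/I_\lambda$ is the Garsia–Procesi module. $S_n$ acts by $\sigma\cdot f(x_1,\dots,x_n)=f(x_{\sigma_1},\dots,x_{\sigma_n})$, and this action preserves $I_\lambda$. Garsia–Stanton monomials: $g_\sigma(\mathbf{x})=\prod_{i:\sigma_i>\sigma_{i+1}}x_{\sigma_1}\cdots x_{\sigma_i}$. Major index table: a run of $\sigma\in S_m$ is a maximal increasing sequence of consecutive entries $\sigma_i<\sigma_{i+1}<\cdots$; if $\sigma$ has $r$ runs, $\mathrm{majt}(\sigma)=(b_1,\dots,b_m)$ with $b_i=r-k$ if the value $i$ lies in the $k$-th run (from left to right). Then $g_\sigma(\mathbf{x})=\mathbf{x}^{\mathrm{majt}(\sigma)}$, and $\mathrm{majt}$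 is injective. Let $\mathcal{D}_m=\{\mathrm{majt}(\sigma):\sigma\in S_m\}$ (descent compositions). For a weak composition $\nu=(\nu_1,\dots,\nu_l)$ of $n$, $\mathcal{D}_\nu$ is the set of $\mathbf{a}\in\mathbb{Z}_{\geq 0}^n$ for which there is an ordered set partition $(A_1|\cdots|A_l)$ of $\{1,\dots,n\}$ with $|A_i|=\nu_i$ and $\mathbf{a}|_{A_i}\in\mathcal{D}_{\nu_i}$ for all $i$; here $\mathbf{a}|_{A}$ is the sequence of the $a_j$, $j\in A$, in their original order. One has $\mathcal{D}_\nu\subset\mathcal{D}_n$. Put $J^{\mathrm{maj}}_\nu=\{\sigma\in S_n:\mathrm{majt}(\sigma)\in\mathcal{D}_\nu\}$. Descent order: $\mathbf{x}^{\mathbf{a}}\leq_{des}\mathbf{x}^{\mathbf{b}}$ if either the weakly decreasing rearrangement of $\mathbf{a}$ is strictly smaller in lexicographic order than that of $\mathbf{b}$, or these rearrangements are equal and $\mathbf{a}\leq_{lex}\mathbf{b}$. (Lexicographic order compares first entries first.) This is a total order on monomials; the leading monomial of a nonzero polynomial is its largest monomial with nonzero coefficient. For a weak composition $\mu=(\mu_1,\dots,\mu_l)$ of $n$, let $B_i=\{\mu_1+\cdots+\mu_{i-1}+1,\dots,\mu_1+\cdots+\mu_i\}$; $S_\mu=S_{\mu_1}\times\cdots\times S_{\mu_l}\subset S_n$ is the subgroup preserving each $B_i$. $\mathrm{Sh}'(\mu)\subset S_n$ (reverse shuffles) is the set of $\sigma$ such that for each $i$ the elements of $B_i$ appear in decreasing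 order, from left to right, in the one-line notation of $\sigma$. $N_\mu=\sum_{w\in S_\mu}\mathrm{sgn}(w)\,w$ is the antisymmetrizing element of the group algebra of $S_\mu$. *)

(* Defs.v *)
From HB Require Import structures.
From mathcomp Require Import all_boot all_order all_fingroup all_algebra.
From mathcomp Require Import boolp.
From mathcomp Require Import generic_quotient ring_quotient.
From mathcomp Require Import mpoly.

Set Implicit Arguments.
Unset Strict Implicit.
Unset Printing Implicit Defensive.

Import Order.TTheory GRing.Theory.

Local Open Scope ring_scope.
Local Open Scope quotient_scope.

(* The index set {1, ..., n} is 'I_n = {0, ..., n-1} throughout: the entry    *)
(* sigma_i of a permutation is (s (i - 1)) + 1 and the variable x_i is        *)
(* 'X_(i - 1).                                                                *)

Definition is_partition (n : nat) (la : seq nat) : bool :=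
  [&& sorted geq la, 0%N \notin la & sumn la == n].

Definition is_weak_comp (n : nat) (mu : seq nat) : bool := sumn mu == n.

Definition conj_part (la : seq nat) : seq nat :=
  mkseq (fun i => count (fun p => (i < p)%N) la) (head 0%N la).

(* p^n_m(la) = la'_n + ... + la'_{n-m+1}, where nth pads la' with zeros. *)
Definition tanisaki_p (n : nat) (la : seq nat) (m : nat) : nat :=
  (\sum_(n - m <= i < n) nth 0 (conj_part la) i)%N.

Definition esym_in (n : nat) (S : {set 'I_n}) (d : nat) : {mpoly rat[n]} :=
  \sum_(T : {set 'I_n} | (T \subset S) && (#|T| == d)) \prod_(i in T) 'X_i.

Definition ideal_gen (R : comNzRingType) (G : R -> Prop) (f : R) : Prop :=
  exists s : seq (R * R),
    (forall q, q \in s -> G q.2) /\ f = \sum_(q <- s) q.1 * q.2.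

(* d > |S| - p is written without (truncated) subtraction. *)
Definition tanisaki_gen (n : nat) (la : seq nat) (f : {mpoly rat[n]}) : Prop :=
  exists (S : {set 'I_n}) (d : nat),
    (#|S| < d + tanisaki_p n la #|S|)%N /\ f = esym_in S d.

Definition tanisaki_ideal (n : nat) (la : seq nat) (f : {mpoly rat[n]}) : bool :=
  `[< ideal_gen (@tanisaki_gen n la) f >].
Arguments tanisaki_ideal : clear implicits.

Section IdealGen.
Variables (R : comNzRingType) (G : R -> Prop).

Lemma ideal_gen0 : ideal_gen G 0.
Proof. by exists [::]; rewrite big_nil. Qed.

Lemma ideal_genD f g : ideal_gen G f -> ideal_gen G g -> ideal_gen G (f + g).
Proof.
move=> [s [hs ->]] [t [ht ->]]; exists (s ++ t); rewrite big_cat; split=> // q.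
by rewrite mem_cat => /orP[/hs|/ht].
Qed.

Lemma ideal_genMl h f : ideal_gen G f -> ideal_gen G (h * f).
Proof.
move=> [s [hs ->]]; exists [seq (h * q.1, q.2) | q <- s]; split.
  by move=> _ /mapP[q /hs ? ->].
by rewrite big_map mulr_sumr; apply: eq_bigr => q _; rewrite mulrA.
Qed.

End IdealGen.

Lemma tanisaki_zmod_closed n la : zmod_closed (tanisaki_ideal n la).
Proof.
split=> [|f g /asboolP hf /asboolP hg]; apply/asboolP; first exact: ideal_gen0.
by apply: ideal_genD => //; rewrite -mulN1r; apply: ideal_genMl.
Qed.

HB.instance Definition _ n la :=
  GRing.isZmodClosed.Build {mpoly rat[n]} (tanisaki_ideal n la)
    (tanisaki_zmod_closed n la).

Definition garsia_procesi (n : nat) (la : seq nat) : Type :=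
  Quotient.quot
    (GRing.ZmodClosed.clone {mpoly rat[n]} (tanisaki_ideal n la) _).

HB.instance Definition _ n la := GRing.Zmodule.on (garsia_procesi n la).
HB.instance Definition _ n la := Quotient.on (garsia_procesi n la).

Definition gp_class (n : nat) (la : seq nat) (f : {mpoly rat[n]}) :
  garsia_procesi n la := \pi_(garsia_procesi n la) f.

Definition gp_scale n la (c : rat) (u : garsia_procesi n la) :=
  gp_class la (c *: repr u).

(* (s . f)(x_1, ..., x_n) = f(x_{s_1}, ..., x_{s_n}). *)
Definition perm_act (n : nat) (s : 'S_n) (f : {mpoly rat[n]}) : {mpoly rat[n]} :=
  f \mPo [tuple 'X_(s i) | i < n].

Definition gp_perm_act n la (s : 'S_n) (u : garsia_procesi n la) :
    garsia_procesi n la :=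
  gp_class la (perm_act s (repr u)).

Section GarsiaProcesi.
Variables (n : nat) (la : seq nat).
Local Notation cl := (@gp_class n la).

Lemma gp_classP f g : cl f = cl g <-> f - g \in tanisaki_ideal n la.
Proof.
have E := Quotient.idealrBE
  (GRing.ZmodClosed.clone {mpoly rat[n]} (tanisaki_ideal n la) _) f g.
by split=> [h|h]; [rewrite E; apply/eqP | apply/eqP; move: h; rewrite E].
Qed.

Lemma gp_reprK (u : garsia_procesi n la) :
  cl (repr u) = u.
Proof. exact: reprK. Qed.

Lemma gp_classD f g : cl (f + g) = cl f + cl g.
Proof. exact: raddfD. Qed.

Lemma gp_scaleE c f : gp_scale c (cl f) = cl (c *: f).
Proof.
apply/gp_classP; rewrite -scalerBr -mul_mpolyC; apply/asboolP/ideal_genMl.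
by apply/asboolP/gp_classP; rewrite gp_reprK.
Qed.

Fact gp_scaleA a b (u : garsia_procesi n la) :
  gp_scale a (gp_scale b u) = gp_scale (a * b) u.
Proof. by rewrite -[u]gp_reprK !gp_scaleE scalerA. Qed.

Fact gp_scale1 : left_id 1 (@gp_scale n la).
Proof. by move=> u; rewrite -[u]gp_reprK gp_scaleE scale1r. Qed.

Fact gp_scaleDr : right_distributive (@gp_scale n la) +%R.
Proof.
move=> a u v; rewrite -[u]gp_reprK -[v]gp_reprK -gp_classD !gp_scaleE.
by rewrite scalerDr gp_classD.
Qed.

Fact gp_scaleDl (u : garsia_procesi n la) :
  {morph (@gp_scale n la)^~ u : a b / a + b}.
Proof.
by move=> a b; rewrite -[u]gp_reprK !gp_scaleE scalerDl gp_classD.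
Qed.

HB.instance Definition _ := GRing.Zmodule_isLmodule.Build rat
  (garsia_procesi n la) gp_scaleA gp_scale1 gp_scaleDr gp_scaleDl.

Fact gp_class_is_linear : linear cl.
Proof. by move=> c f g; rewrite gp_classD -[c *: cl f]/(gp_scale _ _) gp_scaleE. Qed.

HB.instance Definition _ := GRing.isLinear.Build rat {mpoly rat[n]}
  (garsia_procesi n la) _ cl gp_class_is_linear.

Lemma perm_act_esym (s : 'S_n) (S : {set 'I_n}) d :
  perm_act s (esym_in S d) = esym_in (s @: S) d.
Proof.
rewrite /perm_act /esym_in rmorph_sum /=.
have sK : cancel (fun T : {set 'I_n} => s @: T) (fun T => s^-1%g @: T).
  by move=> T; rewrite -imset_comp -[RHS]imset_id; apply: eq_imset => i /=; rewrite permK.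
have Ks : cancel (fun T : {set 'I_n} => s^-1%g @: T) (fun T => s @: T).
  by move=> T; rewrite -imset_comp -[RHS]imset_id; apply: eq_imset => i /=; rewrite permKV.
rewrite [RHS](reindex_onto (fun T : {set 'I_n} => s @: T)
                           (fun T => s^-1%g @: T)) //=.
apply: eq_big => [T|T _].
  rewrite sK eqxx andbT (card_imset _ (@perm_inj _ s)); congr (_ && _).
  apply/idP/idP => [/(imsetS s)//|/(imsetS s^-1%g)].
  by rewrite !sK.
rewrite rmorph_prod /= (big_imset _ (in2W (@perm_inj _ s))) /=.
by apply: eq_bigr => i _; rewrite comp_mpolyXU -tnth_nth tnth_mktuple.
Qed.

Lemma tanisaki_perm_act (s : 'S_n) f :
  f \in tanisaki_ideal n la -> perm_act s f \in tanisaki_ideal n la.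
Proof.
move=> /asboolP[t [ht ->]]; apply/asboolP.
exists [seq (perm_act s q.1, perm_act s q.2) | q <- t]; split.
  move=> _ /mapP[q /ht [S [d [hd ->]]] ->] /=.
  exists (s @: S), d; rewrite perm_act_esym; split=> //.
  by rewrite (card_imset _ (@perm_inj _ s)).
rewrite big_map /perm_act rmorph_sum /=.
by apply: eq_bigr => q _; rewrite rmorphM.
Qed.

Lemma gp_perm_actE (s : 'S_n) f : gp_perm_act s (cl f) = cl (perm_act s f).
Proof.
apply/gp_classP; rewrite /perm_act -rmorphB; apply: tanisaki_perm_act.
by apply/gp_classP; rewrite gp_reprK.
Qed.

End GarsiaProcesi.

Definition is_basis_of (V : lmodType rat) (W : V -> Prop) (I : finType)
    (A : {set I}) (v : I -> V) : Prop :=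
  [/\ forall i, i \in A -> W (v i),
      forall c : I -> rat,
        \sum_(i in A) c i *: v i = 0 -> forall i, i \in A -> c i = 0
    & forall w, W w -> exists c : I -> rat, w = \sum_(i in A) c i *: v i].

Definition gs_descent (n : nat) (s : 'S_n) (i : 'I_n) : bool :=
  [exists j : 'I_n, (j == i.+1 :> nat) && (s j < s i)%N].

Definition garsia_stanton (n : nat) (s : 'S_n) : {mpoly rat[n]} :=
  \prod_(i < n | gs_descent s i) \prod_(j < n | (j <= i)%N) 'X_(s j).

Definition one_line (m : nat) (s : 'S_m) : seq nat :=
  [seq val (s i) | i <- enum 'I_m].

Fixpoint runs (w : seq nat) : seq (seq nat) :=
  if w is x :: w' then
    if runs w' is (y :: r) :: rs then
      if (x < y)%N then (x :: y :: r) :: rs else [:: x] :: (y :: r) :: rs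
    else [:: [:: x]]
  else [::].

(* find is 0-based, so the k-th run has find-index k - 1. *)
Definition majt (m : nat) (s : 'S_m) : m.-tuple nat :=
  let rs := runs (one_line s) in
  [tuple (size rs - (find (fun r => val i \in r) rs).+1)%N | i < m].

Definition descent_comp (a : seq nat) : bool :=
  [exists s : 'S_(size a), majt s == a :> seq nat].

Definition restr (n : nat) (a : n.-tuple nat) (A : {set 'I_n}) : seq nat :=
  [seq tnth a j | j <- enum A].

Definition ordered_set_partition (n : nat) (nu : seq nat)
    (A : {ffun 'I_(size nu) -> {set 'I_n}}) : bool :=
  [&& [forall i, forall j, (i != j) ==> [disjoint A i & A j]],
      \bigcup_i A i == [set: 'I_n]
    & [forall i, #|A i| == nth 0%N nu i]].

Definition descent_comps (n : nat) (nu : seq nat) : pred (n.-tuple nat) :=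
  fun a => [exists A : {ffun 'I_(size nu) -> {set 'I_n}},
    ordered_set_partition A && [forall i, descent_comp (restr a (A i))]].

Definition Jmaj (n : nat) (nu : seq nat) : {set 'S_n} :=
  [set s : 'S_n | descent_comps nu (majt s)].

Definition des_le (n : nat) (a b : 'X_{1..n}) : bool :=
  let da : seqlexi nat := sort geq a in
  let db : seqlexi nat := sort geq b in
  (da < db)%O || (da == db) && ((a : seqlexi nat) <= (b : seqlexi nat))%O.

Definition is_des_leading (n : nat) (m : 'X_{1..n}) (f : {mpoly rat[n]}) : Prop :=
  m \in msupp f /\ (forall m', m' \in msupp f -> des_le m' m).

Definition block (n : nat) (mu : seq nat) (i : nat) : {set 'I_n} :=
  [set j : 'I_n | (sumn (take i mu) <= j < sumn (take i.+1 mu))%N].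

Definition young (n : nat) (mu : seq nat) : {set 'S_n} :=
  [set w : 'S_n | [forall i : 'I_(size mu), w @: block n mu i == block n mu i]].

Definition rev_shuffles (n : nat) (mu : seq nat) : {set 'S_n} :=
  [set s : 'S_n | [forall i : 'I_(size mu), forall p : 'I_n, forall q : 'I_n,
    [&& (p < q)%N, s p \in block n mu i & s q \in block n mu i]
      ==> (s q < s p)%N]].

Definition antisym (n : nat) (mu : seq nat) (f : {mpoly rat[n]}) :
    {mpoly rat[n]} :=
  \sum_(w in young n mu) (-1) ^+ (odd_perm w) *: perm_act w f.

Definition gp_antisym (n : nat) (la mu : seq nat) (u : garsia_procesi n la) :
    garsia_procesi n la :=
  \sum_(w in young n mu) (-1) ^+ (odd_perm w) *: gp_perm_act w u.

Lemma gp_antisymE (n : nat) (la mu : seq nat) (f : {mpoly rat[n]}) :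
  gp_antisym mu (gp_class la f) = gp_class la (antisym mu f).
Proof.
rewrite /gp_antisym /antisym linear_sum /=.
by apply: eq_bigr => w _; rewrite gp_perm_actE linearZ.
Qed.

(* Main.v *)
(* Let nu be the conjugate of la. A composition a lies in D_nu iff the indices
   can be coloured, with class sizes nu, so that every j with a_j > 0 has a mate
   of its colour: some j' > j with a_j' = a_j or some j' < j with a_j' = a_j - 1.
   Ordering indices by the times t_j = a_j n + (n - j), the mate is an element of
   the same colour in the window [t_j - n, t_j).

   Independence. Let delta_j be the rank of t_j in its colour class. The
   functional sending x^m to the signed number of colour-preserving tau with
   m + (delta - a) = delta o tau kills the Tanisaki ideal. On polynomials whose
   monomials are at most x^a in the descent order only the m = a o tau with tau
   preserving delta - a contribute, and these are lexicographically above a. So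
   no element of the ideal has its leading monomial in D_nu; the same functional
   separates the antisymmetrized monomials.

   Dimension. The Garsia-Procesi recursion, removing one variable and one box
   of la at a time, bounds dim R_la by n! / prod_i la_i!.

   Counting. |D_nu| >= n! / prod_i la_i!: replace compositions by finite sets of
   times with N residues. Crystal operators on neighbouring residues make the
   residue generating function symmetric, and the reflection after the first
   violation of dominance expresses its product with a Vandermonde determinant
   as a positive sum; restricting this sum to the sets containing [0, la_1)
   gives |J_la| >= C(N, la_1) |J_la^-|, where la^- is la without its first row.
   Hence |J_la| >= prod_i C(N, la_i), and N tends to infinity. *)

Require Import Defs.
From mathcomp Require Import all_boot all_order all_fingroup all_algebra.
From mathcomp Require Import mpoly boolp zify ring lra.

Set Implicit Arguments.
Unset Strict Implicit.
Unset Printing Implicit Defensive.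

Import Order.TTheory GRing.Theory Num.Theory.

(** * Crystal operators on coloured sets of times *)

(** The three estimates close a circle: the monomials of [Jmaj] are independent in R_la, dim R_la is
    at most n! / prod la_i!, and this number is at most the size of [Jmaj]. So D_nu need only be
    bounded below, and the counting argument may throw positive terms away. A composition in D_nu
    amounts to a coloured set of times with distinct residues, but crystal operators do not keep
    residues distinct. The factor C(N, l) is a specialised e_l: freezing the times below l produces
    the starting weight (1^l, 0, ...), whose alternant is e_l times that of 0. The price is that
    with frozen times a crystal operator can destroy the mate condition at the boundary residue l -
    1. Beyond a violation of dominance this cannot happen, and the cancellation uses the operators
    only there. Symmetric functions are evaluated at (1, x, x^2, ...) with x > 1, where the
    positivity needed is a matter of signs of Vandermonde products; x then tends to 1. *)

Section Mates.
Variable N : nat.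
Implicit Types (T : nat -> bool) (k : nat -> nat).

Definition mate l0 T k (t m : nat) : bool :=
  [&& T m, l0 <= m, k m == k t, m < t & t <= m + N].

(** The exemption of the times below [l0 + N] corresponds, for [l0 = 0], to that of the entries 0 of
    a composition: these are the times of level 0. *)
Definition gapped l0 T k : Prop := forall t, T t -> l0 <= t ->
  t < l0 + N \/ exists m, mate l0 T k t m.

Variable i : nat.
Hypothesis iN : i.+1 < N.

(* The time x * N + r has level x and residue r; lswap exchanges the residues i
   and i.+1 on the levels a, ..., b. *)
Definition lswap (a b s : nat) : nat :=
  if a <= s %/ N <= b then
    if s %% N == i then s.+1 else if s %% N == i.+1 then s.-1 else s
  else s.

Variant lswap_spec a b s : nat -> Type :=
| LswapU x of a <= x <= b & s = x * N + i : lswap_spec a b s (x * N + i).+1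
| LswapW x of a <= x <= b & s = (x * N + i).+1 : lswap_spec a b s (x * N + i)
| LswapN of (forall x, a <= x <= b -> s <> x * N + i /\ s <> (x * N + i).+1)
  : lswap_spec a b s s.

Lemma divmodU x : (x * N + i) %/ N = x /\ (x * N + i) %% N = i.
Proof.
have iN' : i < N by lia.
by rewrite divnMDl ?modnMDl ?divn_small ?modn_small ?addn0 //; lia.
Qed.

Lemma divmodW x : ((x * N + i).+1) %/ N = x /\ ((x * N + i).+1) %% N = i.+1.
Proof.
by rewrite -addnS divnMDl ?modnMDl ?divn_small ?modn_small ?addn0 //; lia.
Qed.

Lemma U_inj x y : x * N + i = y * N + i -> x = y.
Proof. by move=> e; rewrite -(divmodU x).1 e (divmodU y).1. Qed.

Lemma UW_neq x y : x * N + i <> (y * N + i).+1.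
Proof. by move=> e; have := (divmodU x).2; rewrite e (divmodW y).2; lia. Qed.

Lemma lswapP a b s : lswap_spec a b s (lswap a b s).
Proof.
rewrite /lswap; have es := divn_eq s N.
case: (boolP (a <= s %/ N <= b)) => hl; last first.
  by constructor=> x hx; split=> e; move: hl; rewrite e;
    rewrite ?(divmodU x).1 ?(divmodW x).1 hx.
case: (s %% N =P i) => hi.
  have -> : s.+1 = (s %/ N * N + i).+1 by rewrite {1}es hi.
  by apply: LswapU => //; rewrite {1}es hi.
case: (s %% N =P i.+1) => hi'.
  have -> : s.-1 = s %/ N * N + i by rewrite {1}es hi' addnS.
  by apply: LswapW => //; rewrite {1}es hi' addnS.
by constructor=> x hx; split=> e; [apply: hi | apply: hi'];
  rewrite e ?(divmodU x).2 ?(divmodW x).2.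
Qed.

Lemma lswap_U a b x : a <= x <= b -> lswap a b (x * N + i) = (x * N + i).+1.
Proof. by move=> hx; rewrite /lswap; have [-> ->] := divmodU x; rewrite hx eqxx. Qed.

Lemma lswap_W a b x : a <= x <= b -> lswap a b (x * N + i).+1 = x * N + i.
Proof.
move=> hx; rewrite /lswap; have [-> ->] := divmodW x; rewrite hx eqxx.
by case: eqP => // /eqP; rewrite -addn1 -{2}[i]addn0 eqn_add2l.
Qed.

Lemma lswap_N a b s :
  (forall x, a <= x <= b -> s <> x * N + i /\ s <> (x * N + i).+1) ->
  lswap a b s = s.
Proof. by case: lswapP => // x hx e /(_ x hx); rewrite e => -[]. Qed.

Lemma lswap_UN a b x : ~~ (a <= x <= b) -> lswap a b (x * N + i) = x * N + i.
Proof.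
move=> hx; apply: lswap_N => y hy; split; last exact: UW_neq.
by move/U_inj => e; rewrite e hy in hx.
Qed.

Lemma lswap_WN a b x : ~~ (a <= x <= b) -> lswap a b (x * N + i).+1 = (x * N + i).+1.
Proof.
move=> hx; apply: lswap_N => y hy; split; first by move/esym/UW_neq.
by move=> [/U_inj e]; rewrite e hy in hx.
Qed.

Lemma lswapK a b : involutive (lswap a b).
Proof.
move=> s; case: (lswapP a b s) => [x hx ->|x hx ->|h]; first by rewrite lswap_W.
  by rewrite lswap_U.
by rewrite lswap_N.
Qed.

Lemma lswap_div a b s : lswap a b s %/ N = s %/ N.
Proof.
by case: (lswapP a b s) => [x hx ->|x hx ->|//]; rewrite (divmodW x).1 (divmodU x).1.
Qed.

Lemma lswap_lt a b s K : (lswap a b s < K * N) = (s < K * N).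
Proof. by rewrite -!ltn_divLR ?lswap_div //; lia. Qed.

(** Among the distances 1, ..., N from a time to its mate, only 1, N - 1 and N can be pushed out of
    the window: 1 for the two times of one swapped level, N - 1 for times of consecutive swapped
    levels, and N when only one of the two times is swapped, which occurs below level [a] and above
    level [b]. The hypotheses exclude these cases in this order, or supply a replacement; the last
    one protects the exempt times. *)
Lemma gapped_lswap l0 T k a b :
  gapped l0 T k ->
  (forall x, a <= x <= b -> l0 <= x * N + i) ->
  (forall x, a <= x <= b -> T (x * N + i) -> T (x * N + i).+1 ->
     k (x * N + i) <> k (x * N + i).+1) ->
  (forall x, a <= x < b -> T (x.+1 * N + i) -> T (x * N + i).+1 ->
     k (x.+1 * N + i) <> k (x * N + i).+1) ->
  (T (a * N + i) -> (a * N + i) < l0 + N \/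
     exists2 m, mate l0 T k (a * N + i) m & m + N <> a * N + i) ->
  (T (b.+1 * N + i).+1 -> T (b * N + i).+1 ->
     k (b.+1 * N + i).+1 = k (b * N + i).+1 -> (b.+1 * N + i).+1 < l0 + N \/
     exists2 m, mate l0 T k (b.+1 * N + i).+1 m & m + N <> (b.+1 * N + i).+1) ->
  (forall x, a <= x <= b -> T (x * N + i) -> x * N + i < l0 + N ->
     (x * N + i).+1 < l0 + N) ->
  gapped l0 (T \o lswap a b) (k \o lswap a b).
Proof.
move=> hg h6 h1 h2 h3 h4 h5 s /= Ts ls.
have lb t : (l0 <= lswap a b t) = (l0 <= t).
  case: (lswapP a b t) => [x hx ->|x hx ->|//]; have := h6 x hx; lia.
set s0 := lswap a b s in Ts *.
have es : s = lswap a b s0 by rewrite lswapK.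
have ls0 : l0 <= s0 by rewrite lb.
suff: (s0 < l0 + N) && (s < l0 + N) \/
      exists2 m, mate l0 T k s0 m & (lswap a b m < s) && (s <= lswap a b m + N).
  case=> [/andP[_ ->]|[m /and5P[Tm lm /eqP km mt tm] /andP[h h']]]; first by left.
  right; exists (lswap a b m); apply/and5P; split=> //=; rewrite ?lswapK ?lb //.
  by rewrite km.
rewrite es; move: (hg s0 Ts ls0) => hr; clear es.
have hN : 1 < N by lia.
have main m : mate l0 T k s0 m ->
   (forall x, a <= x <= b -> s0 = x * N + i -> m + N = s0 -> a < x) ->
   (forall x, a <= x <= b -> m = (x * N + i).+1 -> m + N = s0 -> x < b) ->
   (lswap a b m < lswap a b s0) && (lswap a b s0 <= lswap a b m + N).
  move=> hm; move: (hm) => /and5P[Tm lm /eqP km mt tm] hA hB.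
  case: (lswapP a b s0) => [x hx e0|x hx e0|h0];
  case: (lswapP a b m) => [y hy em|y hy em|hm0].
  - by lia.
  - have lyx : y < x.
      have : y * N < x * N by lia.
      by rewrite ltn_mul2r => /andP[].
    have [exy|] : x = y.+1 \/ y.+1 < x by lia.
      by have := h2 y; rewrite -exy -e0 -em km => /(_ _ Ts Tm) []; lia.
    move=> l2; have : (y.+2) * N <= x * N by rewrite leq_mul2r l2 orbT.
    by rewrite !mulSn; lia.
  - have : m + N <> s0.
      move=> emN; have lax := hA x hx e0 emN.
      have [] := hm0 x.-1; first by lia.
      case=> []; case: x hx e0 lax => // x hx e0 _ /=; rewrite mulSn in e0; lia.
    by lia.
  - have lyx : y <= x.
      rewrite leqNgt; apply/negP => lxy; have : x.+1 * N <= y * N by rewrite leq_mul2r lxy orbT.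
      by rewrite mulSn; lia.
    have [exy|] : x = y \/ y < x by lia.
      by have := h1 x hx; rewrite -e0 exy -em km => /(_ Tm Ts).
    move=> l2; have : (y.+1) * N <= x * N by rewrite leq_mul2r l2 orbT.
    by rewrite !mulSn; lia.
  - by lia.
  - have := hm0 x hx; lia.
  - have := h0 y hy; lia.
  - have : m + N <> s0.
      move=> emN; have lyb := hB y hy em emN.
      by have [] := h0 y.+1; rewrite ?mulSn; lia.
    by lia.
  - by lia.
have [eA|nA] := boolP [&& T (a * N + i), a <= b & s0 == a * N + i].
  case/and3P: eA => Ta lab /eqP e0; have [hs|[m hm hmn]] := h3 Ta.
    left; rewrite e0 hs lswap_U ?leqnn ?lab //=; apply: h5 => //; by rewrite leqnn.
  right; exists m; first by rewrite e0.
  by apply: main; rewrite ?e0 // => x hx _ _ ?; case: hmn; rewrite -e0; lia.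
have hAx x m : a <= x <= b -> s0 = x * N + i -> m + N = s0 -> a < x.
  move=> hx e0 _; have : a <> x by move=> e; move: nA; rewrite e -e0 Ts eqxx; lia.
  lia.
case: hr => [hs|[m hm]].
  left; rewrite hs; case: lswapP => [x hx e0|x hx e0|//]; last by lia.
  by apply: h5; rewrite -?e0.
have [/and3P[lab /eqP em /eqP emN]|nB] := boolP [&& a <= b, m == (b * N + i).+1 & m + N == s0].
  have eb : s0 = (b.+1 * N + i).+1 by rewrite mulSn; lia.
  move: (hm) => /and5P[Tm lm /eqP km mt tm].
  have sb0 : lswap a b s0 = s0.
    apply: lswap_N => x hx; rewrite eb mulSn; split=> e.
      have : x * N <= b * N by rewrite leq_mul2r; lia.
      lia.
    have : x * N <= b * N by rewrite leq_mul2r; lia.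
    lia.
  have := h4; rewrite -eb -em => /(_ Ts Tm (esym km)) [hs|[m1 hm1 hn1]].
    by left; rewrite sb0 hs.
  by right; exists m1 => //; apply: main.
right; exists m => //; apply: main => // x hx; first exact: hAx.
move=> em emN; have : x <> b by move=> e; move: nB; rewrite -e -em emN !eqxx; lia.
lia.
Qed.

End Mates.

(** * Reflections of strings *)

Section Strings.
Variables (X : finType) (Y : Type) (V : pred X) (f e : X -> X).
Variables (al be ep : X -> nat) (o : X -> Y) (b : nat).
Hypothesis ep_b : forall T, V T -> b <= ep T /\ be T <= al T + ep T.
Hypothesis fV : forall T, V T -> be T < al T + ep T ->
  [/\ V (f T), e (f T) = T, o (f T) = o T & [/\ (al (f T)).+1 = al T,
      be (f T) = (be T).+1 & ep (f T) = (ep T).+1]].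
Hypothesis eV : forall T, V T -> b < ep T ->
  [/\ V (e T), f (e T) = T, o (e T) = o T & [/\ al (e T) = (al T).+1,
      (be (e T)).+1 = be T & (ep (e T)).+1 = ep T]].

(* The reflection of an f-string exchanging the two weights up to the shift b;
   when b > 0 it is the reflection of the string with its last b steps removed. *)
Definition sflip T :=
  if be T <= al T + b then iter (al T + b - be T) f T
  else iter (be T - (al T + b)) e T.

Lemma iter_fV k T : V T -> be T + k <= al T + ep T ->
  [/\ V (iter k f T), iter k e (iter k f T) = T, o (iter k f T) = o T &
      [/\ al (iter k f T) + k = al T,
      be (iter k f T) = be T + k & ep (iter k f T) = ep T + k]].
Proof.
elim: k T => [|k IH] T VT hk; first by split=> //; split; rewrite ?addn0.
have [|Vf ef of' [af bf pf]] := fV VT; first lia.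
have [|Vk ek ok [ak bk pk]] := IH _ Vf; first lia.
by rewrite [iter k.+1 f T]iterSr [iter k.+1 e _]iterS ek; split; rewrite ?ok //; split; lia.
Qed.

Lemma iter_eV k T : V T -> b + k <= ep T ->
  [/\ V (iter k e T), iter k f (iter k e T) = T, o (iter k e T) = o T &
      [/\ al (iter k e T) = al T + k,
      be (iter k e T) + k = be T & ep (iter k e T) + k = ep T]].
Proof.
elim: k T => [|k IH] T VT hk; first by split=> //; split; rewrite ?addn0.
have [|Ve fe oe [ae be' pe]] := eV VT; first lia.
have [|Vk fk ok [ak bk pk]] := IH _ Ve; first lia.
by rewrite [iter k.+1 e T]iterSr [iter k.+1 f _]iterS fk; split; rewrite ?ok //; split; lia.
Qed.

(** From [T] there are [al T + ep T - be T] steps of [f] and [ep T - b] steps of [e] available; the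
    two inequalities of [ep_b] say that the flip never asks for more. *)
Lemma sflipP T : V T ->
  [/\ V (sflip T), sflip (sflip T) = T, o (sflip T) = o T,
      al (sflip T) + b = be T & be (sflip T) = al T + b].
Proof.
move=> VT; have [pb pe] := ep_b VT.
have [hl|hl] := leqP (be T) (al T + b).
  have es : sflip T = iter (al T + b - be T) f T by rewrite /sflip hl.
  have [|Vk ek ok [ak bk pk]] := @iter_fV (al T + b - be T) T VT; first lia.
  rewrite -es in Vk ek ok ak bk pk *.
  split=> //; try lia.
  rewrite {1}/sflip; case: leqP => hl'.
    have e0 : al T + b - be T = 0 by lia.
    have -> : al (sflip T) + b - be (sflip T) = 0 by lia.
    by rewrite es e0.
  by rewrite -[RHS]ek; congr (iter _ e _); lia.
have es : sflip T = iter (be T - (al T + b)) e T by rewrite /sflip leqNgt hl.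
have [|Vk fk ok [ak bk pk]] := @iter_eV (be T - (al T + b)) T VT; first lia.
rewrite -es in Vk fk ok ak bk pk *.
split=> //; try lia.
rewrite {1}/sflip; case: leqP => hl'; last lia.
by rewrite -[RHS]fk; congr (iter _ f _); lia.
Qed.

End Strings.

(** * Moving one time to the neighbouring residue *)

Section AbacusSets.
Variables (N K : nat).
Hypothesis N_gt0 : 0 < N.
Local Notation M := (K * N).
Implicit Types T : {set 'I_M}.

Definition inT T (t : nat) : bool := [exists x in T, val x == t].

Lemma inT_ord T (x : 'I_M) : inT T x = (x \in T).
Proof.
apply/existsP/idP => [[y /andP[yT /eqP/val_inj <-//]]|xT].
by exists x; rewrite xT /=.
Qed.

Lemma inT_lt T t : inT T t -> t < M.
Proof. by case/existsP=> x /andP[_ /eqP <-]; apply: ltn_ord. Qed.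

Lemma setT_eq T T' : (forall t, t < M -> inT T t = inT T' t) -> T = T'.
Proof. by move=> h; apply/setP=> x; rewrite -!inT_ord; apply: h; apply: ltn_ord. Qed.

(* The times below l0 are frozen and belong to no colour class. *)
Definition abacus (l0 : nat) (mu : seq nat) T : Prop :=
  (forall t, t < l0 -> inT T t) /\
  exists2 k : nat -> nat, gapped N l0 (inT T) k &
    forall c, #|[set x in T | (l0 <= x) && (k x == c)]| = nth 0 mu c.

Variable i : nat.
Hypothesis iN : i.+1 < N.
Local Notation U x := (x * N + i).

Lemma lswap_ltM a b (x : 'I_M) : lswap N i a b x < M.
Proof. by rewrite lswap_lt. Qed.

Definition lswapO a b (x : 'I_M) : 'I_M := Ordinal (lswap_ltM a b x).

Lemma lswapOK a b : involutive (lswapO a b).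
Proof. by move=> x; apply: val_inj; rewrite /= lswapK. Qed.

Definition lswapT v T : {set 'I_M} := [set x | lswapO v v x \in T].

Lemma inT_lswapT v T t : inT (lswapT v T) t = inT T (lswap N i v v t).
Proof.
case: (ltnP t M) => ht.
  by rewrite -[t]/(val (Ordinal ht)) inT_ord inE -inT_ord.
by apply/idP/idP => /inT_lt; rewrite ?lswap_lt // ltnNge ht.
Qed.

Lemma lswapTK v : involutive (lswapT v).
Proof. by move=> T; apply/setP=> x; rewrite !inE lswapOK. Qed.

(** The colouring is swapped on all levels from [a] to [b], the set only on level [v]: on the other
    levels both residues are occupied, so the swap there exchanges nothing but colours. *)
Lemma abacus_lswap l0 mu T a b v k :
  (forall t, t < l0 -> inT T t) ->
  gapped N l0 (inT T \o lswap N i a b) (k \o lswap N i a b) ->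
  (forall c, #|[set x in T | (l0 <= x) && (k x == c)]| = nth 0 mu c) ->
  (forall x, a <= x <= b -> l0 <= U x) ->
  a <= v <= b ->
  (forall x, a <= x <= b -> x <> v -> inT T (U x) /\ inT T (U x).+1) ->
  abacus l0 mu (lswapT v T).
Proof.
move=> hl hg hc hla hv hab.
have lb t : (l0 <= lswap N i a b t) = (l0 <= t).
  case: (lswapP iN a b t) => [x hx ->|x hx ->|//]; have := hla x hx; lia.
have eT t : inT (lswapT v T) t = inT T (lswap N i a b t).
  rewrite inT_lswapT; case: (lswapP iN a b t) => [x hx ->|x hx ->|h].
  - have [<-|ne] := eqVneq x v; first by rewrite lswap_U ?leqnn.
    have [h1 h2] := hab x hx (elimN eqP ne).
    by rewrite h2 lswap_UN //; lia.
  - have [<-|ne] := eqVneq x v; first by rewrite lswap_W ?leqnn.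
    have [h1 h2] := hab x hx (elimN eqP ne).
    by rewrite h1 lswap_WN //; lia.
  - rewrite lswap_N // => x hx; apply: h; lia.
split=> [t ht|].
  rewrite eT; have := lb t; rewrite [l0 <= t]leqNgt ht /= => /negbT.
  by rewrite -ltnNge; apply: hl.
exists (k \o lswap N i a b).
  move=> t; rewrite eT => Tt lt; have [h|[m hm]] := hg t Tt lt; first by left.
  by right; exists m; move: hm; rewrite /mate /= eT.
have eO y : (y \in lswapT v T) = (lswapO a b y \in T) by rewrite -!inT_ord eT.
move=> c; rewrite -hc -(card_imset _ (inv_inj (lswapOK a b))); apply: eq_card => x.
apply/imsetP/setIdP => [[y /setIdP[hy /andP[h2 h3]] ->]|[h1 /andP[h2 h3]]].
  by rewrite -eO hy /= lb h2.
exists (lswapO a b x); last by rewrite lswapOK.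
by apply/setIdP; rewrite eO lswapOK h1 /= lswapK // lb h2.
Qed.

(** Moving [U v] up by one is harmful only if all its mates lie exactly N below. Then the mate has
    to move as well, and so on down a chain of times of one colour. The bracket condition makes
    [(U x).+1] present on the lower levels of the chain, so that swapping the whole chain alters the
    set at level [v] only. *)
Lemma abacus_f l0 mu T v : l0 <= N -> abacus l0 mu T ->
  inT T (U v) -> ~~ inT T (U v).+1 ->
  (forall x, x < v -> (forall y, x <= y < v -> inT T (U y)) -> inT T (U x).+1) ->
  (l0 = i.+1 -> exists2 x, x < v & ~~ inT T (U x)) ->
  abacus l0 mu (lswapT v T).
Proof.
move=> hl0 [hl [k hg hc]] Tu Tw hm hs.
have lv : l0 <= U v.
  rewrite leqNgt; apply/negP => hlt.
  have v0 : v = 0 by case: (v) hlt => // v'; rewrite mulSn; lia.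
  have [hs'|] := eqVneq l0 i.+1; first by have [x] := hs hs'; rewrite v0.
  move=> /eqP ne; move/negP: Tw; apply; apply: hl; move: hlt; rewrite v0; lia.
(* The chain stops at the largest such level [a]: there [U a] is exempt or has a mate nearer than
   N. *)
pose P x := (x <= v) && ((U x < l0 + N) ||
   [exists m : 'I_(U x), mate N l0 (inT T) k (U x) m && (m + N != U x)]).
have exP : exists x, P x by exists 0; rewrite /P /=; apply/orP; left; lia.
have ubP x : P x -> x <= v by case/andP.
have [a /andP[lav Pa] amax] := ex_maxnP exP ubP.
have nP x : a < x <= v -> U x >= l0 + N /\
    forall m, mate N l0 (inT T) k (U x) m -> m + N = U x.
  move=> /andP[ax xv]; have : ~~ P x by apply/negP => /amax; lia.
  rewrite /P xv /= negb_or -leqNgt => /andP[-> hx]; split=> // m hmm.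
  apply/eqP; apply: contraNT hx => hne; have lm : m < U x by case/and5P: hmm.
  by apply/existsP; exists (Ordinal lm); rewrite hmm.
have hu x : a <= x <= v -> [/\ inT T (U x), k (U x) = k (U v) & l0 <= U x].
  move=> /andP[ax xv]; rewrite -(subKn xv); have : v - x <= v - a by lia.
  elim: (v - x) => [|j IH] hj; first by rewrite subn0.
  have [Tj kj lj] := IH (ltnW hj).
  have [hq hmj] := nP (v - j) ltac:(lia).
  have [|[m hmm]] := hg _ Tj lj; first by rewrite ltnNge hq.
  have em := hmj m hmm; case/and5P: hmm => Tm lm /eqP km _ _.
  have -> : U (v - j.+1) = m.
    have e1 : v - j = (v - j.+1).+1 by lia.
    by move: em; rewrite {1}e1 mulSn; lia.
  by rewrite km.
have Tw' x : a <= x < v -> inT T (U x).+1.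
  by move=> hx; apply: hm; [lia|move=> y hy; have [] := hu y; lia].
(* A time [(U x).+1] of the colour of the chain would be a mate of [U x.+1] at distance N - 1,
   against the maximality of [a]. *)
have kw x : a <= x < v -> k (U x).+1 <> k (U v).
  move=> hx ek; have hx1 : a < x.+1 <= v by lia.
  have [hq hmj] := nP _ hx1; have [|Tx kx lx] := hu x.+1; first lia.
  have [|Tx0 kx0 lx0] := hu x; first lia.
  have hmt : mate N l0 (inT T) k (U x.+1) (U x).+1.
    by rewrite /mate Tw' // ek kx eqxx mulSn; lia.
  by have := hmj _ hmt; rewrite mulSn; lia.
apply: (@abacus_lswap l0 mu T a v v k) => //; last first.
- by move=> x hx ne; have [|? _ _] := hu x; [lia|split=> //; apply: Tw'; lia].
- by lia.
- by move=> x hx; have [] := hu x hx.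
apply: gapped_lswap => //.
- by move=> x hx; have [] := hu x hx.
- move=> x hx _ Tx ek; have [|ne] := eqVneq x v.
    by move=> e; move: Tx; rewrite e (negPf Tw).
  by apply: (kw x); [lia|rewrite -ek; have [] := hu x hx].
- move=> x hx _ _ ek; apply: (kw x); first lia.
  by rewrite -ek; have [] := hu x.+1 ltac:(lia).
- move=> _; case/orP: Pa => [|/existsP[m /andP[h1 /eqP h2]]]; first by left.
  by right; exists m.
- by move=> _; rewrite (negPf Tw).
(* The only dangerous case is [l0 = i.+1], [x = 1]: the time N + i is exempt and N + i + 1 is not.
   Then level 0 is frozen and the levels from 1 to [v] belong to the chain, which leaves no room for
   the hole required by the last hypothesis. *)
move=> x hx Tx hlt; rewrite ltn_neqAle hlt andbT; apply/eqP => ex.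
have [x1 l0i] : x = 1 /\ l0 = i.+1.
  by case: x hx Tx hlt ex => [|[|x]] hx Tx hlt ex; rewrite ?mulSn ?mul0n in ex hlt; lia.
have [y yv /negP] := hs l0i; apply.
have [->|y0] := eqVneq y 0; first by apply: hl; lia.
by have [] := hu y ltac:(lia).
Qed.

(** The mirror image of [abacus_f]: when [(U v).+1] moves down, a time exactly N above may lose its
    mate and has to move too, so the chain now climbs from [v]. *)
Lemma abacus_e l0 mu T v : l0 <= N -> abacus l0 mu T ->
  inT T (U v).+1 -> ~~ inT T (U v) ->
  (forall x, v < x -> (forall y, v < y <= x -> inT T (U y).+1) -> inT T (U x)) ->
  abacus l0 mu (lswapT v T).
Proof.
move=> hl0 [hl [k hg hc]] Tw Tu hm.
have lv : l0 <= U v by rewrite leqNgt; apply/negP => /hl; rewrite (negPf Tu).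
(* A level is bad if its time [(U x).+1] continues the chain: it has the same colour, is not exempt,
   and can only have its mate at distance N. *)
pose bad x := [&& inT T (U x).+1, k (U x).+1 == k (U v).+1, l0 + N <= (U x).+1 &
   [forall m : 'I_(U x).+1, mate N l0 (inT T) k (U x).+1 m ==> (m + N == (U x).+1)]].
have exP : exists x, (v <= x) && ~~ bad x.+1.
  (* The level [(v + M).+1] lies beyond all times of [T], so the climb ends. *)
  exists (v + M); rewrite leq_addr /=; apply/negP => /and4P[/inT_lt h _ _ _].
  move: h; have : M <= (v + M).+1 * N by rewrite -{1}[M]muln1; apply: leq_mul; lia.
  lia.
have [b /andP[lvb nbad] bmin] := ex_minnP exP.
have hb x : v < x <= b -> bad x.
  move=> hx; apply/negPn/negP => hn; have := bmin x.-1.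
  by rewrite prednK ?hn; lia.
have hw x : v <= x <= b -> inT T (U x).+1 /\ k (U x).+1 = k (U v).+1.
  move=> hx; have [->//|ne] := eqVneq x v.
  by have /and4P[? /eqP ? _ _] := hb x ltac:(lia).
have Tu' x : v < x <= b -> inT T (U x).
  by move=> hx; apply: hm; [lia|move=> y hy; have [] := hw y; lia].
have lU x : v <= x -> l0 <= U x.
  by move=> hx; apply: leq_trans lv _; rewrite leq_add2r leq_mul2r hx orbT.
have ku x : v < x <= b -> k (U x) <> k (U v).+1.
  move=> hx ek; have /and4P[Tx /eqP kx hq /forallP hall] := hb x hx.
  have lx : U x < (U x).+1 by [].
  have /implyP := hall (Ordinal lx); rewrite /mate /= Tu' // ek kx eqxx lU; last lia.
  move=> /(_ _) h; have /eqP := h ltac:(lia); lia.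
apply: (@abacus_lswap l0 mu T v b v k) => //; last first.
- move=> x hx ne; split; last by have [] := hw x hx.
  by apply: Tu'; lia.
- by lia.
- by move=> x hx; apply: lU; lia.
apply: gapped_lswap => //.
- by move=> x hx; apply: lU; lia.
- move=> x hx Tx _ ek; have [e|ne] := eqVneq x v; first by rewrite -e Tx in Tu.
  by apply: (ku x); [lia|rewrite ek; have [] := hw x hx].
- move=> x hx _ _ ek; apply: (ku x.+1); first lia.
  by rewrite ek; have [] := hw x ltac:(lia).
- by rewrite (negPf Tu).
- move=> Tb _ ek; move: nbad; rewrite /bad Tb ek.
  have [_ ->] := hw b ltac:(lia); rewrite eqxx /= negb_and -ltnNge.
  case/orP=> [|/forallPn[m]]; first by left.
  by rewrite negb_imply => /andP[h1 /eqP h2]; right; exists m.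
move=> x hx Tx hlt; rewrite ltn_neqAle hlt andbT; apply/eqP => ex.
have [x1 l0i] : x = 1 /\ l0 = i.+1.
  by case: x hx Tx hlt ex => [|[|x]] hx Tx hlt ex; rewrite ?mulSn ?mul0n in ex hlt; lia.
have [ev|nv] := eqVneq v 1; first by move: Tx; rewrite x1 -ev (negPf Tu).
have v0 : v = 0 by lia.
by move: lv; rewrite v0 l0i; lia.
Qed.

End AbacusSets.

(** * Crystal operators on two neighbouring residues *)

Section Crystal.
Variables (N K : nat).
Hypothesis N_gt0 : 0 < N.
Local Notation M := (K * N).
Implicit Types T : {set 'I_M}.

Definition wt T (r : nat) : nat := \sum_(y < K) inT T (y * N + r).

Variable i : nat.
Hypothesis iN : i.+1 < N.
Local Notation U x := (x * N + i).

Definition low_count T x : nat := \sum_(y < x) inT T (U y).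
Definition high_count T x : nat := \sum_(y < x) inT T (U y).+1.

Lemma low_countS T x : low_count T x.+1 = low_count T x + inT T (U x).
Proof. by rewrite /low_count big_ord_recr. Qed.
Lemma high_countS T x : high_count T x.+1 = high_count T x + inT T (U x).+1.
Proof. by rewrite /high_count big_ord_recr. Qed.
Lemma low_countK T : low_count T K = wt T i. Proof. by []. Qed.
Lemma high_countK T : high_count T K = wt T i.+1.
Proof. by apply: eq_bigr => y _; rewrite addnS. Qed.

Lemma low_count_le T x j : low_count T (x + j) <= low_count T x + j.
Proof. by elim: j => [|j IH]; rewrite ?addn0 // addnS low_countS; case: inT; lia. Qed.
Lemma high_count_le T x j : high_count T (x + j) <= high_count T x + j.
Proof. by elim: j => [|j IH]; rewrite ?addn0 // addnS high_countS; case: inT; lia. Qed.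
Lemma low_count_all T x j : (forall y, x <= y < x + j -> inT T (U y)) ->
  low_count T (x + j) = low_count T x + j.
Proof.
elim: j => [|j IH] h; rewrite ?addn0 // addnS low_countS h ?IH; [lia| |lia].
by move=> y hy; apply: h; lia.
Qed.
Lemma high_count_all T x j : (forall y, x <= y < x + j -> inT T (U y).+1) ->
  high_count T (x + j) = high_count T x + j.
Proof.
elim: j => [|j IH] h; rewrite ?addn0 // addnS high_countS h ?IH; [lia| |lia].
by move=> y hy; apply: h; lia.
Qed.

(* With g = high_count - low_count, f acts after the last maximum of g and e
   before the first one. *)
Definition cond_f T v := [forall x : 'I_K.+1,
  high_count T x + low_count T v + (v < x) <= high_count T v + low_count T x].
Definition cond_e T v := [forall x : 'I_K.+1,
  high_count T x + low_count T v.+1 + (x <= v) <= high_count T v.+1 + low_count T x].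

Lemma cond_fP T v : reflect (forall x, x <= K ->
  high_count T x + low_count T v + (v < x) <= high_count T v + low_count T x) (cond_f T v).
Proof.
apply: (iffP forallP) => h x; last by apply: h; rewrite -ltnS.
by move=> hx; apply: (h (Ordinal (hx : x < K.+1))).
Qed.
Lemma cond_eP T v : reflect (forall x, x <= K ->
  high_count T x + low_count T v.+1 + (x <= v) <= high_count T v.+1 + low_count T x) (cond_e T
    v).
Proof.
apply: (iffP forallP) => h x; last by apply: h; rewrite -ltnS.
by move=> hx; apply: (h (Ordinal (hx : x < K.+1))).
Qed.

(** The number of times [crystal_e] can be applied. Truncating the subtraction is harmless, because
    g vanishes at 0 and its maximum is not negative. *)
Definition eps T : nat := \max_(x < K.+1) (high_count T x - low_count T x).

Lemma eps_ge T x : x <= K -> high_count T x <= low_count T x + eps T.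
Proof.
move=> hx; rewrite -leq_subLR.
exact: (@leq_bigmax _ (fun x : 'I_K.+1 =>
  high_count T x - low_count T x) (Ordinal (hx : x < K.+1))).
Qed.

Lemma eps_ex T : exists2 x, x <= K & high_count T x = low_count T x + eps T.
Proof.
have [x hx] := @bigop.eq_bigmax _ (fun x : 'I_K.+1 =>
  high_count T x - low_count T x) ltac:(by rewrite card_ord).
have lx : x <= K by rewrite -ltnS.
have [h|h] := leqP (low_count T x) (high_count T x).
  by exists x => //; rewrite /eps hx; lia.
exists 0 => //; rewrite /eps hx {1}/low_count {1}/high_count !big_ord0; lia.
Qed.

Lemma cond_f_eps T v : v <= K -> cond_f T v -> high_count T v = low_count T v + eps T.
Proof.
move=> vK /cond_fP h; have [x xK ex] := eps_ex T.
by apply/eqP; rewrite eqn_leq eps_ge //=; have := h x xK; lia.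
Qed.

Lemma cond_e_eps T v : v < K -> cond_e T v -> high_count T v.+1 = low_count T v.+1 + eps T.
Proof.
move=> vK /cond_eP h; have [x xK ex] := eps_ex T.
by apply/eqP; rewrite eqn_leq eps_ge //=; have := h x xK; lia.
Qed.

Lemma cond_f_ex T : high_count T K < low_count T K + eps T -> exists2 v : 'I_K,
  cond_f T v & true.
Proof.
move=> hK; pose P x := (x <= K) && (high_count T x == low_count T x + eps T).
have exP : exists x, P x by have [x xK ex] := eps_ex T; exists x; rewrite /P xK ex eqxx.
have ubP x : P x -> x <= K by case/andP.
have [v /andP[vK /eqP ev] vmax] := ex_maxnP exP ubP.
have vK' : v < K by rewrite ltn_neqAle vK andbT; apply: contraTneq hK => <-; lia.
exists (Ordinal vK') => //; apply/cond_fP => x xK /=; rewrite ev.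
have := eps_ge T xK; case: ltnP => [lx|_ ]; last lia.
have : ~~ P x by apply/negP => /vmax; lia.
rewrite /P xK; lia.
Qed.

Lemma cond_e_ex T : 0 < eps T -> exists2 v : 'I_K, cond_e T v & true.
Proof.
move=> hK; pose P x := (x <= K) && (high_count T x == low_count T x + eps T).
have exP : exists x, P x by have [x xK ex] := eps_ex T; exists x; rewrite /P xK ex eqxx.
have [[|v] /andP[vK /eqP ev] vmin] := ex_minnP exP.
  by move: ev; rewrite /low_count /high_count !big_ord0; lia.
exists (Ordinal vK) => //; apply/cond_eP => x xK /=; rewrite ev.
have := eps_ge T xK; case: (leqP x v) => [lx|_]; last lia.
have : ~~ P x by apply/negP => /vmin; lia.
rewrite /P xK; lia.
Qed.

Lemma cond_f_mem T v : v < K -> cond_f T v -> inT T (U v) /\ ~~ inT T (U v).+1.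
Proof.
move=> vK /cond_fP/(_ _ vK); rewrite low_countS high_countS ltnSn.
by do 2!case: inT => //=; rewrite ?addn0 ?addn1; lia.
Qed.

Lemma cond_e_mem T v : v < K -> cond_e T v -> inT T (U v).+1 /\ ~~ inT T (U v).
Proof.
by move=> vK /cond_eP/(_ _ (ltnW vK)); rewrite low_countS high_countS leqnn; do 2!case: inT;
  lia.
Qed.

Lemma cond_f_uniq T (v v' : 'I_K) : cond_f T v -> cond_f T v' -> v = v'.
Proof.
move=> /cond_fP h /cond_fP h'; apply: ord_inj.
have := h v' (ltnW (ltn_ord v')); have := h' v (ltnW (ltn_ord v)).
by case: ltngtP; lia.
Qed.

Lemma cond_e_uniq T (v v' : 'I_K) : cond_e T v -> cond_e T v' -> v = v'.
Proof.
move=> /cond_eP h /cond_eP h'; apply: ord_inj.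
have := h v'.+1 (ltn_ord v'); have := h' v.+1 (ltn_ord v).
by case: ltngtP; lia.
Qed.

Local Notation lswapT := (lswapT iN).

Lemma lswapTU T v y : inT (lswapT v T) (U y) = if y == v then inT T (U y).+1 else inT T (U y).
Proof.
rewrite inT_lswapT; have [->|ne] := eqVneq y v; first by rewrite lswap_U ?leqnn.
by rewrite lswap_UN //; lia.
Qed.

Lemma lswapTW T v y : inT (lswapT v T) (U y).+1 = if y == v then inT T (U y) else inT T (U
  y).+1.
Proof.
rewrite inT_lswapT; have [->|ne] := eqVneq y v; first by rewrite lswap_W ?leqnn.
by rewrite lswap_WN //; lia.
Qed.

Lemma low_count_swap T v x : inT T (U v) -> ~~ inT T (U v).+1 ->
  low_count (lswapT v T) x + (v < x) = low_count T x.
Proof.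
move=> hu hw; elim: x => [|x IH]; first by rewrite /low_count !big_ord0.
rewrite !low_countS lswapTU -{1}IH; have [->|ne] := eqVneq x v.
  by rewrite hu (negPf hw) ltnn ltnSn; lia.
by rewrite ltnS (leq_eqVlt v) eq_sym (negPf ne); lia.
Qed.

Lemma high_count_swap T v x : inT T (U v) -> ~~ inT T (U v).+1 ->
  high_count (lswapT v T) x = high_count T x + (v < x).
Proof.
move=> hu hw; elim: x => [|x IH]; first by rewrite /high_count !big_ord0.
rewrite !high_countS lswapTW IH; have [->|ne] := eqVneq x v.
  by rewrite hu (negPf hw) ltnn ltnSn; lia.
by rewrite ltnS (leq_eqVlt v) eq_sym (negPf ne); lia.
Qed.

(** The swap adds 2 to g after [v] and nothing before. The values after the last maximum [v] were
    smaller by at least 1, and [v.+1] by exactly 1, so [v.+1] becomes the first maximum. *)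
Lemma cond_fe T (v : 'I_K) : inT T (U v) -> ~~ inT T (U v).+1 ->
  cond_e (lswapT v T) v = cond_f T v.
Proof.
move=> hu hw; have gu x := low_count_swap x hu hw; have gw x := high_count_swap x hu hw.
apply/cond_eP/cond_fP => h x xK; have := h x xK; have := gu x; have := gu v.+1;
  rewrite !gw !(low_countS T) !(high_countS T) hu (negPf hw) ltnSn; case: (ltnP v x); lia.
Qed.

Definition crystal_f T := if [pick v : 'I_K | cond_f T v] is Some v then lswapT v T else T.
Definition crystal_e T := if [pick v : 'I_K | cond_e T v] is Some v then lswapT v T else T.

Lemma crystal_fE T (v : 'I_K) : cond_f T v -> crystal_f T = lswapT v T.
Proof.
move=> h; rewrite /crystal_f; case: pickP => [v' h'|/(_ v)]; last by rewrite h.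
by rewrite (cond_f_uniq h h').
Qed.
Lemma crystal_eE T (v : 'I_K) : cond_e T v -> crystal_e T = lswapT v T.
Proof.
move=> h; rewrite /crystal_e; case: pickP => [v' h'|/(_ v)]; last by rewrite h.
by rewrite (cond_e_uniq h h').
Qed.

Lemma modU_other r v y : r < N -> r != i -> r != i.+1 ->
  forall T, inT (lswapT v T) (y * N + r) = inT T (y * N + r).
Proof.
move=> rN ri ri1 T; rewrite inT_lswapT lswap_N // => x _.
by split=> e; have := congr1 (modn^~ N) e; rewrite modnMDl modn_small //;
  rewrite ?(divmodU iN x).2 ?(divmodW iN x).2; lia.
Qed.

Lemma crystal_fP T : high_count T K < low_count T K + eps T -> exists2 v : 'I_K, cond_f T v &
  [/\ crystal_f T = lswapT v T, crystal_e (crystal_f T) = T, (forall r,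
    r < N -> r != i -> r != i.+1 -> wt (crystal_f T) r = wt T r)
   & [/\ (wt (crystal_f T) i).+1 = wt T i,
     wt (crystal_f T) i.+1 = (wt T i.+1).+1 & eps (crystal_f T) = (eps T).+1]].
Proof.
move=> h; have [v hv _] := cond_f_ex h; exists v => //.
have [hu hw] := cond_f_mem (ltn_ord v) hv; rewrite (crystal_fE hv).
have he : cond_e (lswapT v T) v by rewrite cond_fe.
have gK := low_count_swap K hu hw; have wK := high_count_swap K hu hw; rewrite ltn_ord in gK wK.
split=> //; first by rewrite (crystal_eE he) lswapTK.
  by move=> r rN ri ri1; apply: eq_bigr => y _; rewrite modU_other.
rewrite -!high_countK -!low_countK; split; try lia.
have := cond_f_eps (ltnW (ltn_ord v)) hv; have := cond_e_eps (ltn_ord v) he.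
have := low_count_swap v.+1 hu hw; have := high_count_swap v.+1 hu hw.
rewrite !(low_countS T) !(high_countS T) hu (negPf hw) ltnSn; lia.
Qed.

Lemma crystal_eP T : 0 < eps T -> exists2 v : 'I_K, cond_e T v &
  [/\ crystal_e T = lswapT v T, crystal_f (crystal_e T) = T, (forall r,
    r < N -> r != i -> r != i.+1 -> wt (crystal_e T) r = wt T r)
   & [/\ wt (crystal_e T) i = (wt T i).+1,
     (wt (crystal_e T) i.+1).+1 = wt T i.+1 & (eps (crystal_e T)).+1 = eps T]].
Proof.
move=> h; have [v hv _] := cond_e_ex h; exists v => //.
have [hw hu] := cond_e_mem (ltn_ord v) hv; rewrite (crystal_eE hv).
set T' := lswapT v T; have eT : T = lswapT v T' by rewrite lswapTK.
have hu' : inT T' (U v) by rewrite lswapTU eqxx.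
have hw' : ~~ inT T' (U v).+1 by rewrite lswapTW eqxx.
have hf : cond_f T' v by rewrite -(cond_fe hu' hw') -eT.
have lt : high_count T' K < low_count T' K + eps T'.
  have /cond_fP/(_ K (leqnn _)) := hf; rewrite ltn_ord.
  by have := cond_f_eps (ltnW (ltn_ord v)) hf; lia.
have [v' hv' [e1 e2 e3 [e4 e5 e6]]] := crystal_fP lt.
rewrite (crystal_fE hf) -eT in e1 e2 e3 e4 e5 e6 *.
by split=> // r rN ri ri1; rewrite e3.
Qed.

(** This is the bracket condition of [abacus_f]: if [(U x).+1] were missing while every [U y] from
    [x] up to [v] is present, g would drop strictly from [x] to [v], and [v] would not be a
    maximum. *)
Lemma cond_f_match T v x : v < K -> cond_f T v -> x < v ->
  (forall y, x <= y < v -> inT T (U y)) -> inT T (U x).+1.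
Proof.
move=> vK /cond_fP h xv hall; have := h x ltac:(lia).
have e : x + (v - x) = v by lia.
have := @low_count_all T x (v - x); rewrite e => /(_ hall) ->.
have := high_count_le T x.+1 (v - x.+1); rewrite high_countS.
have -> : x.+1 + (v - x.+1) = v by lia.
by case: inT; lia.
Qed.

Lemma cond_e_match T v x : v < K -> cond_e T v -> v < x ->
  (forall y, v < y <= x -> inT T (U y).+1) -> inT T (U x).
Proof.
move=> vK /cond_eP h vx hall.
have xK : x < K.
  have /inT_lt hx : inT T (U x).+1 by apply: hall; lia.
  by rewrite -(@ltn_pmul2r N) //; lia.
have := h x.+1 xK; have e : v.+1 + (x - v) = x.+1 by lia.
have := @high_count_all T v.+1 (x - v); rewrite e => ->; last by move=> y hy; apply: hall; lia.
have := low_count_le T v.+1 (x - v.+1); have -> : v.+1 + (x - v.+1) = x by lia.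
by rewrite [low_count T x.+1]low_countS; case: inT; lia.
Qed.

(** If g is positive at [x], fewer than [x] of the times [U y] with [y < x] are present, because
    [high_count] is at most [x]. This gives the hole needed when [l0 = i.+1]. *)
Lemma abacus_cond_f l0 mu T (v : 'I_K) : l0 <= N -> abacus l0 mu T -> cond_f T v ->
  (l0 = i.+1 -> exists2 x, x <= v & low_count T x < high_count T x) -> abacus l0 mu (lswapT v
    T).
Proof.
move=> hl0 hg hv hx; have [hu hw] := cond_f_mem (ltn_ord v) hv.
apply: abacus_f => //; first by move=> x; apply: cond_f_match.
move=> e; have [x xv lt] := hx e; have lGw := high_count_le T 0 x; rewrite add0n in lGw.
have : ~~ [forall y : 'I_x, inT T (U y)].
  apply/forallP => hall; have := @low_count_all T 0 x; rewrite add0n => /(_ _)hh.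
  have := hh (fun y (hy : 0 <= y < x) => hall (Ordinal (proj2 (andP hy)))).
  by move: lt lGw; rewrite /low_count /high_count big_ord0 [\sum_(y < 0) _]big_ord0; lia.
by rewrite negb_forall => /existsP[y hy]; exists y => //; apply: leq_trans xv.
Qed.

Lemma abacus_cond_e l0 mu T (v : 'I_K) : l0 <= N -> abacus l0 mu T -> cond_e T v ->
  abacus l0 mu (lswapT v T).
Proof.
move=> hl0 hg hv; have [hw hu] := cond_e_mem (ltn_ord v) hv.
by apply: abacus_e => // x; apply: cond_e_match.
Qed.

End Crystal.

(** * Alternants and the counting inequality *)

Section Alternants.
Local Open Scope ring_scope.
Variables (N : nat) (x : rat).
Implicit Types al be : 'I_N -> nat.

(* The alternant of the weight al at the point (1, x, x^2, ...). *)
Definition alternant al : rat :=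
  \det (\matrix_(j < N, r < N) x ^+ ((al r + (N - r.+1)) * j)).

Definition wmon al : rat := \prod_(j < N) x ^+ (al j * j).

Lemma alternant_ext al be : al =1 be -> alternant al = alternant be.
Proof. by move=> h; congr (\det _); apply/matrixP => j r; rewrite !mxE h. Qed.

Lemma alternant_swap al be (a b : 'I_N) : b = a.+1 :> nat ->
  (be a + 1 = al b)%N -> (be b = al a + 1)%N ->
  (forall r, r != a -> r != b -> be r = al r) -> alternant be = - alternant al.
Proof.
move=> eb ha hb hr; set A := \matrix_(j < N, r < N) x ^+ ((al r + (N - r.+1)) * j).
have -> : alternant be = \det (col_perm (tperm a b) A).
  congr (\det _); apply/matrixP => j r; rewrite !mxE.
  congr (x ^+ (_ * _)); case: tpermP => [->|->|/eqP ra /eqP rb]; last by rewrite hr.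
    by have := ltn_ord b; lia.
  by have := ltn_ord b; lia.
have ab : a != b by rewrite -val_eqE /= eb; lia.
by rewrite col_permE det_mulmx det_perm odd_permV odd_tperm ab expr1 mulrN1.
Qed.

Lemma alternant_eq0 al (a b : 'I_N) : b = a.+1 :> nat -> (al a + 1 = al b)%N -> alternant al =
  0.
Proof.
move=> eb h; have /eqP : alternant al = - alternant al by apply: (@alternant_swap _ _ a b) =>
  //; lia.
by rewrite -addr_eq0 -mulr2n mulrn_eq0 /= => /eqP.
Qed.

(** In the expansion of the determinant the term of [s] is multiplied by the symmetric sum, which
    may first be translated by [s * rho]. The freedom in [rho] allows the residues to be
    relabelled. *)
Lemma alternant_mul (X : finType) (Y : pred X) (w : X -> 'I_N -> nat) al (rho : 'S_N) :
  (forall s : 'S_N, \sum_(T | Y T) wmon (w T \o s) = \sum_(T | Y T) wmon (w T)) ->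
  alternant al * \sum_(T | Y T) wmon (w T) =
  \sum_(T | Y T) alternant (fun r => al r + w T (rho r))%N.
Proof.
move=> hw; rewrite /alternant /determinant mulr_suml.
rewrite [RHS]exchange_big /=; apply: eq_bigr => s _.
rewrite -mulr_sumr -mulrA; congr (_ * _).
rewrite -(hw (s * rho)%g) mulr_sumr; apply: eq_bigr => T _.
rewrite -big_split /=; apply: eq_bigr => j _; rewrite !mxE -exprD permM.
by congr (x ^+ _); lia.
Qed.

Hypothesis x_gt1 : 1 < x.

(** Both are Vandermonde products with strictly decreasing exponents, so every factor is negative.
    The number of factors depends on N, hence only a product of two alternants has a definite
    sign. *)
Lemma alternant_pos al be : (forall i j : 'I_N, (i <= j)%N -> (al j <= al i)%N) ->
  (forall i j : 'I_N, (i <= j)%N -> (be j <= be i)%N) -> 0 < alternant al * alternant be.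
Proof.
have V ga : alternant ga = \prod_(i < N) \prod_(j < N | (i < j)%N)
    (x ^+ (ga j + (N - j.+1)) - x ^+ (ga i + (N - i.+1))).
  pose y : 'rV_N := \row_r x ^+ (ga r + (N - r.+1)).
  transitivity (\det (Vandermonde N y)).
    by congr (\det _); apply/matrixP => j r; rewrite !mxE exprM.
  by rewrite det_Vandermonde; do 2!(apply: eq_bigr => ? _); rewrite !mxE.
move=> ha hb; rewrite !V -big_split; apply: prodr_gt0 => i _.
rewrite -big_split; apply: prodr_gt0 => j ij /=.
have lt ga : (forall i j : 'I_N, (i <= j)%N -> (ga j <= ga i)%N) ->
  x ^+ (ga j + (N - j.+1)) - x ^+ (ga i + (N - i.+1)) < 0.
  move=> h; rewrite subr_lt0 ltr_eXn2l //; have := h i j (ltnW ij).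
  by have := ltn_ord j; lia.
by rewrite nmulr_rgt0 lt.
Qed.

Lemma wmon_ge1 al : 1 <= wmon al.
Proof.
rewrite /wmon; elim/big_ind: _ => // [u v hu hv|i _]; last by rewrite exprn_ege1 // ltW.
by rewrite -[1]mulr1 ler_pM.
Qed.

End Alternants.

Lemma big_invol (R : Type) (idx : R) (op : Monoid.com_law idx) (X : finType)
    (V : pred X) (phi : X -> X) (F : X -> R) :
  (forall T, V T -> V (phi T) /\ phi (phi T) = T) ->
  \big[op/idx]_(T | V T) F T = \big[op/idx]_(T | V T) F (phi T).
Proof.
move=> h; rewrite [LHS](reindex_onto phi phi) => [|T /h[] //].
apply: eq_bigl => T; apply/andP/idP => [[/h[VT _] /eqP e]|/h[-> ->]] //.
by rewrite -e.
Qed.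

(** * Cancellation of the non-dominant sets *)

Section Family.
Variables (N K : nat).
Hypothesis N_gt0 : 0 < N.
Local Notation M := (K * N).
Implicit Types T : {set 'I_M}.

Section Node.
Variable i : nat.
Hypothesis iN : i.+1 < N.

(** The flip of crystal strings inside [V]. Closure under [crystal_e] is demanded only while [eps]
    exceeds [b], since the shifted flip never enters the last [b] steps of a string. *)
Lemma weight_flip (V : pred {set 'I_M}) b :
  (forall T, V T -> b <= eps i T) ->
  (forall T (v : 'I_K), V T -> cond_f i T v -> V (lswapT iN v T)) ->
  (forall T (v : 'I_K), V T -> cond_e i T v -> b < eps i T -> V (lswapT iN v T)) ->
  exists phi, forall T, V T -> [/\ V (phi T), phi (phi T) = T,
    forall r, r < N -> r != i -> r != i.+1 -> wt (phi T) r = wt T r,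
    wt (phi T) i + b = wt T i.+1 & wt (phi T) i.+1 = wt T i + b].
Proof.
move=> Vb Vf Ve.
(* The quantity constant along a string: the weights of all residues other than [i] and [i.+1]. *)
pose o T := [ffun r : 'I_N => if (r == i :> nat) || (r == i.+1 :> nat) then 0 else wt T r].
have oP T T' : (forall r, r < N -> r != i -> r != i.+1 -> wt T' r = wt T r) -> o T' = o T.
  by move=> h; apply/ffunP => r; rewrite !ffunE; case: ifP => // /norP[h1 h2]; apply: h.
exists (sflip (crystal_f iN) (crystal_e iN) (fun T => wt T i) (fun T => wt T i.+1) b) => T VT.
have [|||V1 e1 o1 a1 b1] := @sflipP _ _ V (crystal_f iN) (crystal_e iN) (fun T =>
  wt T i) (fun T => wt T i.+1) (eps i) o b _ _ _ T VT.
- by move=> T' V'; split; [exact: Vb|rewrite /= -(low_countK i) -(high_countK i);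
  apply: eps_ge].
- move=> T' V' lt; have [|v hv [ef ee ho [h1 h2 h3]]] := @crystal_fP _ _ N_gt0 _ iN T';
  first by rewrite low_countK high_countK.
  by split; [rewrite ef; apply: Vf|..] => //; apply: oP.
- move=> T' V' lt; have [|v hv [ef ee ho [h1 h2 h3]]] := @crystal_eP _ _ N_gt0 _ iN T';
  first lia.
  by split; [rewrite ef; apply: Ve|..] => //; apply: oP.
split=> // r rN ri ri1; move/ffunP/(_ (Ordinal rN)): o1.
by rewrite !ffunE /= (negPf ri) (negPf ri1).
Qed.

End Node.

Definition prefix_wt T r tau : nat := \sum_(y < K) (inT T (y * N + r) && (y * N + r < tau)).

Definition dominant T tau := [forall t : 'I_tau.+1, forall r : 'I_N,
  (r.+1 < N) ==> (prefix_wt T r.+1 t <= prefix_wt T r t)].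

Lemma dominantP T tau : reflect (forall t r,
  t <= tau -> r.+1 < N -> prefix_wt T r.+1 t <= prefix_wt T r t)
  (dominant T tau).
Proof.
apply: (iffP forallP) => [h t r ht hr|h t].
  have /forallP/(_ (Ordinal (ltnW hr)))/implyP := h (Ordinal (ht : t < tau.+1)); exact.
by apply/forallP => r; apply/implyP; apply: h; rewrite -ltnS.
Qed.

(* tau is the first time after which the weight of the times so far is not a
   partition. *)
Definition violation T tau := dominant T tau && ~~ dominant T tau.+1.

Lemma prefix_wt_ext T T' tau t r : (forall s, s <= tau -> inT T' s = inT T s) ->
  t <= tau.+1 -> prefix_wt T' r t = prefix_wt T r t.
Proof.
move=> h ht; apply: eq_bigr => y _; case: (ltnP _ t) => ly; last by rewrite !andbF.
by rewrite h //; lia.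
Qed.

Lemma violation_ext T T' tau : (forall s, s <= tau -> inT T' s = inT T s) ->
  violation T' tau = violation T tau.
Proof.
move=> h; rewrite /violation; congr (_ && ~~ _).
  by apply/dominantP/dominantP => hd t r ht hr; move: (hd t r ht hr);
    rewrite !(prefix_wt_ext _ h) //; lia.
by apply/dominantP/dominantP => hd t r ht hr; move: (hd t r ht hr);
  rewrite !(prefix_wt_ext _ h) //; lia.
Qed.

Lemma prefix_wt0 T r : prefix_wt T r 0 = 0.
Proof. by rewrite /prefix_wt big1 // => y _; rewrite ltn0 andbF. Qed.

Lemma prefix_wt_full T r : r < N -> prefix_wt T r M = wt T r.
Proof.
move=> hr; apply: eq_bigr => y _; rewrite (_ : _ < _); first by rewrite andbT.
by have : y.+1 * N <= M; [rewrite leq_mul2r ltn_ord orbT|rewrite mulSn; lia].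
Qed.

Lemma prefix_wtS T r tau : r < N ->
  prefix_wt T r tau.+1 = prefix_wt T r tau + (inT T tau && (tau %% N == r)).
Proof.
move=> hr; case Tt: (inT T tau && _); last first.
  rewrite addn0 /prefix_wt; apply: eq_bigr => y _; rewrite ltnS leq_eqVlt; case: eqP => //= e.
  by move: Tt; rewrite -e modnMDl modn_small // eqxx andbT => ->.
case/andP: Tt => Tt /eqP er; have tM := inT_lt Tt.
have yK : tau %/ N < K by rewrite ltn_divLR.
rewrite /prefix_wt (bigD1 (Ordinal yK)) // [in RHS](bigD1 (Ordinal yK)) //=.
rewrite -er -divn_eq Tt ltnSn ltnn addn1 add1n add0n; congr _.+1.
apply: eq_bigr => y ne; rewrite ltnS leq_eqVlt; case: eqP => //= e.
case/eqP: ne; apply: val_inj => /=.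
by rewrite -[in RHS]e er divnMDl // divn_small ?addn0.
Qed.

Lemma prefix_wt_level T r x t : r < N -> x <= K -> x * N <= t + (N - r.+1) -> t + (N - r.+1) <
  x.+1 * N ->
  prefix_wt T r t = \sum_(y < x) inT T (y * N + r).
Proof.
move=> hr xK h1 h2; rewrite /prefix_wt (big_ord_widen K (fun y =>
  nat_of_bool (inT T (y * N + r)))) //.
rewrite [RHS]big_mkcond /=; apply: eq_bigr => y _; case: (ltnP y x) => hy.
  have : y.+1 * N <= x * N by rewrite leq_mul2r hy orbT.
  rewrite mulSn => ?; rewrite (_ : _ < t) ?andbT //; lia.
have : x.+1 * N <= y.+1 * N by rewrite leq_mul2r ltnS hy orbT.
rewrite mulSn => ?; rewrite (_ : (_ < t) = false) ?andbF //; lia.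
Qed.

(** Only the time [tau] itself can have broken dominance, so it belongs to [T], has a residue
    [i.+1], and creates an excess of exactly one. Dominance at the times [y * N] says that g was not
    positive before. *)
Lemma violationP T tau : violation T tau -> exists i x (iN : i.+1 < N), [/\ x < K,
  tau = x * N + i.+1, high_count i T x.+1 = (low_count i T x.+1).+1 &
  forall y, y <= x -> high_count i T y <= low_count i T y].
Proof.
case/andP => /dominantP hd nd.
have [t [r [ht hr hlt]]] : exists t r, [/\ t <= tau.+1,
  r.+1 < N & prefix_wt T r t < prefix_wt T r.+1 t].
  move: nd; rewrite negb_forall => /existsP[t]; rewrite negb_forall => /existsP[r].
  rewrite negb_imply -ltnNge => /andP[h1 h2].
  by exists t, r; split=> //; rewrite -ltnS.
have et : t = tau.+1.
  apply/eqP; rewrite eqn_leq ht leqNgt; apply/negP => lt.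
  by have := hd t r lt hr; lia.
have hrN : r < N by lia.
move: (hd tau r (leqnn _) hr) hlt; rewrite et !prefix_wtS //.
case Tt: (inT T tau) => /=; last lia.
case: (tau %% N =P r.+1) => er; last lia.
rewrite er (_ : (r.+1 == r) = false); last by apply/eqP; lia.
move=> h1 h2; have xK : tau %/ N < K by rewrite ltn_divLR //; apply: inT_lt Tt.
have etau := divn_eq tau N; rewrite er in etau.
exists r, (tau %/ N), hr; split=> //.
  move: (tau %/ N) etau xK => x etau xK.
  have eu : prefix_wt T r tau = low_count r T x.+1.
    rewrite (@prefix_wt_level T r x.+1) // ?etau ?mulSn; lia.
  have ew : prefix_wt T r.+1 tau = high_count r T x.
    rewrite (@prefix_wt_level T r.+1 x) // ?etau ?mulSn; try lia.
    by apply: eq_bigr => y _; rewrite addnS.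
  by rewrite high_countS -ew -addnS -etau Tt -eu; lia.
move=> y hy; have yx : y * N <= tau %/ N * N by rewrite leq_mul2r hy orbT.
have := hd (y * N) r ltac:(lia) hr.
rewrite (@prefix_wt_level T r y) ?mulSn; try lia.
rewrite (@prefix_wt_level T r.+1 y) ?mulSn; try lia.
by congr (_ <= _); apply: eq_bigr => z _; rewrite addnS.
Qed.

Lemma dominant_wt T : dominant T M -> forall r r', r <= r' -> r' < N -> wt T r' <= wt T r.
Proof.
move=> /dominantP h r r' hrr; elim: r' hrr => [|r' IH]; first by rewrite leqn0 => /eqP ->.
rewrite leq_eqVlt => /orP[/eqP -> //|hr] hN.
apply: leq_trans (IH hr (ltnW hN)); rewrite -!prefix_wt_full ?h //; lia.
Qed.

Variables (l0 : nat) (mu : seq nat).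
Hypothesis l0N : l0 <= N.

Definition abacus_set : {set {set 'I_M}} := [set T | `[< abacus l0 mu T >]].

Lemma abacus_setP T : reflect (abacus l0 mu T) (T \in abacus_set).
Proof. by rewrite inE; apply: asboolP. Qed.

(* The reflection after the violation swaps two neighbouring entries of the
   shifted weight, hence changes the sign of the alternant. *)
Lemma alternant_violation (x : rat) tau :
  (\sum_(T in abacus_set | violation T tau) alternant x (fun r : 'I_N => wt T r) = 0)%R.
Proof.
have [|] := boolP [exists T in abacus_set, violation T tau]; last first.
  rewrite negb_exists => /forallP h; rewrite big1 // => T hT.
  by have := h T; rewrite hT.
case/existsP=> T0 /andP[_ /violationP[i [x0 [iN [x0K etau _ _]]]]].
pose V := [pred T | (T \in abacus_set) && violation T tau].
have VP T : V T -> high_count i T x0.+1 = (low_count i T x0.+1).+1 /\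
    forall y, y <= x0 -> high_count i T y <= low_count i T y.
  case/andP=> _ /violationP[i' [x' [iN' [_ e' h1 h2]]]].
  have := congr1 (modn^~ N) e'; rewrite etau /= !modnMDl !modn_small //.
  case=> ei; subst i'; have /eqP : x0 * N = x' * N by lia.
  by rewrite eqn_pmul2r // => /eqP ->.
(* A swap on a level above [x0] touches no time up to [tau], so it keeps the violation. *)
have Vext T (v : 'I_K) : x0 < v -> V T -> abacus l0 mu (lswapT iN v T) -> V (lswapT iN v T).
  move=> hv /andP[_ hviol] hj /=; apply/andP; split; first by apply/abacus_setP.
  rewrite (@violation_ext T) // => s hs; rewrite inT_lswapT lswap_N // => y hy.
  have : x0.+1 * N <= y * N by rewrite leq_mul2r; lia.
  by rewrite mulSn; lia.
have epsV T : V T -> 0 < eps i T.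
  by move=> /VP[h1 _]; have := eps_ge i T x0K; lia.
have [||phi hphi] := @weight_flip i iN V 1 epsV.
- move=> T v VT hv; have [h1 h2] := VP T VT; have x0v : x0 < v.
    rewrite ltnNge; apply/negP => /h2; have := cond_f_eps N_gt0 iN (ltnW (ltn_ord v)) hv.
    by have := epsV T VT; lia.
  apply: Vext => //; case/andP: (VT) => /abacus_setP hj _.
  by apply: abacus_cond_f => // _; exists x0.+1; rewrite // h1.
(* Here [eps] exceeds 1, while g is at most 0 up to [x0] and equals 1 at [x0.+1]; so the first
   maximum [v.+1] comes strictly later. This is why the flip is shifted by one. *)
- move=> T v VT hv lt; have [h1 h2] := VP T VT; have x0v : x0 < v.
    rewrite ltnNge; apply/negP => hv0; have := cond_e_eps N_gt0 iN (ltn_ord v) hv.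
    have [/h2|] := leqP v.+1 x0; first lia.
    move=> h3; have -> : nat_of_ord v = x0 by lia.
    by rewrite h1; lia.
  by apply: Vext => //; case/andP: (VT) => /abacus_setP hj _; apply: abacus_cond_e.
have inv T : V T -> V (phi T) /\ phi (phi T) = T by move=> /hphi[].
have e1 := @big_invol _ 0%R _ _ V phi (fun T => alternant x (fun r : 'I_N => wt T r)) inv.
have e2 : (\sum_(T | V T) alternant x (fun r : 'I_N => wt (phi T) r) =
  - \sum_(T | V T) alternant x (fun r : 'I_N => wt T r))%R.
  rewrite -sumrN; apply: eq_bigr => T /hphi[_ _ h1 h2 h3].
  by apply: (@alternant_swap _ _ _ _ (Ordinal (ltnW iN)) (Ordinal iN)) => // r hr1 hr2;
    apply: h1.
by move/eqP: (etrans (e1 _) e2); rewrite -addr_eq0 -mulr2n mulrn_eq0 /= => /eqP.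
Qed.

(** The sets are discarded in the order of their first violation, one value of [tau] at a time. *)
Lemma alternant_dominant (x : rat) tau :
  (\sum_(T in abacus_set) alternant x (fun r : 'I_N => wt T r) =
   \sum_(T in abacus_set | dominant T tau) alternant x (fun r : 'I_N => wt T r))%R.
Proof.
elim: tau => [|tau ->].
  apply: eq_bigl => T; rewrite (_ : dominant T 0) ?andbT //.
  by apply/dominantP => t r; rewrite leqn0 => /eqP ->; rewrite !prefix_wt0.
rewrite (bigID (fun T => dominant T tau.+1)) /=.
rewrite [X in (_ + X)%R](_ : _ = 0)%R ?addr0.
  apply: eq_bigl => T; rewrite -andbA; case: (T \in abacus_set) => //=.
  case hd: (dominant T tau.+1); rewrite ?andbF ?andbT //.
  by apply/dominantP => t r ht; have /dominantP := hd; apply; lia.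
by rewrite -[RHS](alternant_violation x tau); apply: eq_bigl => T; rewrite -andbA.
Qed.

End Family.

Lemma card_ord_lt (N l : nat) : l <= N -> #|[set r : 'I_N | r < l]| = l.
Proof.
move=> lN; rewrite -sum1_card (eq_bigl (fun r : 'I_N => r < l)); last by move=> r; rewrite inE.
by rewrite -(big_ord_widen N (fun=> 1)) // sum1_card card_ord.
Qed.

Section Elementary.
Variables (N l : nat) (x : rat).
Hypothesis lN : l <= N.
Local Open Scope ring_scope.

Definition omega (r : 'I_N) : nat := (r < l)%N.

Definition esum : rat := \sum_(S : {set 'I_N} | #|S| == l) wmon x (fun r => (r \in S : nat)).

(** Pieri's rule for the empty partition. A set S that is not an initial segment has some r outside
    with r + 1 inside, which produces two equal columns; only the initial segment survives. *)
Lemma alternant_omega : alternant x omega = alternant x (fun _ : 'I_N => 0%N) * esum.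
Proof.
rewrite (@alternant_mul N x _ _ (fun (S : {set 'I_N}) r => (r \in S : nat)) _ 1%g); last first.
  move=> s; rewrite [LHS](reindex (fun S : {set 'I_N} => s @: S)) /=.
    apply: eq_big => S; first by rewrite card_imset //; apply: perm_inj.
    move=> _; congr wmon; apply: funext => r /=.
    by rewrite mem_imset //; apply: perm_inj.
  exists (fun S : {set 'I_N} => s^-1%g @: S) => S _; rewrite -imset_comp -[RHS]imset_id;
    by apply: eq_imset => i /=; rewrite ?permK ?permKV.
pose S0 := [set r : 'I_N | (r < l)%N].
rewrite (bigD1 S0) /=; last by rewrite card_ord_lt.
rewrite big1 ?addr0; first by apply: alternant_ext => r; rewrite perm1 inE.
move=> S /andP[/eqP cS nS].
have [|] := boolP [exists r : 'I_N, [exists r' : 'I_N, [&& r' == r.+1 :> nat,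
  r \notin S & r' \in S]]].
  case/existsP=> r /existsP[r' /and3P[/eqP h1 h2 h3]].
  by apply: (@alternant_eq0 _ _ _ r r') => //; rewrite !perm1 h3 (negPf h2).
rewrite negb_exists => /forallP h; case/eqP: nS; apply/eqP.
rewrite eqEcard card_ord_lt // cS leqnn andbT; apply/subsetP => r rS.
rewrite inE -cS -(@card_ord_lt N r.+1) //; apply: subset_leq_card.
(* Without such an r the set is closed downwards. *)
have dn d (q : 'I_N) : (q + d)%N = r -> q \in S.
  elim: d q => [|d IH] q; first by rewrite addn0 => /val_inj ->.
  move=> e; have qN : (q.+1 < N)%N by have := ltn_ord r; lia.
  have := h q; rewrite negb_exists => /forallP/(_ (Ordinal qN)).
  by rewrite eqxx (IH (Ordinal qN)) /= ?andbT ?negbK //; lia.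
by apply/subsetP => q; rewrite inE ltnS => hq; apply: (dn (r - q)%N); rewrite subnKC.
Qed.

End Elementary.

Section Symmetry.
Variables (N K : nat).
Hypothesis N_gt0 : 0 < N.
Variable (mu : seq nat).
Local Notation J := (@abacus_set N K 0 mu).
Local Notation w T := (fun r : 'I_N => wt T r).
Local Open Scope ring_scope.

Definition wsym (s : 'S_N) := forall F : ('I_N -> nat) -> rat,
  \sum_(T in J) F (w T \o s) = \sum_(T in J) F (w T).

Lemma wsymM s s' : wsym s -> wsym s' -> wsym (s * s')%g.
Proof.
move=> h h' F; rewrite -h -(h' (fun u => F (u \o s))); apply: eq_bigr => T _.
by congr F; apply: funext => r /=; rewrite permM.
Qed.

(** With [l0 = 0] the boundary case of [abacus_cond_f] cannot occur, so the whole family is closed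
    under the crystal operators and the flip with [b = 0] exchanges two neighbouring weights. *)
Lemma wsym_adj (a b : 'I_N) : b = a.+1 :> nat -> wsym (tperm a b).
Proof.
move=> eb F; have iN : (a.+1 < N)%N by rewrite -eb.
have [|||phi hphi] := @weight_flip N K N_gt0 a iN (mem J) 0.
- by [].
- by move=> T v /abacus_setP hj hv; apply/abacus_setP; apply: abacus_cond_f.
- by move=> T v /abacus_setP hj hv _; apply/abacus_setP; apply: abacus_cond_e.
have inv T : T \in J -> phi T \in J /\ phi (phi T) = T by move=> /hphi[].
rewrite [RHS](@big_invol _ _ _ _ (mem J) phi _ inv); apply: eq_bigr => T /hphi[_ _ h1 h2 h3].
congr F; apply: funext => r /=; case: tpermP => [->|->|/eqP ra /eqP rb].
- by rewrite eb; lia.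
- by rewrite eb; lia.
- by rewrite h1 // -eb.
Qed.

Lemma wsym_tperm (a b : 'I_N) : (a < b)%N -> wsym (tperm a b).
Proof.
move: {2}(b - a.+1)%N (leqnn (b - a.+1)%N) => d; elim: d b => [|d IH] b hd hab.
  by apply: wsym_adj; lia.
have [e|ne] := eqVneq (b : nat) a.+1; first exact: wsym_adj.
have cN : (b.-1 < N)%N by have := ltn_ord b; lia.
pose c := Ordinal cN.
have -> : tperm a b = (tperm c b * (tperm a c * tperm c b))%g.
  have := tpermJ a c (tperm c b); rewrite tpermL tpermD; first by rewrite conjgE tpermV => <-.
    by rewrite -val_eqE /=; lia.
  by rewrite -val_eqE /=; lia.
have hcb : wsym (tperm c b) by apply: wsym_adj => /=; lia.
by do 2!apply: wsymM => //; apply: IH => /=; lia.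
Qed.

Lemma wsym_all s : wsym s.
Proof.
have [ts -> _] := prod_tpermP s; elim: ts => [|[a b] ts IH].
  by rewrite big_nil => F; apply: eq_bigr => T _; congr F; apply: funext => r /=; rewrite perm1.
rewrite big_cons; apply: wsymM IH => /=.
case: (ltngtP a b) => [|h|/val_inj ->]; first exact: wsym_tperm.
  by rewrite tpermC; apply: wsym_tperm.
by move=> F; apply: eq_bigr => T _; congr F; apply: funext => r /=; rewrite tperm1 perm1.
Qed.

Definition Jsum (x : rat) : rat := \sum_(T in J) wmon x (w T).

Lemma alternant_Jsum x al (rho : 'S_N) :
  alternant x al * Jsum x = \sum_(T in J) alternant x (fun r => (al r + wt T (rho r))%N).
Proof.
rewrite -(@alternant_mul N x _ (mem J) (fun T r => wt T r)) // => s.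
exact: (wsym_all s (wmon x)).
Qed.

End Symmetry.

(** * The inequality for one more row *)

Section Step.
Variables (N K l : nat) (mu mu' : seq nat).
Hypotheses (N_gt0 : 0 < N) (lN : l <= N).
Variables (shift : {set 'I_(K * N)} -> {set 'I_(K.+1 * N)}) (rho : 'S_N).
Hypothesis shift_inj : injective shift.
Hypothesis shift_wt : forall U (r : 'I_N), wt (shift U) r = omega l r + wt U (rho r).
Hypothesis shift_abacus_set : shift @: @abacus_set N K 0 mu' = @abacus_set N K.+1 l mu'.
Hypothesis sub_abacus_set : @abacus_set N K.+1 l mu' \subset @abacus_set N K.+1 0 mu.

(** After multiplication by the square of the alternant of 0, both sides are sums of products of two
    alternants: on the left over the sets with frozen times, through [shift], on the right over all
    sets. On either side only the dominant sets remain, and each of them contributes a positive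
    term. *)
Lemma Jsum_ge x : (1 < x)%R ->
  (esum N l x * @Jsum N K mu' x <= @Jsum N K.+1 mu x)%R.
Proof.
move=> x1; pose a0 := alternant x (fun _ : 'I_N => 0).
have a2 : (0 < a0 * a0)%R by apply: alternant_pos.
rewrite -(ler_pM2l a2) mulrA -[(_ * esum _ _ _)%R]mulrA -(alternant_omega _ lN).
rewrite -!mulrA (alternant_Jsum _ N_gt0 _ _ _ rho) (alternant_Jsum _ N_gt0 _ _ _ 1%g).
have -> : (\sum_(T in @abacus_set N K 0 mu') alternant x (fun r =>
  (omega l r + wt T (rho r))%N) =
   \sum_(T in @abacus_set N K.+1 l mu') alternant x (fun r : 'I_N => wt T r))%R.
  rewrite -shift_abacus_set big_imset /=; last by move=> ? ? _ _; apply: shift_inj.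
  by apply: eq_bigr => U _; apply: alternant_ext => r; rewrite shift_wt.
have -> : (\sum_(T in @abacus_set N K.+1 0 mu) alternant x (fun r =>
  (0 + wt T ((1%g : 'S_N) r))%N) =
   \sum_(T in @abacus_set N K.+1 0 mu) alternant x (fun r : 'I_N => wt T r))%R.
  by apply: eq_bigr => U _; apply: alternant_ext => r; rewrite perm1.
rewrite (@alternant_dominant N K.+1 N_gt0 l mu' lN x (K.+1 * N)) (@alternant_dominant N K.+1
  N_gt0 0 mu (leq0n N) x (K.+1 * N)).
rewrite !mulr_sumr [X in (_ <= X)%R](bigID (fun T => T \in @abacus_set N K.+1 l mu')) /=.
apply: ler_wpDr.
  apply: sumr_ge0 => T /andP[/andP[_ hd] _]; apply: ltW; apply: alternant_pos => // i j ij.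
  by apply: (dominant_wt N_gt0 hd ij).
rewrite le_eqVlt; apply/orP; left; apply/eqP; apply: eq_bigl => T;
  case: (boolP (T \in @abacus_set N K.+1 l mu')) => hT; rewrite ?andbF //.
by rewrite (subsetP sub_abacus_set) // !andbT.
Qed.

(* Jsum_ge at x = 1 / (1 - 1/k), k large: by Bernoulli's inequality all
   monomials, of degree at most E, are then close to 1. *)
Lemma card_step : 'C(N, l) * #|@abacus_set N K 0 mu'| <= #|@abacus_set N K.+1 0 mu|.
Proof.
set A := 'C(N, l); set B := #|@abacus_set N K 0 mu'|; set D := #|@abacus_set N K.+1 0 mu|.
have [//|lt] := leqP (A * B) D.
pose E := K.+1 * N * N; pose k := ((A * B) * E).+2.
have k1 : (1 < k%:R :> rat)%R by rewrite ltr1n.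
have k0 : (0 < k%:R :> rat)%R by apply: lt_trans k1.
pose q : rat := (1 - k%:R^-1)%R.
have q0 : (0 < q)%R by rewrite subr_gt0 invf_lt1.
have q1 : (q < 1)%R by rewrite ltrBlDr ltrDl invr_gt0.
have x1 : (1 < q^-1)%R by rewrite invf_gt1.
have bern m : (1 - m%:R * k%:R^-1 <= q ^+ m)%R.
  elim: m => [|m IH]; first by rewrite mul0r subr0 expr0.
  rewrite exprS; apply: le_trans (ler_wpM2l (ltW q0) IH);
    rewrite /q mulrBl !mulrBr mul1r !mulr1 -natr1 mulrDl mul1r.
  have : (0 <= m%:R * k%:R^-1 * k%:R^-1 :> rat)%R.
    by rewrite !mulr_ge0 ?ler0n // ltW // invr_gt0.
  by rewrite [(k%:R^-1 * _)%R]mulrC; lra.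
have hle := Jsum_ge x1.
have lo : ((A * B)%:R <= esum N l q^-1 * @Jsum N K mu' q^-1)%R.
  rewrite natrM; apply: ler_pM; rewrite ?ler0n //.
    rewrite /A -{1}(card_ord N) -card_draws -sum1dep_card natr_sum; apply: ler_sum => S _.
    exact: wmon_ge1.
  rewrite /B -sum1_card natr_sum; apply: ler_sum => T _; exact: wmon_ge1.
have hi : (@Jsum N K.+1 mu q^-1 <= D%:R * q^-1 ^+ E)%R.
  rewrite -mulr_natl mulr1 /D -sum1_card natr_sum mulr_suml; apply: ler_sum => T _.
  rewrite mul1r /wmon prodrXr; apply: ler_weXn2l; first exact: ltW.
  apply: leq_trans (_ : \sum_(j < N) K.+1 * N <= E); last first.
    by rewrite sum_nat_const card_ord /E mulnC.
  apply: leq_sum => j _; apply: leq_mul; last exact: ltnW.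
  by rewrite /wt -[X in _ <= X](card_ord K.+1) -sum1_card; apply: leq_sum => y _; case: inT.
have {hle lo hi} : ((A * B)%:R * q ^+ E <= D%:R)%R.
  have := le_trans lo (le_trans hle hi).
  by rewrite exprVn -ler_pdivlMr ?invr_gt0 ?exprn_gt0 // invrK.
move=> h; have := le_trans (ler_wpM2l (ler0n _ _) (bern E)) h.
have : ((A * B)%:R * (1 - E%:R * k%:R^-1) > (A * B)%:R - 1 :> rat)%R.
  rewrite mulrBr mulr1 ltrD2l ltrN2 mulrA -natrM ltr_pdivrMr // mul1r ltr_nat.
  by rewrite /k.
have : (D%:R <= (A * B)%:R - 1 :> rat)%R by rewrite lerBrDr natr1 ler_nat.
lra.
Qed.

End Step.

(** A permutation agreeing with [g] at as many points of [D] as possible agrees on all of [D],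
    because a transposition would repair one more point without spoiling another. *)
Lemma perm_extend (X : finType) (D : {set X}) (g : X -> X) :
  {in D &, injective g} -> exists s : {perm X}, {in D, s =1 g}.
Proof.
move=> gi; pose m (s : {perm X}) := #|[set c in D | s c == g c]|.
have [s _ hs] := @arg_maxnP {perm X} 1%g xpredT m isT.
exists s => c cD; apply/eqP/negPn/negP => ne.
have : m (s * tperm (s c) (g c))%g <= m s := hs _ isT; rewrite leqNgt => /negP; apply.
apply: proper_card; apply/properP; split.
  apply/subsetP => d; rewrite !inE permM => /andP[dD /eqP ed]; rewrite dD /= ed.
  have dc : d != c by apply: contraNneq ne => <-; rewrite ed.
  rewrite tpermD //; first by apply: contraNneq dc => e; rewrite -(inj_eq (@perm_inj _ s)) ed e.
  by apply: contraNneq dc => e; rewrite (gi _ _ dD cD).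
by exists c; rewrite !inE cD //= ?(negPf ne) // permM tpermL eqxx.
Qed.

Lemma card_inT (N K : nat) (T : {set 'I_(K * N)}) (P : nat -> bool) B : K * N <= B ->
  #|[set x in T | P x]| = \sum_(0 <= t < B) (inT T t && P t).
Proof.
move=> hB; rewrite (big_cat_nat (n := K * N)) //= [X in _ + X](_ : _ = 0) ?addn0.
  rewrite big_mkord -sum1_card big_mkcond /=; apply: eq_bigr => x _.
  by rewrite inE inT_ord; case: ifP.
by rewrite big_nat_cond big1 // => t /andP[/andP[h _] _]; case: (boolP (inT T t)) => // /inT_lt;
  rewrite ltnNge h.
Qed.

(** Descending from mate to mate costs at most N per step and uses up one time of the colour. *)
Lemma gapped_bound N l0 T k t : gapped N l0 T k -> T t -> l0 <= t ->
  t < l0 + N * \sum_(0 <= s < t.+1) (T s && ((l0 <= s) && (k s == k t))).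
Proof.
move=> hg; elim/ltn_ind: t => t IH Tt lt.
rewrite big_nat_recr //= Tt lt eqxx /= mulnDr muln1.
case: (hg t Tt lt) => [|[m /and5P[Tm lm /eqP km mt tm]]]; first lia.
have := IH m mt Tm lm; rewrite km => h.
have : \sum_(0 <= s < m.+1) (T s && ((l0 <= s) && (k s == k t))) <=
  \sum_(0 <= s < t) (T s && ((l0 <= s) && (k s == k t))).
  by rewrite [X in _ <= X](big_cat_nat (n := m.+1)) //= leq_addr.
by move/(leq_mul (leqnn N)); lia.
Qed.

(** * Adding a row to la by freezing the first times *)

Section Shift.
Variables (N K l : nat) (mu mu' : seq nat).
Hypotheses (N_gt0 : 0 < N) (lN : l <= N).
Hypothesis mu_step : forall c, nth 0 mu c = nth 0 mu' c + (c < l).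
Hypothesis mu'_le : forall c, nth 0 mu' c <= K.
Hypothesis mu'_lt : forall c, 0 < nth 0 mu' c -> c < l.

Definition shift (U : {set 'I_(K * N)}) : {set 'I_(K.+1 * N)} :=
  [set t : 'I_(K.+1 * N) | (t < l) || (l <= t) && inT U (t - l)].

Lemma inT_shift U t : inT (shift U) t = (t < l) || (l <= t) && inT U (t - l).
Proof.
case: (ltnP t (K.+1 * N)) => ht; first by rewrite -[t]/(val (Ordinal ht)) inT_ord inE.
apply/idP/idP => [/inT_lt|]; first by rewrite ltnNge ht.
by rewrite mulSn in ht; case/orP=> [|/andP[h /inT_lt]]; lia.
Qed.

Lemma inT_shift_add U u : inT (shift U) (u + l) = inT U u.
Proof. by rewrite inT_shift addnK leq_addl ltnNge leq_addl. Qed.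

Lemma shift_inj : injective shift.
Proof. by move=> U U' e; apply: setT_eq => t _; rewrite -!inT_shift_add e. Qed.

(** The value is the residue of [t - l] when [t] has residue [r]. *)
Lemma rot_lt (r : 'I_N) : (if r < l then N - l + r else r - l) < N.
Proof. by have := ltn_ord r; case: ifP; lia. Qed.

Lemma rot_inj : injective (fun r => Ordinal (rot_lt r)).
Proof.
move=> r r' /(congr1 val) /= e; apply: val_inj => /=; move: e.
by have := ltn_ord r; have := ltn_ord r'; do 2!case: ifP; lia.
Qed.

Definition rotp : 'S_N := perm rot_inj.

Lemma shift_wt U (r : 'I_N) : wt (shift U) r = omega l r + wt U (rotp r).
Proof.
rewrite /wt /omega permE /=; case: ifP => hr.
  rewrite big_ord_recl /= mul0n inT_shift hr /=; congr (_ + _); apply: eq_bigr => y _.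
  rewrite /bump /= add1n mulSn inT_shift; have -> : N + y * N + r < l = false by lia.
  rewrite (_ : l <= _) /=; last lia.
  by congr (nat_of_bool (inT U _)); lia.
rewrite big_ord_recr /= addnC; congr (_ + _).
  rewrite inT_shift; case: (boolP (inT U _)) => [/inT_lt|]; rewrite ?andbF ?orbF; lia.
apply: eq_bigr => y _; rewrite inT_shift.
have -> : y * N + r < l = false by lia.
rewrite (_ : l <= _) /=; last lia.
by congr (nat_of_bool (inT U _)); lia.
Qed.

Lemma shift_abacus U : abacus l mu' (shift U) <-> abacus 0 mu' U.
Proof.
have hc (k k' : nat -> nat) (c : nat) : (forall u, k' (u + l) = k u) ->
    #|[set x in shift U | (l <= x) && (k' x == c)]| = #|[set x in U | (0 <= x) && (k x == c)]|.
  move=> hk; rewrite (@card_inT N K.+1 (shift U) (fun x =>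
    (l <= x) && (k' x == c)) (K.+1 * N + l)) ?leq_addr //.
  rewrite (@card_inT N K U (fun x => (0 <= x) && (k x == c)) (K.+1 * N));
    last by rewrite leq_mul2r leqnSn orbT.
  rewrite (big_cat_nat (n := l)) ?leq_addl //= [X in X + _](_ : _ = 0) ?add0n.
    rewrite -{1}[l]add0n big_addn addnK; apply: eq_bigr => u _.
    by rewrite inT_shift_add leq_addl hk.
  by rewrite big_nat_cond big1 // => t /andP[/andP[_ h] _]; rewrite leqNgt h andbF.
have hm (k k' : nat -> nat) (hk : forall u, k' (u + l) = k u) :
    gapped N l (inT (shift U)) k' <-> gapped N 0 (inT U) k.
  split=> hg t Tt lt.
    have := hg (t + l); rewrite inT_shift_add Tt leq_addl => /(_ isT isT).
    case=> [h|[m /and5P[Tm lm /eqP km mt tm]]]; first by left; lia.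
    right; exists (m - l); rewrite -{1 2}(subnK lm) in km Tm *.
    apply/and5P; split=> //; try lia; last by rewrite -!hk km.
    by rewrite -inT_shift_add.
  rewrite -(subnK lt) inT_shift_add in Tt *; have := hg _ Tt (leq0n _).
  case=> [h|[m /and5P[Tm _ /eqP km mt tm]]]; first by left; lia.
  right; exists (m + l); apply/and5P; split; rewrite ?inT_shift_add ?hk ?km ?leq_addl //; lia.
split=> [[_ [k hg hk]]|[_ [k hg hk]]].
  split=> //; exists (fun u => k (u + l)); first by apply/(hm (fun u => k (u + l)) k).
  by move=> c; rewrite -hk -(hc (fun u => k (u + l)) k).
split; first by move=> t ht; rewrite inT_shift ht.
have e u : (fun t => k (t - l)) (u + l) = k u by rewrite /= addnK.
exists (fun t => k (t - l)); first by apply/(hm _ _ e).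
by move=> c; rewrite -hk; apply: (hc k (fun t => k (t - l)) c e).
Qed.

Lemma shift_abacus_set : shift @: @abacus_set N K 0 mu' = @abacus_set N K.+1 l mu'.
Proof.
apply/setP=> T; apply/imsetP/abacus_setP => [[U /abacus_setP hU ->]|hT];
  first exact/shift_abacus.
pose U : {set 'I_(K * N)} := [set u : 'I_(K * N) | inT T (u + l)].
suff e : T = shift U by exists U => //; apply/abacus_setP/shift_abacus; rewrite -e.
case: hT => hl [k hg hc]; apply: setT_eq => t ht; rewrite inT_shift.
case: (ltnP t l) => lt /=; first exact: hl.
case: (boolP (inT T t)) => Tt; last first.
  symmetry; apply: contraNF Tt => hU.
  by have := hU; rewrite -[t - l]/(val (Ordinal (inT_lt hU))) inT_ord inE /= subnK.
(* Every colour class has at most [K] times, so by [gapped_bound] all of them lie below [l + K * N],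
   and subtracting [l] leaves a set with [K] levels. *)
have b : t - l < K * N.
  have := gapped_bound hg Tt lt; have := hc (k t).
  rewrite (@card_inT N K.+1 T (fun x => (l <= x) && (k x == k t)) _ (leqnn _)).
  rewrite (big_cat_nat (n := t.+1)) //= => e h.
  have : N * \sum_(0 <= s < t.+1) (inT T s && ((l <= s) && (k s == k t))) <= N * K.
    by rewrite leq_mul2l; apply/orP; right; apply: leq_trans (mu'_le (k t));
      rewrite -e leq_addr.
  by rewrite [N * K]mulnC; lia.
by symmetry; rewrite -[t - l]/(val (Ordinal b)) inT_ord inE /= subnK.
Qed.

(** Each of the [l] colours receives one frozen time. The first time t of a colour was exempt as t <
    l + N; if t is at least N it needs a mate once nothing is frozen, and t - N is a frozen time
    that can serve. Different colours ask for different frozen times, so the choice extends to a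
    bijection between colours and frozen times. *)
Lemma sub_abacus_set : @abacus_set N K.+1 l mu' \subset @abacus_set N K.+1 0 mu.
Proof.
apply/subsetP => T /abacus_setP [hl [k hg hc]]; apply/abacus_setP; split=> //.
pose M := K.+1 * N.
pose fst (c t : nat) := [&& inT T t, l <= t, k t == c & [forall s : 'I_t, ~~ [&& inT T s,
  l <= s & k s == c]]].
have fst_lt c t : fst c t -> t < l + N.
  case/and4P=> Tt lt /eqP kt /forallP h; case: (hg t Tt lt) => // [[m /and5P[Tm lm km mt tm]]].
  by have := h (Ordinal mt); rewrite /= Tm lm -kt km.
have fst_uniq c t t' : fst c t -> fst c t' -> t = t'.
  case/and4P=> Tt lt kt /forallP h; case/and4P=> Tt' lt' kt' /forallP h'.
  case: (ltngtP t t') => // lt2; [have := h' (Ordinal lt2)|have := h (Ordinal lt2)];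
  by rewrite /= ?Tt ?Tt' ?lt ?lt' ?kt ?kt'.
pose D := [set c : 'I_l | [exists t : 'I_M, (N <= t) && fst c t]].
pose g (c : 'I_l) : 'I_l := if [pick s : 'I_l | fst c (s + N)] is Some s then s else c.
have gP (c : 'I_l) t : fst c t -> N <= t -> g c + N = t.
  move=> ft Nt; rewrite /g; case: pickP => [s fs|]; first exact: fst_uniq fs ft.
  have hs : t - N < l by have := fst_lt _ _ ft; lia.
  by move=> /(_ (Ordinal hs)); rewrite /= subnK // ft.
have gi : {in D &, injective g}.
  move=> c c'; rewrite !inE => /existsP[t /andP[Nt ft]] /existsP[t' /andP[Nt' ft']] e.
  have ett : t = t' :> nat by rewrite -(gP _ _ ft Nt) -(gP _ _ ft' Nt') e.
  case/and4P: ft => _ _ /eqP kt _; case/and4P: ft' => _ _ /eqP kt' _.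
  by apply: val_inj; rewrite /= -kt ett kt'.
have [s hs] := perm_extend gi.
pose k2 t := if insub t is Some u then nat_of_ord (s^-1%g (u : 'I_l)) else k t.
have k2l t : l <= t -> k2 t = k t.
  by move=> lt; rewrite /k2; case: insubP => // u; rewrite ltnNge lt.
have k2s (u : 'I_l) : k2 u = s^-1%g u by rewrite /k2 valK.
exists k2.
  move=> t Tt _; case: (ltnP t N) => Nt; first by left.
  have lt : l <= t by lia.
  right; case: (hg t Tt lt) => [tl|[m /and5P[Tm lm km mt tm]]]; last first.
    by exists m; rewrite /mate Tm mt tm !k2l // km.
  case ft: (fst (k t) t); last first.
    move: ft; rewrite /fst Tt lt eqxx /= => /negbT; rewrite negb_forall => /existsP[m].
    rewrite negbK => /and3P[Tm lm km]; exists m; rewrite /mate Tm !k2l // km ltn_ord /=; lia.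
  have cl : k t < l.
    apply: mu'_lt; rewrite -hc; apply/card_gt0P; exists (Ordinal (inT_lt Tt)).
    by rewrite !inE -inT_ord /= Tt lt eqxx.
  have e := gP (Ordinal cl) t ft Nt; exists (g (Ordinal cl)).
  apply/and5P; split=> //; try lia; first exact/hl/ltn_ord.
  rewrite k2s k2l // -hs ?permK //= inE; apply/existsP; exists (Ordinal (inT_lt Tt)).
  by rewrite Nt.
move=> c; rewrite mu_step -hc.
rewrite (@card_inT N K.+1 T (fun x => (0 <= x) && (k2 x == c)) (M + l)) ?leq_addr //.
rewrite (@card_inT N K.+1 T (fun x => (l <= x) && (k x == c)) (M + l)) ?leq_addr //.
rewrite (big_cat_nat (n := l)) ?leq_addl //= [in RHS](big_cat_nat (n := l)) ?leq_addl //=.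
have -> : \sum_(0 <= t < l) (inT T t && (k2 t == c)) = (c < l).
  rewrite big_mkord (eq_bigr (fun u : 'I_l => (s^-1%g u == c :> nat) : nat)); last first.
    by move=> u _; rewrite hl // k2s.
  case: (ltnP c l) => cl; last by rewrite big1 // => u _; case: eqP => // e; move: cl;
    rewrite -e leqNgt ltn_ord.
  rewrite (bigD1 (s (Ordinal cl))) //= permK eqxx big1 // => u ne.
  case: eqP => // e; case/eqP: ne; rewrite -[u in LHS](permKV s); congr (s _); exact: val_inj.
have -> : \sum_(0 <= t < l) (inT T t && ((l <= t) && (k t == c))) = 0.
  by rewrite big_nat_cond big1 // => t /andP[/andP[_ h] _]; rewrite leqNgt h andbF.
rewrite add0n addnC; congr (_ + _); rewrite big_nat_cond [RHS]big_nat_cond.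
by apply: eq_bigr => t /andP[/andP[h _] _]; rewrite k2l // h.
Qed.

Lemma card_abacus_set_step : 'C(N, l) * #|@abacus_set N K 0 mu'| <= #|@abacus_set N K.+1 0 mu|.
Proof. exact: (@card_step N K l mu mu' N_gt0 lN shift rotp shift_inj shift_wt shift_abacus_set
  sub_abacus_set). Qed.

End Shift.

Lemma nth_conj_part la c : sorted geq la ->
  nth 0 (conj_part la) c = count (fun p => c < p) la.
Proof.
move=> sla; case: (ltnP c (head 0 la)) => hc; first by rewrite nth_mkseq.
rewrite nth_default ?size_mkseq //; symmetry; apply/eqP; rewrite -leqn0 leqNgt -has_count.
apply/hasPn => p pla; rewrite -leqNgt; apply: leq_trans hc.
case: la sla pla => // q la /=; rewrite path_sortedE; last by move=> ? ? ? h1 h2;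
  apply: leq_trans h2 h1.
by move=> /andP[/allP h _]; rewrite inE => /orP[/eqP ->|/h].
Qed.

Lemma sumn_conj_part la : sorted geq la -> sumn (conj_part la) = sumn la.
Proof.
move=> sla; rewrite sumnE big_map -[X in iota _ X]subn0 big_mkord.
have hle p : p \in la -> p <= head 0 la.
  case: la sla => // q la /=; rewrite path_sortedE; last by move=> ? ? ? h1 h2;
    apply: leq_trans h2 h1.
  by move=> /andP[/allP h _]; rewrite inE => /orP[/eqP ->|/h].
rewrite (eq_bigr (fun i : 'I__ => \sum_(p <- la) (i < p))); last first.
  by move=> i _; rewrite -sum1_count big_mkcond.
rewrite exchange_big /= sumnE; apply: eq_big_seq => p /hle hp.
by rewrite -big_mkcond /= sum1_card -[RHS](card_ord_lt hp); apply: eq_card => r; rewrite inE.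
Qed.

Lemma card_abacus_set_ge N la : 0 < N -> sorted geq la -> all (fun p => p <= N) la ->
  \prod_(p <- la) 'C(N, p) <= #|@abacus_set N (size la) 0 (conj_part la)|.
Proof.
move=> N_gt0; elim: la => [|l la IH].
  move=> _ _; rewrite big_nil; apply/card_gt0P; exists set0; apply/abacus_setP; split=> //.
  exists (fun=> 0); first by move=> t Tt; have := inT_lt Tt.
  by move=> c; rewrite nth_conj_part //=; apply: eq_card0 => x; rewrite !inE.
move=> /= sla /andP[lN hN]; have sla' := path_sorted sla.
rewrite big_cons; apply: leq_trans (leq_mul (leqnn _) (IH sla' hN)) _.
apply: card_abacus_set_step => // c; rewrite !nth_conj_part //=.
- by rewrite addnC.
- exact: count_size.
- rewrite -has_count => /hasP[p pla cp]; apply: leq_trans cp _.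
  move: sla; rewrite path_sortedE; last by move=> ? ? ? h1 h2; apply: leq_trans h2 h1.
  by move=> /andP[/allP h _]; apply: h.
Qed.

Definition mates n (mu : seq nat) (a : 'I_n -> nat) : Prop :=
  exists2 k : 'I_n -> nat, forall c, #|[set j | k j == c]| = nth 0 mu c &
  forall j, 0 < a j -> exists2 j', k j' = k j &
    (a j' = a j /\ j < j') \/ ((a j').+1 = a j /\ j' < j).

(** * From sets of times back to compositions *)

Section Residues.
Variables (N K n : nat) (mu : seq nat).
Hypotheses (N_gt0 : 0 < N) (hn : sumn mu = n).
Local Notation M := (K * N).
Implicit Types T : {set 'I_M}.
Local Notation J := (@abacus_set N K 0 mu).

Definition mate_seqs : {set {ffun 'I_n -> 'I_K.+1}} :=
  [set a | `[< mates mu (fun j : 'I_n => nat_of_ord ((a : {ffun 'I_n -> 'I_K.+1}) j)) >] ].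

Definition elems T : seq nat := [seq val x | x <- enum T].
Definition distinct T := uniq [seq t %% N | t <- elems T].
(** Sorted by decreasing residue, so that an element at position j plays the part of t_j = a_j n +
    (n - j): its level is the entry a_j, and its residue falls as j grows. *)
Definition decr T : seq nat := sort (fun s t => t %% N <= s %% N) (elems T).

Lemma mem_elems T t : (t \in elems T) = inT T t.
Proof.
apply/mapP/existsP => [[x hx ->]|[x /andP[xT /eqP <-]]]; last by exists x; rewrite ?mem_enum.
by exists x; rewrite eqxx andbT -mem_enum.
Qed.

Lemma uniq_elems T : uniq (elems T).
Proof. by rewrite map_inj_uniq ?enum_uniq //; apply: val_inj. Qed.

Lemma card_good T : T \in J -> #|T| = n.
Proof.
move=> /abacus_setP[_ [k _ hk]]; rewrite -hn sumnE (big_nth 0) big_mkord.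
rewrite (eq_bigr (fun c : 'I_(size mu) => \sum_(x in T) (k x == c))); last first.
  move=> c _; rewrite -hk -sum1_card big_mkcond [RHS]big_mkcond; apply: eq_bigr => x _.
  by rewrite inE leq0n; case: (x \in T) => //=; case: (k x == c).
rewrite exchange_big /= -sum1_card; apply: eq_bigr => x xT.
have hx : k x < size mu.
  rewrite ltnNge; apply/negP => h; have /eqP := hk (k x); rewrite nth_default // cards_eq0.
  by move=> /eqP/setP/(_ x); rewrite !inE xT eqxx.
rewrite (bigD1 (Ordinal hx)) //= eqxx big1 // => c ne; case: eqP => // e.
by case/eqP: ne; apply: val_inj.
Qed.

Lemma mem_decr T t : (t \in decr T) = inT T t.
Proof. by rewrite mem_sort mem_elems. Qed.

Lemma size_decr T : T \in J -> size (decr T) = n.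
Proof. by move=> hT; rewrite size_sort size_map -cardE card_good. Qed.

Lemma decr_sorted T : sorted geq [seq t %% N | t <- decr T].
Proof.
rewrite sorted_map; apply: sort_sorted => s t /=; exact: leq_total.
Qed.

Lemma decr_mod_uniq T : distinct T -> uniq [seq t %% N | t <- decr T].
Proof. by rewrite /distinct (perm_uniq (perm_map _ (permEl (perm_sort _ _)))). Qed.

Lemma decr_lt T i j : T \in J -> distinct T -> i < n -> j < n ->
  (nth 0 (decr T) j %% N < nth 0 (decr T) i %% N) = (i < j).
Proof.
move=> TJ dT iN jN; have sz := size_decr TJ.
have hs : sorted gtn [seq t %% N | t <- decr T].
  by rewrite gtn_sorted_uniq_geq decr_mod_uniq // decr_sorted.
have tr : transitive gtn by move=> y x z h1 h2; apply: ltn_trans h2 h1.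
have mono i' j' : i' < j' -> j' < n -> nth 0 (decr T) j' %% N < nth 0 (decr T) i' %% N.
  move=> h1 h2; have := sorted_ltn_nth tr 0 hs i' j'; rewrite !inE size_map sz.
  by move=> /(_ (ltn_trans h1 h2) h2 h1); rewrite !(nth_map 0) ?sz // (ltn_trans h1 h2).
apply/idP/idP => [h|h]; last exact: mono.
rewrite ltnNge leq_eqVlt; apply/negP => /orP[/eqP e|h']; first by rewrite e ltnn in h.
by have := mono _ _ h' iN; lia.
Qed.

Lemma decr_lev T j : T \in J -> j < n -> nth 0 (decr T) j %/ N < K.
Proof.
move=> TJ jn; rewrite ltn_divLR //; apply: (@inT_lt N K T).
by rewrite -mem_decr mem_nth // size_decr.
Qed.

(** A mate inside the window is either on the same level with a smaller residue, hence a larger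
    index, or one level lower with a residue at least as large, hence a smaller index, equality
    being excluded by distinctness. *)
Lemma decr_mates T : T \in J -> distinct T -> mates mu (fun j : 'I_n => nth 0 (decr T) j %/ N).
Proof.
move=> TJ dT; have sz := size_decr TJ; case/abacus_setP: (TJ) => _ [k hg hk].
have un : uniq (decr T) by rewrite sort_uniq uniq_elems.
have hT j : j < n -> inT T (nth 0 (decr T) j) by move=> jn; rewrite -mem_decr mem_nth ?sz.
exists (fun j : 'I_n => k (nth 0 (decr T) j)).
  move=> c; rewrite -hk.
  pose e (j : 'I_n) : 'I_M := Ordinal (inT_lt (hT j (ltn_ord j))).
  have ei : injective e.
    move=> i j /(congr1 val) /= /eqP; rewrite nth_uniq ?sz // => /eqP; exact: val_inj.
  rewrite -(card_imset _ ei); apply: eq_card => x; apply/imsetP/setIdP => [[j]|[xT /= hx]].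
    by rewrite inE => hj ->; rewrite -inT_ord /= hT.
  have xd : val x \in decr T by rewrite mem_decr inT_ord.
  have xi : index (val x) (decr T) < n by rewrite -sz index_mem.
  exists (Ordinal xi); last by apply: val_inj; rewrite /= nth_index.
  by rewrite inE /= nth_index.
move=> j; case: (hg _ (hT j (ltn_ord j)) (leq0n _)) => [h|[m /and5P[Tm _ /eqP km mt tm]] aj].
  by rewrite divn_small.
have md : m \in decr T by rewrite mem_decr.
have mi : index m (decr T) < n by rewrite -sz index_mem.
exists (Ordinal mi); first by rewrite /= nth_index.
have := decr_lt TJ dT mi (ltn_ord j); have := decr_lt TJ dT (ltn_ord j) mi.
have ne : index m (decr T) <> j.
  by move=> e; move: mt; rewrite -e nth_index // ltnn.
rewrite /= nth_index //; move: (nth 0 _ j) mt tm aj => t mt tm aj.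
have tE := divn_eq t N; have mE := divn_eq m N; have tl := ltn_pmod t N_gt0;
  have ml := ltn_pmod m N_gt0.
have h1 : m %/ N <= t %/ N by apply: leq_div2r; lia.
have h2 : t %/ N <= (m %/ N).+1.
  by apply: leq_trans (leq_div2r N tm) _; rewrite divnDr ?dvdnn // divnn N_gt0 addn1.
move: h1 h2 tE mE; move: (t %/ N) (m %/ N) (t %% N) (m %% N) tl ml aj =>
  a b r s tl ml aj h1 h2 tE mE.
have [e|e] : b = a \/ b.+1 = a by lia.
  by move=> <- _; left; split=> //; subst b; lia.
move=> e1 e2; right; split=> //; subst a; rewrite mulSn in tE.
have [h|h] : r < s \/ r = s by lia.
  by move: e2; rewrite h => /esym.
by move: e1 e2 ne; rewrite h !ltnn; lia.
Qed.

Definition resO (x : 'I_M) : 'I_N := Ordinal (ltn_pmod x N_gt0).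

Lemma card_distinct : #|[set T in J | distinct T]| <= 'C(N, n) * #|mate_seqs|.
Proof.
pose F T := (resO @: T, [ffun j : 'I_n => inord (nth 0 (decr T) j %/ N) : 'I_K.+1]).
have Fn T : T \in J -> forall j : 'I_n, (F T).2 j = nth 0 (decr T) j %/ N :> nat.
  by move=> TJ j; rewrite ffunE inordK // ltnS ltnW // decr_lev.
have FS T r : (r \in [seq t %% N | t <- decr T]) = (r \in [seq val s | s <- enum (F T).1]).
  apply/mapP/mapP => [[t]|[s]].
    rewrite mem_decr => Tt ->; exists (resO (Ordinal (inT_lt Tt))) => //.
    by rewrite mem_enum imset_f // -inT_ord.
  rewrite mem_enum => /imsetP[x xT ->] ->; exists (val x) => //.
  by rewrite mem_decr inT_ord.
have -> : 'C(N, n) = #|[set S : {set 'I_N} | #|S| == n]| by rewrite card_draws card_ord.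
rewrite -cardsX -(card_in_imset (f := F)).
  apply/subset_leq_card/subsetP => _ /imsetP[T + ->]; rewrite inE => /andP[TJ dT].
  rewrite inE; apply/andP; split.
    rewrite inE /= cardE -(size_map val) -(perm_size (s1 := [seq t %% N | t <- decr T])).
      by rewrite size_map size_decr.
    apply: uniq_perm; [exact: decr_mod_uniq|by rewrite map_inj_uniq ?enum_uniq //;
      apply: val_inj|exact: FS].
  rewrite inE; apply/asboolP; have := decr_mates TJ dT.
  congr mates; apply: funext => j; apply: esym; exact: Fn.
move=> T T'; rewrite !inE => /andP[/asboolP hT dT] /andP[/asboolP hT' dT'] eF.
have TJ : T \in J by apply/abacus_setP. have TJ' : T' \in J by apply/abacus_setP.
have em : [seq t %% N | t <- decr T] = [seq t %% N | t <- decr T'].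
  apply: (sorted_eq (leT := geq)); try exact: decr_sorted.
  - by move=> y x z h1 h2; apply: leq_trans h2 h1.
  - by move=> x y /andP[h1 h2]; apply/eqP; rewrite eqn_leq; apply/andP; split.
  - apply: uniq_perm; try exact: decr_mod_uniq.
    by move=> r; rewrite !FS eF.
suff e : decr T = decr T' by apply: setT_eq => t _; rewrite -!mem_decr e.
apply: (@eq_from_nth _ 0) => [|j]; rewrite !size_decr // => jn.
have := congr1 (nth 0 ^~ j) em; rewrite !(nth_map 0) ?size_decr // => e1.
rewrite [LHS](divn_eq _ N) [RHS](divn_eq _ N) e1.
by rewrite -(Fn T TJ (Ordinal jn)) -(Fn T' TJ' (Ordinal jn)) eF.
Qed.

(** A crude code by a list of levels and a list of residues with a repetition. It suffices, since
    [N ^ n - N ^_ n] is of lower order than [N ^ n]. *)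
Lemma card_repeated : #|[set T in J | ~~ distinct T]| <= K ^ n * (N ^ n - N ^_ n).
Proof.
pose R := [set t : n.-tuple 'I_N | ~~ uniq t].
have -> : N ^ n - N ^_ n = #|R|.
  have e1 : #|[set t : n.-tuple 'I_N | uniq t]| = N ^_ n.
    rewrite -[in RHS](card_ord N) -(card_uniq_tuples n 'I_N); apply: eq_card => t; rewrite !inE.
    by rewrite (_ : all _ _) //; apply/allP.
  have e2 := cardsC [set t : n.-tuple 'I_N | uniq t]; rewrite card_tuple card_ord in e2.
  rewrite -e2 e1 addKn; apply: eq_card => t; rewrite !inE //.
pose L := [set: n.-tuple 'I_K].
have -> : K ^ n = #|L| by rewrite cardsT card_tuple card_ord.
rewrite -cardsX.
pose F (q : n.-tuple 'I_K * n.-tuple 'I_N) : {set 'I_M} :=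
  [set x : 'I_M | [exists j : 'I_n, x == tnth q.1 j * N + tnth q.2 j :> nat]].
apply: leq_trans (leq_imset_card F _).
apply/subset_leq_card/subsetP => T; rewrite inE => /andP[TJ dT].
have sz : size (enum T) = n by rewrite -cardE card_good.
have lt (x : 'I_M) : x %/ N < K by rewrite ltn_divLR.
pose q := (map_tuple (fun x : 'I_M => Ordinal (lt x)) (tcast sz (in_tuple (enum T))),
           map_tuple resO (tcast sz (in_tuple (enum T)))).
apply/imsetP; exists q.
  rewrite !inE /= val_tcast /=; apply: contra dT => h.
  by rewrite /distinct /elems -map_comp -(map_inj_uniq val_inj) -map_comp in h *.
apply/setP=> x; rewrite inE; apply/idP/existsP => [xT|[j]].
  have xi : index x (enum T) < n by rewrite -sz index_mem mem_enum.
  exists (Ordinal xi); rewrite !tnth_map /= (tnth_nth x) val_tcast /= nth_index ?mem_enum //.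
  by rewrite -divn_eq.
rewrite !tnth_map /= -divn_eq => /eqP/val_inj ->.
by rewrite -mem_enum -[X in _ \in X](val_tcast sz (in_tuple (enum T))) mem_tnth.
Qed.

Lemma card_abacus_set_le : #|J| <= 'C(N, n) * #|mate_seqs| + K ^ n * (N ^ n - N ^_ n).
Proof.
rewrite -(cardsID [set T | distinct T] J); apply: leq_add.
  by apply: leq_trans card_distinct; apply/subset_leq_card/subsetP => T; rewrite !inE.
by apply: leq_trans card_repeated; apply/subset_leq_card/subsetP => T; rewrite !inE andbC.
Qed.

End Residues.

Lemma ffact_ge N m n : m <= n -> n <= N -> (N - n) ^ m <= N ^_ m.
Proof.
elim: m => [|m IH] mn nN //; rewrite expnSr ffactnSr.
by apply: leq_mul; [apply: IH => //; lia|lia].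
Qed.

Lemma ffact_le N m : N ^_ m <= N ^ m.
Proof.
by elim: m => [|m IH] //; rewrite expnSr ffactnSr; apply: leq_mul => //; lia.
Qed.

(** Bernoulli's inequality (1 - b/a)^m >= 1 - m b/a, cleared of denominators. *)
Lemma expn_sub_ge (a b m : nat) : b <= a -> a ^ m * a <= (a - b) ^ m * a + m * b * a ^ m.
Proof.
move=> ba; elim: m => [|m IH]; first by rewrite !expn0 leq_addr.
have : a ^ m * a * (a - b) <= ((a - b) ^ m * a + m * b * a ^ m) * (a - b).
  by rewrite leq_mul2r IH orbT.
have -> : a ^ m * a * (a - b) = a ^ m.+1 * a - b * a ^ m.+1 by rewrite expnSr mulnBr; lia.
rewrite mulnDl => h.
have h2 : m * b * a ^ m * (a - b) <= m * b * a ^ m.+1.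
  by rewrite expnSr mulnA leq_mul2l leq_subr orbT.
have -> : (a - b) ^ m.+1 * a = (a - b) ^ m * a * (a - b) by rewrite expnSr; lia.
have : b * a ^ m.+1 <= a ^ m.+1 * a by rewrite mulnC leq_mul2l ba orbT.
by rewrite mulSn mulnDl; lia.
Qed.

(* For large N almost all sets counted by abacus_set have distinct residues, and
   those are a choice of n residues together with a mated sequence of levels. *)
Lemma card_mate_seqs_ge n la : is_partition n la ->
  n`! <= #|@mate_seqs (size la) n (conj_part la)| * \prod_(p <- la) p`!.
Proof.
case/and3P=> sla _ /eqP hn; set D := #|_|; set L := \prod_(p <- la) _.
set K := size la; have hmu : sumn (conj_part la) = n by rewrite sumn_conj_part.
rewrite leqNgt; apply/negP => lt.
(* If D L < n!, the estimates give (c + 1) (N - n)^n <= c N^n with [c = D * L + C], and Bernoulli's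
   inequality turns this into N <= (c + 1) n^2. [N] is chosen to contradict it, and to be at least
   [n]. *)
pose C := n`! * L * K ^ n; pose c := D * L + C; pose N := c.+1 * (n * n) + n + 1.
have N_gt0 : 0 < N by rewrite /N addn1.
have nN : n <= N by rewrite /N; lia.
have hle : all (fun p => p <= N) la.
  apply/allP => p pla; apply: leq_trans nN; rewrite -hn sumnE (big_rem p) //=; exact: leq_addr.
have h1 := card_abacus_set_ge N_gt0 sla hle.
have h2 := card_abacus_set_le K N_gt0 hmu.
have hB : (N - n) ^ n <= (\prod_(p <- la) 'C(N, p)) * L.
  rewrite /L -big_split /= -{2}hn sumnE.
  have: all (fun p => p <= n) la.
    by apply/allP => p pla; rewrite -hn sumnE (big_rem p) //=; exact: leq_addr.
  elim: (la) => [|p s IH]; first by rewrite !big_nil.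
  move=> /= /andP[pn hs]; rewrite !big_cons expnD; apply: leq_mul; last exact: IH.
  by rewrite bin_ffact ffact_ge.
have h3 : n`! * (N - n) ^ n <= D * L * N ^ n + C * (N ^ n - (N - n) ^ n).
  have e1 : n`! * (N - n) ^ n <= n`! * L * ('C(N, n) * D + K ^ n * (N ^ n - N ^_ n)).
    rewrite -mulnA leq_mul2l; apply/orP; right; apply: leq_trans hB _.
    by rewrite mulnC leq_mul2l (leq_trans h1 h2) orbT.
  apply: leq_trans e1 _; rewrite mulnDr; apply: leq_add.
    have -> : n`! * L * ('C(N, n) * D) = D * L * ('C(N, n) * n`!) by lia.
    by rewrite bin_ffact leq_mul2l ffact_le orbT.
  rewrite mulnA -/C leq_mul2l; apply/orP; right; apply: leq_sub2l.
  exact: ffact_ge.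
have h4 : c.+1 * (N - n) ^ n <= c * N ^ n.
  have : (N - n) ^ n <= N ^ n by exact: leq_trans (ffact_ge (leqnn n) nN) (ffact_le N n).
  have : (D * L).+1 * (N - n) ^ n <= n`! * (N - n) ^ n by rewrite leq_mul2r lt orbT.
  rewrite /c mulSn mulnDl; rewrite mulnBr in h3; nia.
have h5 := expn_sub_ge n nN.
have h6 : c.+1 * (N ^ n * N) <= c * N ^ n * N + c.+1 * (n * n * N ^ n).
  apply: leq_trans (leq_mul (leqnn _) h5) _; rewrite mulnDr mulnA leq_add //.
  by rewrite leq_mul2r h4 orbT.
have h7 : 0 < N ^ n by rewrite expn_gt0 N_gt0.
have : N <= c.+1 * (n * n).
  rewrite -(leq_pmul2l h7); nia.
by rewrite /N; lia.
Qed.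

(** * A functional annihilating the Tanisaki ideal *)

Section Ranks.
Variables (n : nat) (a k : 'I_n -> nat).
Hypothesis ak_mate : forall j, 0 < a j -> exists2 j', k j' = k j &
    (a j' = a j /\ j < j') \/ ((a j').+1 = a j /\ j' < j).

(** The order of the times a_j n + (n - j), expressed without them. *)
Definition prec (i j : 'I_n) := (a i < a j) || ((a i == a j) && (j < i)).
Definition rk j := #|[set i | (k i == k j) && prec i j]|.

Lemma prec_trans : transitive prec.
Proof. by rewrite /prec => y x z; lia. Qed.

Lemma prec_irr j : prec j j = false.
Proof. by rewrite /prec; lia. Qed.

Lemma prec_total i j : i != j -> prec i j || prec j i.
Proof. by rewrite -val_eqE /prec /=; lia. Qed.

Lemma rk_lt i j : k i = k j -> prec i j -> rk i < rk j.
Proof.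
move=> kij pij; apply: proper_card; apply/properP; split.
  by apply/subsetP => x; rewrite !inE kij => /andP[-> h]; apply: prec_trans pij.
by exists i; rewrite !inE ?kij ?eqxx ?pij ?prec_irr.
Qed.

Lemma rk_ltE i j : k i = k j -> (rk i < rk j) = prec i j.
Proof.
move=> kij; apply/idP/idP => [h|]; last exact: rk_lt.
have [e|/prec_total/orP[//|/rk_lt]] := eqVneq i j; first by rewrite e ltnn in h.
by move=> /(_ (esym kij)); lia.
Qed.

Lemma rk_inj i j : k i = k j -> rk i = rk j -> i = j.
Proof.
move=> kij e; apply/eqP/negPn/negP => /prec_total/orP[] /rk_lt; rewrite e ltnn.
  by move=> /(_ kij).
by move=> /(_ (esym kij)).
Qed.

Lemma rk_bound j : rk j < #|[set i | k i == k j]|.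
Proof.
apply: proper_card; apply/properP; split.
  by apply/subsetP => x; rewrite !inE => /andP[].
by exists j; rewrite !inE ?eqxx ?prec_irr.
Qed.

Lemma mate_ex j : 0 < a j -> exists m, [/\ k m = k j, prec m j, a j <= (a m).+1 &
   (a m).+1 = a j -> m < j].
Proof.
by move=> /ak_mate[m km hm]; exists m; split=> //; rewrite /prec; case: hm; lia.
Qed.

Lemma a_le_rk j : a j <= rk j.
Proof.
move: {2}(rk j) (leqnn (rk j)) => d; elim: d j => [|d IH] j hd;
  have [->//|/mate_ex[m [km pm am _]]] := posnP (a j); have := rk_lt km pm; first lia.
by have := IH m; lia.
Qed.

(** Going from [j] to its mate lowers [a] by at most one and the rank by at least one, and the index
    drops whenever [a] does. The descent ends at [i], or passes below it; in the latter case already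
    [a j <= (a i).+1]. *)
Lemma rk_slope i j : k i = k j -> prec i j ->
  a j + rk i <= rk j + a i /\ (a j + rk i = rk j + a i -> i < j).
Proof.
move: {2}(rk j) (leqnn (rk j)) => d; elim: d j => [|d IH] j hd kij pij.
  by have := rk_lt kij pij; lia.
have lij := rk_lt kij pij.
have [a0|/mate_ex[m [km pm am hmj]]] := posnP (a j); first by rewrite a0; lia.
have lmj := rk_lt km pm.
have [e|ne] := eqVneq i m; first by subst m; split; lia.
have kim : k i = k m by rewrite kij km.
case/orP: (prec_total ne) => h.
  have [|h1 h2] := IH m _ kim h; first lia.
  by split=> [|e]; [lia|have := h2 ltac:(lia); have := hmj ltac:(lia); lia].
move: h pij; rewrite /prec => h pij; split; first lia.
by move=> e; have := hmj ltac:(lia); lia.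
Qed.

Definition defect j := rk j - a j.

Lemma defectE j : a j + defect j = rk j.
Proof. by rewrite addnC subnK ?a_le_rk. Qed.

Lemma defect_mono i j : k i = k j -> rk i <= rk j -> defect i <= defect j.
Proof.
move=> kij; rewrite leq_eqVlt => /orP[/eqP/(rk_inj kij)->//|].
rewrite rk_ltE // => /(rk_slope kij)[h _]; have := defectE i; have := defectE j; lia.
Qed.

(** The equality case of [rk_slope]. It makes the entries increase along each set of equal colour
    and defect, from which the lexicographic comparisons are later drawn. *)
Lemma defect_index i j : k i = k j -> defect i = defect j -> i < j -> a i < a j.
Proof.
move=> kij bij lij; rewrite ltnNge; apply/negP => h.
have ne : i != j by rewrite -val_eqE /= neq_ltn lij.
have := defectE i; have := defectE j.
have pji : prec j i by rewrite /prec; lia.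
have [_ h2] := rk_slope (esym kij) pji.
by move=> e1 e2; have := h2 ltac:(lia); lia.
Qed.

Section Minimum.
Variable s : 'S_n.
Hypothesis ks : forall j, k (s j) = k j.

(** A pigeonhole argument: if the defect rose at [j], the indices of rank at least that of [s j]
    would all have defect larger than that of [j], while [s] maps the latter indices into those of
    rank strictly above [s j]. So the defect rises nowhere, and its total is invariant. *)
Lemma defect_no_inversion :
  (forall i j, k i = k j -> defect i < defect j -> rk (s i) < rk (s j)) ->
  forall j, defect (s j) = defect j.
Proof.
move=> hs.
have le j : defect (s j) <= defect j.
  rewrite leqNgt; apply/negP => lt.
  pose H := [set i | (k i == k j) && (defect j < defect i)].
  pose U := [set i | (k i == k j) && (rk (s j) <= rk i)].
  have UH : #|U| <= #|H|.
    apply/subset_leq_card/subsetP => i; rewrite !inE => /andP[/eqP ki h]; rewrite ki eqxx /=.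
    by apply: leq_trans lt _; apply: defect_mono; rewrite ?ks.
  have : #|s @: H| < #|U|.
    apply: proper_card; apply/properP; split.
      apply/subsetP => _ /imsetP[i + ->]; rewrite !inE ks => /andP[/eqP ki h].
      by rewrite ki eqxx /= ltnW // hs.
    exists (s j); first by rewrite inE ks eqxx leqnn.
    by rewrite mem_imset; [rewrite inE ltnn andbF|apply: perm_inj].
  by rewrite (card_imset _ (@perm_inj _ s)) ltnNge UH.
have e : \sum_j defect (s j) = \sum_j defect j by rewrite [RHS](reindex_inj (@perm_inj _ s)).
move=> j; apply/eqP; rewrite eqn_leq le /= leqNgt; apply/negP => lt.
move: e; rewrite (bigD1 j) //= [RHS](bigD1 j) //=.
have : \sum_(i | i != j) defect (s i) <= \sum_(i | i != j) defect i by apply: leq_sum.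
move: (\sum_(i | _) defect (s i)) (\sum_(i | _) defect i) => x y; lia.
Qed.

End Minimum.

(** Up to the factor [n.+1 ^ B] this is the power sum of the exponents rk o s - defect; the offset
    [B] gives it a meaning also for those [s] that make an exponent negative. *)
Definition energy B (s : 'S_n) := \sum_j n.+1 ^ (rk (s j) + (B - defect j)).

(* A rearrangement argument: undoing an inversion lowers the energy. *)
Lemma energy_min B (s : 'S_n) : (forall j, defect j <= B) -> (forall j, k (s j) = k j) ->
  (forall t : 'S_n, (forall j, k (t j) = k j) -> energy B s <= energy B t) ->
  forall j, defect (s j) = defect j.
Proof.
move=> hB ks hmin; apply: defect_no_inversion => // i j kij bij.
have nij : i != j by apply: contraTneq bij => ->; rewrite ltnn.
rewrite ltnNge; apply/negP; rewrite leq_eqVlt => /orP[/eqP e|lt].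
  have := rk_inj _ e; rewrite !ks => /(_ (esym kij)) /perm_inj e2.
  by rewrite e2 eqxx in nij.
pose t := (tperm i j * s)%g.
have kt x : k (t x) = k x by rewrite permM ks; case: tpermP => [->|->|].
have := hmin t kt; rewrite leqNgt => /negP; apply.
rewrite /energy (bigD1 i) // [X in _ < X](bigD1 i) //= (bigD1 j) 1?eq_sym // [X in _ < _ +
  X](bigD1 j) 1?eq_sym //=.
rewrite !permM tpermL tpermR.
rewrite (eq_bigr (fun x => n.+1 ^ (rk (s x) + (B - defect x)))); last first.
  by move=> x /andP[xi xj]; rewrite permM tpermD // eq_sym.
rewrite !addnA ltn_add2r !expnD.
have n1 : 1 < n.+1 by rewrite ltnS; apply: leq_ltn_trans (ltn_ord i).
have h1 : n.+1 ^ rk (s j) < n.+1 ^ rk (s i) by rewrite ltn_exp2l.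
have h2 : n.+1 ^ (B - defect j) < n.+1 ^ (B - defect i).
  by rewrite ltn_exp2l //; have := hB j; lia.
move: h1 h2; move: (n.+1 ^ rk (s j)) (n.+1 ^ rk (s i)) (n.+1 ^ (B - defect j)) (n.+1 ^ (B -
  defect i)) => x y z w; nia.
Qed.

(* Compatible with the comparison of decreasing rearrangements since the base
   exceeds the number of entries. *)
Definition power_sum (m : 'I_n -> nat) := \sum_j n.+1 ^ m j.

(** A permutation of least energy preserves the defect, so its energy is that of [a]. The hypothesis
    therefore makes [s] a minimiser too. *)
Lemma power_sum_min (s : 'S_n) (m : 'I_n -> nat) : (forall j, k (s j) = k j) ->
  (forall j, m j + defect j = rk (s j)) -> power_sum m <= power_sum a ->
  forall j, defect (s j) = defect j.
Proof.
move=> ks hm le; pose B := \max_j defect j.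
have hB j : defect j <= B by apply: leq_bigmax.
have em : energy B s = power_sum m * n.+1 ^ B.
  rewrite /energy /power_sum big_distrl /=; apply: eq_bigr => j _.
  by rewrite -expnD -hm; congr (_ ^ _); have := hB j; lia.
pose P (t : 'S_n) := [forall j, k (t j) == k j].
have P1 : P 1%g by apply/forallP => j; rewrite perm1.
have fixE (t : 'S_n) : (forall j,
  defect (t j) = defect j) -> energy B t = power_sum a * n.+1 ^ B.
  move=> ht; rewrite /energy /power_sum big_distrl /= [RHS](reindex_inj (@perm_inj _ t)) /=.
  apply: eq_bigr => j _; rewrite -expnD -defectE ht; congr (_ ^ _).
  by have := hB j; lia.
have [t Pt tmin] := @arg_minnP _ 1%g P (energy B) P1.
have kt j : k (t j) = k j by have /forallP/(_ j)/eqP := Pt.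
have ht : forall j, defect (t j) = defect j.
  by apply: (@energy_min B t) => // u ku; apply: tmin; apply/forallP => j; rewrite ku.
apply: (@energy_min B s) => // u ku; apply: (@leq_trans (energy B t)).
  by rewrite em (fixE t ht) leq_mul2r le orbT.
by apply: tmin; apply/forallP => j; rewrite ku.
Qed.

End Ranks.

Lemma sum_conj_le la L (O : {set 'I_L}) r : sorted geq la -> #|O| <= r ->
  \sum_(c in O) nth 0 (conj_part la) c <= \sum_(0 <= i < r) nth 0 (conj_part la) i.
Proof.
move=> sla hO; under eq_bigr do rewrite nth_conj_part //.
under [X in _ <= X]eq_bigr do rewrite nth_conj_part //.
rewrite (eq_bigr (fun c : 'I_L => \sum_(p <- la) (c < p))); last first.
  by move=> i _; rewrite -sum1_count big_mkcond.
rewrite [X in _ <= X](eq_bigr (fun c => \sum_(p <- la) (c < p))); last first.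
  by move=> i _; rewrite -sum1_count big_mkcond.
rewrite exchange_big [X in _ <= X]exchange_big /=; apply: leq_sum => p _.
have -> : \sum_(0 <= i < r) (i < p) = minn r p.
  elim: r {hO} => [|r IH]; first by rewrite big_nil min0n.
  by rewrite big_nat_recr //= IH; lia.
rewrite leq_min; apply/andP; split.
  by apply: leq_trans hO; rewrite -sum1_card; apply: leq_sum => c _; case: ltnP.
have -> : \sum_(i in O) (i < p) = #|[set c in O | c < p]|.
  rewrite -sum1_card big_mkcond [RHS]big_mkcond; apply: eq_bigr => c _; rewrite inE.
  by case: (c \in O) => //=; case: ltnP.
apply: (@leq_trans #|[set c : 'I_L | c < p]|).
  by apply/subset_leq_card/subsetP => c; rewrite !inE => /andP[].
have [pL|Lp] := leqP p L; first by rewrite card_ord_lt.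
by apply: leq_trans (max_card _) _; rewrite card_ord ltnW.
Qed.

Lemma sum_inj_lt (X : finType) (A : {set X}) (f : X -> nat) : {in A &, injective f} ->
  (forall x, x \in A -> f x < #|A|) -> \sum_(x in A) f x = \sum_(0 <= i < #|A|) i.
Proof.
move=> fi fl; rewrite -big_enum /= -[LHS](big_map f xpredT id); apply: perm_big.
have u : uniq [seq f x | x <- enum A].
  by rewrite map_inj_in_uniq ?enum_uniq // => x y; rewrite !mem_enum; apply: fi.
have s : {subset [seq f x | x <- enum A] <= index_iota 0 #|A|}.
  by move=> _ /mapP[x xA ->]; rewrite mem_index_iota fl // -mem_enum.
apply: uniq_perm => //; first exact: iota_uniq.
by case: (uniq_min_size u s); rewrite // size_map -cardE size_iota subn0.
Qed.

Lemma prodX_set n (T : {set 'I_n}) :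
  (\prod_(i in T) 'X_i = 'X_[[multinom (i \in T : nat) | i < n]] :> {mpoly rat[n]})%R.
Proof.
rewrite mpolyXE_id big_mkcond /=; apply: eq_bigr => i _; rewrite mnmE.
by case: ifP; rewrite ?expr1 ?expr0.
Qed.

Section Functional.
Variables (n : nat) (la : seq nat) (a k : 'I_n -> nat).
Hypothesis hla : is_partition n la.
Local Notation nu := (conj_part la).
Hypothesis hk : forall c, #|[set j | k j == c]| = nth 0 nu c.
Hypothesis ak_mate : forall j, 0 < a j -> exists2 j', k j' = k j &
    (a j' = a j /\ j < j') \/ ((a j').+1 = a j /\ j' < j).
Local Notation L := (size nu).
Local Notation rk := (rk a k).
Local Notation defect := (defect a k).
Implicit Types (s : 'S_n) (S T : {set 'I_n}).

Definition colour_perm s := [forall j, k (s j) == k j].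

Definition Lmon (m : 'X_{1..n}) : rat := (\sum_(s | colour_perm s)
  (-1) ^+ s * [forall j, (m j + defect j)%N == rk (s j)]%:R)%R.

Lemma colour_lt j : k j < L.
Proof.
rewrite ltnNge; apply/negP => h; have /eqP := hk (k j); rewrite nth_default // cards_eq0.
by move=> /eqP/setP/(_ j); rewrite !inE eqxx.
Qed.

Definition colour_class (c : 'I_L) : {set 'I_n} := [set j | k j == c].

Lemma card_colour_class c : #|colour_class c| = nth 0 nu c. Proof. exact: hk. Qed.

Lemma sum_colour_class (A : {set 'I_L}) : \sum_(c in A) #|colour_class c| = #|\bigcup_(c in A)
  colour_class c|.
Proof.
symmetry; rewrite -sum1_card (eq_bigr (fun c => \sum_(j in colour_class c) 1)); last first.
  by move=> c _; rewrite sum1_card.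
have -> : \sum_(i in \bigcup_(c in A) colour_class c) 1 =
    \sum_(i | Ordinal (colour_lt i) \in A) 1.
  apply: eq_bigl => j; apply/bigcupP/idP => [[c cA]|h].
    by rewrite inE => /eqP e; rewrite (_ : Ordinal _ = c) //; apply: val_inj.
  by exists (Ordinal (colour_lt j)) => //; rewrite inE.
rewrite (partition_big (fun j => Ordinal (colour_lt j)) (mem A)) //=.
apply: eq_bigr => c cA; apply: eq_bigl => j; rewrite inE -val_eqE /=.
by case: eqP => [e|]; rewrite ?andbF // andbT (_ : Ordinal _ = c) //; apply: val_inj.
Qed.

(** Each class not contained in [S] uses a place outside [S], so there are at most n - |S| of them,
    and together they have at most the size of the first n - |S| columns. The classes inside [S]
    thus cover at least p^n_|S| places, and [T] is too large to avoid them. *)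
Lemma meets_colour_class S T d : #|S| < d + tanisaki_p n la #|S| -> T \subset S -> #|T| = d ->
  exists c : 'I_L, (colour_class c \subset S) && (colour_class c :&: T != set0).
Proof.
move=> hd TS hT; apply/existsP; apply: contraLR hd; rewrite negb_exists => /forallP h.
have [sla _ /eqP hn] := and3P hla.
pose I := [set c : 'I_L | colour_class c \subset S].
have dis : [disjoint T & \bigcup_(c in I) colour_class c].
  rewrite -setI_eq0; apply/eqP/setP => j; rewrite !inE; apply/negP => /andP[jT /bigcupP[c]].
  rewrite inE => cS jc; have := h c; rewrite cS /= negbK => /eqP/setP/(_ j).
  by rewrite !inE jT andbT -[_ == _]/(_ : bool); move: jc; rewrite inE => ->.
have h1 : d + \sum_(c in I) #|colour_class c| <= #|S|.
  have := cardsUI T (\bigcup_(c in I) colour_class c); move: dis; rewrite -setI_eq0 => /eqP ->.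
  rewrite sum_colour_class cards0 addn0 hT => <-; apply: subset_leq_card; rewrite subUset TS.
  by apply/bigcupsP => c; rewrite inE.
have h2 : #|~: I| <= n - #|S|.
  have -> : n - #|S| = #|~: S| by have := cardsC S; rewrite card_ord; lia.
  apply: leq_trans (leq_imset_card (fun j => Ordinal (colour_lt j)) _).
  apply/subset_leq_card/subsetP => c; rewrite !inE => /subsetPn[j]; rewrite inE => /eqP e jS.
  by apply/imsetP; exists j; [rewrite inE|apply: val_inj].
have h3 := sum_conj_le sla h2.
have tot : \sum_(c : 'I_L) #|colour_class c| = n.
  transitivity (sumn nu); last by rewrite sumn_conj_part.
  rewrite sumnE (big_nth 0) big_mkord.
  by apply: eq_bigr => c _; apply: card_colour_class.
have Ln : L <= n.
  rewrite -hn size_mkseq; case: (la) => //= p s; exact: leq_addr.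
have tot' : \sum_(0 <= i < n) nth 0 nu i = n.
  apply: etrans tot; rewrite (big_cat_nat (n := L)) //= -[RHS]addn0 big_mkord; congr (_ + _).
    by apply: eq_bigr => c _; rewrite card_colour_class.
  by rewrite big_nat_cond big1 // => i /andP[/andP[hi _] _]; rewrite nth_default.
have Sn : #|S| <= n by apply: leq_trans (max_card _) _; rewrite card_ord.
have := tot; rewrite (bigID (mem I)) /=.
have -> : \sum_(i | i \notin I) #|colour_class i| = \sum_(c in ~: I) nth 0 nu c.
  by apply: eq_big => c; rewrite ?inE // => _; apply: card_colour_class.
move: tot'; rewrite (big_cat_nat (n := n - #|S|)) ?leq_subr //= -/(tanisaki_p n la #|S|).
move: h1 h3 Sn; rewrite -leqNgt;
  move: (\sum_(c in I) #|colour_class c|) (\sum_(c in ~: I) nth 0 nu c).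
move: (\sum_(0 <= i < n - #|S|) nth 0 nu i) (tanisaki_p n la #|S|) (#|S|).
clear; lia.
Qed.

Lemma Lmon_perm (t : 'S_n) (c c' : 'X_{1..n}) : colour_perm t ->
  (forall j, c' j + defect j = c (t j) + defect (t j)) -> Lmon c' = ((-1) ^+ t * Lmon c)%R.
Proof.
move=> /forallP pt ht; rewrite /Lmon (reindex_inj (mulgI t)) /= mulr_sumr.
apply: eq_big => [s|s _].
  apply/forallP/forallP => h j; last by rewrite permM (eqP (h (t j))); apply: pt.
  have := h ((t^-1)%g j); rewrite permM permKV => /eqP ->.
  by rewrite -[X in _ == k X](permKV t) eq_sym; apply: pt.
rewrite odd_permM signr_addb -mulrA; congr (_ * (_ * _%:R))%R.
congr nat_of_bool; apply/forallP/forallP => h j.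
  by have := h ((t^-1)%g j); rewrite ht permM permKV.
by rewrite ht permM; apply: h.
Qed.

(* Every T meets a colour class contained in S. If c + defect takes a value twice
   on that class, transposing the two places reverses the sign; otherwise
   c + defect is already a bijection onto an initial segment, and adding T is too
   much. *)
Lemma Lmon_esym (c : 'X_{1..n}) S d : #|S| < d + tanisaki_p n la #|S| ->
  (\sum_(T : {set 'I_n} | (T \subset S) && (#|T| == d))
    Lmon (c + [multinom (i \in T : nat) | i < n])%MM = 0)%R.
Proof.
move=> hd; pose Q T (c : 'I_L) := (colour_class c \subset S) && (colour_class c :&: T != set0).
(* The sets are grouped by one chosen class, so that the transposition used below, which preserves
   every class, acts within a group. *)
rewrite (partition_big (fun T => [pick c | Q T c]) xpredT) //= big1 // => -[x|] _; last first.
  rewrite big_pred0 // => T; apply/negP => /andP[/andP[TS /eqP hT]].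
  case: pickP => // h _; have [x] := meets_colour_class hd TS hT; rewrite -/(Q T x) h //.
pose ct j := c j + defect j.
have [|nex] := boolP [exists y in colour_class x, [exists z in colour_class x,
  (y != z) && (ct y == ct z)]].
  case/existsP=> y /andP[yx /existsP[z /and3P[zx nyz /eqP eyz]]].
  rewrite !inE in yx zx.
  pose t := tperm y z; pose ft T := t @: T.
  have ctt j : ct (t j) = ct j by rewrite /t; case: tpermP => [->|->|].
  have mt T j : (j \in ft T) = (t j \in T).
    by rewrite -{1}[j](tpermK y z) mem_imset //; apply: perm_inj.
  have ftK : involutive ft by move=> T; apply/setP => j; rewrite !mt tpermK.
  have pt : colour_perm t.
    apply/forallP => j; rewrite /t; case: tpermP => [->|->|] //.
      by rewrite (eqP yx) (eqP zx).
    by rewrite (eqP yx) (eqP zx).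
  have clst c0 j : (t j \in colour_class c0) = (j \in colour_class c0).
    by rewrite !inE; have /forallP/(_ j)/eqP -> := pt.
  have Qt T c0 : Q (ft T) c0 = Q T c0.
    congr (_ && ~~ _); have -> : colour_class c0 :&: ft T = ft (colour_class c0 :&: T).
      by apply/setP => j; rewrite mt !inE mt -!(in_set (fun j => k j == c0)) clst.
    by rewrite imset_eq0.
  pose V := [pred T : {set 'I_n} | (T \subset S) && (#|T| == d) && ([pick c | Q T c] == Some
    x)].
  have VP T : V T -> V (ft T) /\ ft (ft T) = T.
    move=> /= /andP[/andP[TS /eqP hT] hp]; split; last exact: ftK.
    rewrite (card_imset _ (@perm_inj _ t)) hT eqxx andbT (eq_pick (Qt T)) hp andbT.
    have xS : colour_class x \subset S by move: hp; case: pickP => // x' /andP[h _] /eqP[<-].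
    apply/subsetP => j; rewrite mt; have [jx _|jx] := boolP (j \in colour_class x);
      first exact: (subsetP xS).
    rewrite /t; case: tpermP => [ey|ez|_ _]; last exact: (subsetP TS).
      by rewrite ey inE yx in jx.
    by rewrite ez inE zx in jx.
  have e1 := @big_invol _ 0%R _ _ V ft (fun T =>
    Lmon (c + [multinom (i \in T : nat) | i < n])%MM) VP.
  have e2 : (\sum_(T | V T) Lmon (c + [multinom (i \in ft T : nat) | i < n])%MM =
     - \sum_(T | V T) Lmon (c + [multinom (i \in T : nat) | i < n])%MM)%R.
    rewrite -sumrN; apply: eq_bigr => T _.
    rewrite (@Lmon_perm t (c + [multinom (i \in T : nat) | i < n])%MM) // => [|j].
      by rewrite odd_tperm nyz expr1 mulN1r.
    by rewrite !mnmDE !mnmE mt addnAC [RHS]addnAC; have := ctt j; rewrite /ct => ->.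
  by move/eqP: (etrans (e1 _) e2); rewrite -addr_eq0 -mulr2n mulrn_eq0 /= => /eqP.
have ci : {in colour_class x &, injective ct}.
  move=> y z yx zx eyz; apply/eqP/negPn/negP => nyz; case/negP: nex.
  by apply/existsP; exists y; rewrite yx; apply/existsP; exists z; rewrite zx nyz eyz eqxx.
rewrite big1 // => T /andP[/andP[TS hT]]; case: pickP => // x' /andP[xS nT] /eqP[e]; subst x'.
rewrite /Lmon big1 // => s ps; case: forallP => [h|]; last by rewrite mulr0.
have ks j : k (s j) = k j by have /forallP/(_ j)/eqP := ps.
have hj j : ct j + (j \in T) = rk (s j).
  by have /eqP <- := h j; rewrite mnmDE mnmE addnAC.
have rb j : j \in colour_class x -> rk j < #|colour_class x|.
  by rewrite inE => /eqP jx; rewrite /colour_class -jx; apply: rk_bound.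
have sx j : (s j \in colour_class x) = (j \in colour_class x) by rewrite !inE ks.
have e1 : \sum_(j in colour_class x) ct j = \sum_(0 <= i < #|colour_class x|) i.
  apply: sum_inj_lt => // j jx; have := rb (s j); rewrite sx -hj => /(_ jx); lia.
have e2 : \sum_(j in colour_class x) rk (s j) = \sum_(0 <= i < #|colour_class x|) i.
  apply: sum_inj_lt => [i j ix jx e|j jx]; last by apply: rb; rewrite sx.
  apply: (@perm_inj _ s); apply: rk_inj e; rewrite !ks.
  by move: ix jx; rewrite !inE => /eqP -> /eqP ->.
case/set0Pn: nT => z; rewrite inE => /andP[zx zT].
move: e2; rewrite -e1 => /eqP; rewrite (eq_bigr (fun j => ct j + (j \in T))) // big_split /=.
by rewrite -[X in _ == X]addn0 eqn_add2l (bigD1 z) //= zT.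
Qed.

Definition Lfun (f : {mpoly rat[n]}) : rat := (\sum_(m <- msupp f) f@_m * Lmon m)%R.

Lemma LfunE (B : seq 'X_{1..n}) (f : {mpoly rat[n]}) : uniq B -> {subset msupp f <= B} ->
  Lfun f = (\sum_(m <- B) f@_m * Lmon m)%R.
Proof.
move=> uB sB; rewrite [RHS](bigID (mem (msupp f))) /= [X in (_ + X)%R]big1 ?addr0; last first.
  by move=> m; rewrite mcoeff_msupp negbK => /eqP ->; rewrite mul0r.
rewrite -[RHS]big_filter; apply: perm_big; apply: uniq_perm; rewrite ?filter_uniq //.
by move=> m; rewrite mem_filter; case: (boolP (m \in msupp f)) => //= /sB ->.
Qed.

Lemma LfunD f g : Lfun (f + g)%R = (Lfun f + Lfun g)%R.
Proof.
pose B := undup (msupp f ++ msupp g).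
have uB : uniq B by apply: undup_uniq.
rewrite (@LfunE B (f + g)%R uB) ?(@LfunE B f uB) ?(@LfunE B g uB).
- by rewrite -big_split /=; apply: eq_bigr => m _; rewrite mcoeffD mulrDl.
- by move=> m mg; rewrite mem_undup mem_cat mg orbT.
- by move=> m mf; rewrite mem_undup mem_cat mf.
- by move=> m /msuppD_le; rewrite mem_undup.
Qed.

Lemma Lfun0 : Lfun 0%R = 0%R.
Proof. by rewrite /Lfun msupp0 big_nil. Qed.

Lemma Lfun_sum (I : Type) (r : seq I) (P : pred I) F :
  Lfun (\sum_(i <- r | P i) F i)%R = (\sum_(i <- r | P i) Lfun (F i))%R.
Proof. by apply: (big_morph _ LfunD Lfun0). Qed.

Lemma LfunZX x m : Lfun (x *: 'X_[m])%R = (x * Lmon m)%R.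
Proof.
rewrite (@LfunE [:: m]) //; first by rewrite big_seq1 mcoeffZ mcoeffX eqxx mulr1.
by move=> m' /msuppZ_le; rewrite msuppX.
Qed.

Lemma Lfun_tanisaki f : f \in tanisaki_ideal n la -> Lfun f = 0%R.
Proof.
move=> /asboolP[s [hs ->]]; rewrite Lfun_sum big_seq big1 // => q /hs[S [d [hd ->]]].
rewrite [q.1]mpolyE mulr_suml Lfun_sum big1 // => c _.
rewrite /esym_in mulr_sumr Lfun_sum.
rewrite (eq_bigr (fun T : {set 'I_n} =>
  (q.1@_c * Lmon (c + [multinom (i \in T : nat) | i < n])%MM)%R)).
  by rewrite -mulr_sumr Lmon_esym // mulr0.
by move=> T _; rewrite prodX_set -scalerAl -mpolyXD LfunZX.
Qed.

End Functional.

Definition perm_mon n (a : 'I_n -> nat) (s : 'S_n) : 'X_{1..n} := [multinom a (s j) | j < n].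

(** The groups are the pairs of colour and defect. By [power_sum_min], a monomial with power sum at
    most that of [a] meets the functional only through permutations preserving these groups. *)
Lemma tanisaki_functional n la (a : 'I_n -> nat) : is_partition n la -> mates (conj_part la) a
  ->
  exists2 grp : 'I_n -> nat * nat,
    forall i j, grp i = grp j -> i < j -> a i < a j &
    forall f, f \in tanisaki_ideal n la ->
      (forall m, m \in msupp f -> power_sum m <= power_sum a) ->
      (\sum_(s : 'S_n | [forall j, grp (s j) == grp j]) (-1) ^+ s * f@_(perm_mon a s) = 0)%R.
Proof.
move=> hla [k hk ha]; exists (fun j => (k j, defect a k j)).
  by move=> i j [kij dij]; apply: (defect_index ha).
move=> f fI hf; apply: etrans (Lfun_tanisaki a hla hk fI); rewrite /Lfun.
under [RHS]eq_bigr do rewrite /Lmon mulr_sumr.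
rewrite exchange_big /= [RHS](bigID (fun s : 'S_n =>
  [forall j, defect a k (s j) == defect a k j])) /=.
rewrite [X in (_ = _ + X)%R]big1 ?addr0 => [|s /andP[/forallP ps /negP ns]].
  apply: eq_big => [s|s /forallP hs].
    apply/forallP/andP => [h|[/forallP h1 /forallP h2] j]; last first.
      by rewrite xpair_eqE h1 h2.
    by split; apply/forallP => j; case/eqP: (h j) => e1 e2; rewrite ?e1 ?e2.
  have ds j : defect a k (s j) = defect a k j by case/eqP: (hs j).
  have bE (m : 'X_{1..n}) : [forall j,
    (m j + defect a k j)%N == rk a k (s j)] = (m == perm_mon a s).
    apply/forallP/eqP => [h|-> j]; last by rewrite mnmE -ds defectE.
    apply/mnmP => j; have /eqP := h j; rewrite -(defectE ha) ds mnmE => /addIn //.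
  under [RHS]eq_bigr do rewrite bE mulrCA.
  rewrite -mulr_sumr; congr (_ * _)%R.
  case: (boolP (perm_mon a s \in msupp f)) => hm.
    rewrite (bigD1_seq _ hm) ?msupp_uniq //= eqxx mulr1 big1 ?addr0 // => m /negPf ->.
    by rewrite mulr0.
  rewrite big_seq big1; first by apply/eqP; rewrite mcoeff_eq0.
  move=> m mf; case: eqP => [e|]; last by rewrite mulr0.
  by rewrite -e mf in hm.
rewrite big_seq big1 // => m mf; case: forallP => [h|]; last by rewrite !mulr0.
case: ns; apply/forallP => j; apply/eqP.
apply: (power_sum_min ha) (hf m mf) _ => i; first exact/eqP.
exact/eqP.
Qed.

(** * The dimension bound *)

Section Spanning.
Local Open Scope ring_scope.
Variable n : nat.
Local Notation P := {mpoly rat[n]}.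
Implicit Types (W : P -> Prop) (B : seq P) (S V : {set 'I_n}).

Definition is_ideal W := [/\ W 0, forall f g, W f -> W g -> W (f + g) & forall h f,
  W f -> W (h * f)].

Definition in_span B (f : P) := exists c : nat -> rat, f = \sum_(i < size B) c i *: B`_i.

Lemma in_span_cat B1 B2 f g : in_span B1 f -> in_span B2 g -> in_span (B1 ++ B2) (f + g).
Proof.
move=> [c1 ->] [c2 ->]; exists (fun i => if (i < size B1)%N then c1 i else c2 (i - size B1)%N).
rewrite size_cat big_split_ord; congr (_ + _); apply: eq_bigr => i _ /=.
  by rewrite ltn_ord nth_cat ltn_ord.
by rewrite nth_cat ltnNge leq_addr addKn.
Qed.

Definition spanned W (m0 : P) B := forall g, exists2 f, in_span B f & W (g * m0 - f).

Lemma esym_inS x S d : x \notin S ->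
  esym_in (x |: S) d.+1 = esym_in S d.+1 + 'X_x * esym_in S d.
Proof.
move=> xS; rewrite /esym_in (bigID (fun T : {set 'I_n} => x \in T)) /= addrC; congr (_ + _).
  apply: eq_bigl => T; apply/andP/andP => [[/andP[h1 h2] h3]|[h1 h2]].
    split=> //; apply/subsetP => y yT; have := subsetP h1 y yT; rewrite !inE.
    by case/orP=> // /eqP e; rewrite -e yT in h3.
  rewrite h2 (subset_trans h1 (subsetUr _ _)); split=> //.
  by apply: contra xS; apply: (subsetP h1).
rewrite mulr_sumr [LHS](reindex_onto (fun T : {set 'I_n} => x |: T) (fun T => T :\ x)) /=;
  last first.
  by move=> T /andP[_ xT]; rewrite setD1K.
apply: eq_big => [T|T].
  rewrite setU11 andbT; apply/andP/andP => [[/andP[h1 /eqP h2] /eqP h3]|[h1 /eqP h2]].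
    have xT : x \notin T by rewrite -h3 !inE eqxx.
    split; last by move: h2; rewrite cardsU1 xT add1n => -[->].
    by rewrite -h3 subDset.
  have xT : x \notin T by apply: contra xS; apply: (subsetP h1).
  by rewrite setU1K // cardsU1 xT h2 add1n !eqxx setUS.
case/andP=> /andP[/andP[h1 _] _] /eqP h3; have xT : x \notin T by rewrite -h3 !inE eqxx.
by rewrite big_setU1.
Qed.

Lemma esym_in0 S : esym_in S 0 = 1.
Proof.
rewrite /esym_in (big_pred1 set0) ?big_set0 // => T /=.
by rewrite cards_eq0; case: eqP => [->|]; rewrite ?andbF // sub0set.
Qed.

(* Repeated use of x e_d(S) = e_(d+1)(x |: S) - e_(d+1)(S). *)
Lemma esym_chain W m0 x S d t : is_ideal W -> x \notin S ->
  (forall j, (d < j <= d + t)%N -> W (esym_in (x |: S) j * m0)) ->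
  W (esym_in S (d + t) * m0) -> W ('X_x ^+ t * (esym_in S d * m0)).
Proof.
move=> [W0 WD WM] xS; elim: t d => [|t IH] d hj hd; first by rewrite expr0 mul1r -(addn0 d).
have -> : 'X_x ^+ t.+1 * (esym_in S d * m0) =
   'X_x ^+ t * (esym_in (x |: S) d.+1 * m0) + (-1) * ('X_x ^+ t * (esym_in S d.+1 * m0)).
  by rewrite esym_inS // exprSr; ring.
apply: (WD); first by apply/WM/hj; lia.
apply: (WM); apply: IH => [j h|]; last by rewrite addSnnS.
by apply: hj; lia.
Qed.

Definition col la i := count (fun p => (i < p)%N) la.
(* The p^N_m of the row lengths la, which need not be sorted. *)
Definition tail_cols N la m := (\sum_(N - m <= i < N) col la i)%N.

(** Modulo [W], the element [m0] is annihilated by the variables outside [V] and by the Tanisaki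
    generators of [la] in the variables of [V]: it generates a quotient of a Garsia-Procesi module
    with fewer variables. *)
Definition spanning_hyp W m0 V la :=
  [/\ is_ideal W, sumn la = #|V|, forall y, y \notin V -> W ('X_y * m0) &
      forall S d, S \subset V -> (#|S| < d + tail_cols #|V| la #|S|)%N -> W (esym_in S d * m0)].

Lemma spanning_base W m0 la : spanning_hyp W m0 set0 la -> spanned W m0 [:: m0].
Proof.
case=> [[W0 WD WM] _ hy _] g; exists (g@_0 *: m0).
  by exists (fun=> g@_0); rewrite big_ord1.
rewrite {1}[g]mpolyE.
have -> : (\sum_(m <- msupp g) g@_m *: 'X_[m]) * m0 - g@_0 *: m0 =
   \sum_(m <- msupp g | m != 0%MM) (g@_m *: 'X_[m]) * m0.
  case: (boolP (0%MM \in msupp g)) => h0.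
    rewrite (bigD1_seq _ h0) ?msupp_uniq //= mpolyX0 mulrDl -mul_mpolyC mulr1 mul_mpolyC.
    by rewrite addrAC subrr add0r mulr_suml.
  move: (h0); rewrite mcoeff_msupp negbK => /eqP ->; rewrite scale0r subr0 mulr_suml.
  rewrite [RHS]big_seq_cond big_seq; apply: eq_bigl => m; case: eqP => [->|]; rewrite ?andbT //.
  by rewrite (negPf h0).
apply: (big_ind W) => // m m0'; rewrite -scalerAl -mul_mpolyC; apply: (WM).
have [i hi] : exists i, m i != 0%N.
  apply/existsP; apply: contraNT m0'; rewrite negb_exists => /forallP h.
  by apply/eqP/mnmP => i; rewrite mnm0E; apply/eqP; have := h i; rewrite negbK.
have -> : m = (m - U_(i) + U_(i))%MM.
  by rewrite submK //; apply/mnm_lepP => j; rewrite mnm1E; case: eqP => // <-; rewrite lt0n.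
by rewrite mpolyXD -mulrA; apply/WM/hy; rewrite inE.
Qed.

Lemma col_perm la la' i : perm_eq la la' -> col la i = col la' i.
Proof. by rewrite /col => /seq.permP ->. Qed.

Lemma col_decr la i j : (i < size la)%N -> (0 < nth 0%N la i)%N ->
  col la j = (col (set_nth 0%N la i (nth 0%N la i).-1) j + (j == (nth 0%N la i).-1))%N.
Proof.
elim: la i => // p la IH [|i] /= hi hp; last by have := IH i hi hp; rewrite /col /= => ->;
  rewrite addnA.
by rewrite /col /=; lia.
Qed.

Lemma prod_decr la i : (i < size la)%N -> (0 < nth 0%N la i)%N ->
  (\prod_(p <- la) p`! = nth 0 la i * \prod_(p <- set_nth 0 la i (nth 0 la i).-1) p`!)%N.
Proof.
elim: la i => // p la IH [|i] /= hi hp; rewrite !big_cons.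
  by case: p hp => // p _; rewrite factS mulnA.
by rewrite (IH i) // mulnCA.
Qed.

Lemma sumn_decr la i : (i < size la)%N -> (0 < nth 0%N la i)%N ->
  sumn la = (sumn (set_nth 0 la i (nth 0 la i).-1)).+1%N.
Proof.
elim: la i => // p la IH [|i] /= hi hp; first by case: p hp.
by rewrite (IH i) // addnS.
Qed.

Lemma col_sorted la i j : sorted geq la -> (nth 0 la i <= j)%N -> (col la j <= i)%N.
Proof.
elim: la i => // p la IH [|i] /= sla hj.
  rewrite /col /= ltnNge hj add0n leqn0; apply/eqP; rewrite -[RHS](count_pred0 la).
  apply: eq_in_count => q qla /=; apply/negbTE; rewrite -leqNgt; apply: leq_trans hj.
  move: sla; rewrite path_sortedE; last by move=> ? ? ? h1 h2; apply: leq_trans h2 h1.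
  by move=> /andP[/allP h _]; apply: h.
have := IH i (path_sorted sla) hj; rewrite /col /=; lia.
Qed.

Lemma sum_col la b : all (fun p => (p <= b)%N) la -> (\sum_(0 <= j < b) col la j)%N = sumn la.
Proof.
move=> h; under eq_bigr do rewrite /col -sum1_count big_mkcond /=.
rewrite exchange_big /= sumnE; apply: eq_big_seq => p /(allP h) hp.
rewrite (big_cat_nat (n := p)) //= -[RHS]addn0; congr addn; rewrite big_nat_cond.
  rewrite (eq_bigr (fun=> 1%N)) => [|j /andP[/andP[_ ->]]] //.
  by rewrite -big_nat_cond sum_nat_const_nat muln1 subn0.
by rewrite big1 // => j /andP[/andP[hj _] _]; rewrite ltnNge hj.
Qed.

Definition add_gen W (u : P) : P -> Prop := fun f => exists h, W (f - h * u).

Lemma add_genW W u f : is_ideal W -> W f -> add_gen W u f.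
Proof. by move=> _ hf; exists 0; rewrite mul0r subr0. Qed.

Lemma add_gen_ideal W u : is_ideal W -> is_ideal (add_gen W u).
Proof.
move=> hW; have [W0 WD WM] := hW; split; first exact: add_genW.
  move=> f g [h1 w1] [h2 w2]; exists (h1 + h2).
  by rewrite mulrDl opprD addrACA; apply: WD.
by move=> h f [h1 w1]; exists (h * h1); rewrite -mulrA -mulrBr; apply: WM.
Qed.

(** This concerns the layer between ['X_x ^+ i * m0] and ['X_x ^+ i.+1 * m0]. If the removed box
    lies in one of the columns counted for [S], or beyond them, then e_d(x |: S) already kills [m0],
    and e_d(S) differs from it by a multiple of x. Otherwise [esym_chain] exchanges the factor x^i
    for [i] degrees. *)
Lemma step_hyp W m0 V la x i : sorted geq la -> x \in V -> (i < size la)%N -> (0 < nth 0 la i)%N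
  ->
  spanning_hyp W m0 V la ->
  spanning_hyp (add_gen W ('X_x ^+ i.+1 * m0)) ('X_x ^+ i * m0) (V :\ x)
    (set_nth 0%N la i (nth 0%N la i).-1).
Proof.
move=> sla xV il hp [hW hsum hy hS]; have [W0 WD WM] := hW.
have cV : #|V| = #|V :\ x|.+1 by rewrite (cardsD1 x V) xV.
have aW f : W f -> add_gen W ('X_x ^+ i.+1 * m0) f by apply: add_genW.
split; first exact: add_gen_ideal.
- by apply: succn_inj; rewrite -cV -hsum (sumn_decr il hp).
- move=> y; rewrite !inE negb_and negbK => /orP[/eqP ->|yV].
    by exists 1; rewrite mul1r mulrA -exprS subrr.
  by apply: aW; rewrite mulrCA; apply/WM/hy.
move=> S d SV hd; have [SV' xS] : S \subset V /\ x \notin S.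
  split; first by apply: subset_trans SV (subsetDl _ _).
  by apply/negP => /(subsetP SV); rewrite !inE eqxx.
have sN : (#|S| <= #|V :\ x|)%N by apply: subset_leq_card.
move: hd; rewrite /tail_cols; set s := #|S| in sN *; set N := #|V :\ x| in sN cV *.
set la' := set_nth _ _ _ _; set q := (nth 0%N la i).-1 in la' *;
  set p' := (\sum_(_ <= _ < _) _)%N => hd.
have xSV : x |: S \subset V by rewrite subUset sub1set xV.
have cxS : #|x |: S| = s.+1 by rewrite cardsU1 xS.
have e1 : tail_cols #|V| la s.+1 = (p' + ((N - s <= q < N)%N : nat) + col la N)%N.
  rewrite /tail_cols cV subSS big_nat_recr ?leq_subr //=; congr addn.
  rewrite (eq_bigr (fun j => col la' j + (j == q))%N); last by move=> j _; apply: col_decr.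
  rewrite big_split /=; congr addn; have [hq|hq] := boolP (N - s <= q < N)%N.
    rewrite (bigD1_seq q) ?mem_index_iota ?iota_uniq //= eqxx big1 // => j.
    by case: eqP.
  rewrite big_nat_cond big1 // => j /andP[hj _]; case: eqP => // e.
  by rewrite -e hj in hq.
have [hq|hq] := leqP (N - s) q.
  have hp1 : (p' < tail_cols #|V| la s.+1)%N.
    rewrite e1 hq /=; case: (ltnP q N) => hqN; first lia.
    suff : (0 < col la N)%N by lia.
    rewrite /col -has_count; apply/hasP; exists (nth 0%N la i); first exact: mem_nth.
    by rewrite /=; move: hqN; rewrite /q; lia.
  have hx : W (esym_in (x |: S) d * m0).
    by apply: hS => //; rewrite cxS; move: hd hp1; move: (tail_cols _ _ _); clear; lia.
  case: d hd hx => [|d] hd hx.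
    by rewrite esym_in0 in hx; apply: aW; rewrite esym_in0 mulrCA; apply: WM.
  exists (- esym_in S d); rewrite esym_inS // in hx.
  have -> : esym_in S d.+1 * ('X_x ^+ i * m0) - - esym_in S d * ('X_x ^+ i.+1 * m0) =
    'X_x ^+ i * ((esym_in S d.+1 + 'X_x * esym_in S d) * m0) by rewrite exprS; ring.
  exact: WM.
have e2 : (p' + col la N = col la (N - s) + tail_cols #|V| la s)%N.
  have : tail_cols #|V| la s.+1 = (p' + col la N)%N.
    by rewrite e1 leqNgt hq /= addn0.
  move=> <-; rewrite /tail_cols cV subSS; have [s0|sgt] := posnP s.
    by rewrite s0 !subn0 big_nat1 big_geq // addn0.
  by rewrite big_ltn ?subSn //; lia.
(* Row [i] ends before column [N - s], so that column has at most [i] boxes; this loss is what the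
   factor x^i makes up for. *)
have hc : (col la (N - s) <= i)%N by apply: col_sorted => //; move: hq; rewrite /q; lia.
apply: aW; rewrite mulrCA; apply: (esym_chain hW xS) => [j hj|].
  apply: hS => //; rewrite cxS e1 (leqNgt (N - s)) hq /= addn0; move: hd hj; rewrite -/s;
    move: p' {e1 e2}; clear; lia.
apply: hS; first by apply: subset_trans SV (subsetDl _ _).
move: hd hc e2; rewrite -/s; move: (tail_cols _ _ _) (col _ _) (col _ _) p' {e1}; clear; lia.
Qed.

(** The chain of [esym_chain] from e_0 = 1 on [V :\ x]: e_j(V) kills [m0] for every j > 0, and on
    [V :\ x] this holds for j equal to the number of nonzero rows. *)
Lemma top_power W m0 V la x : x \in V -> spanning_hyp W m0 V la ->
  W ('X_x ^+ col la 0 * m0).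
Proof.
move=> xV [hW hsum hy hS].
have cV : #|V| = #|V :\ x|.+1 by rewrite (cardsD1 x V) xV.
have xS : x \notin V :\ x by rewrite !inE eqxx.
have hb : all (fun p => (p <= #|V|)%N) la.
  by apply/allP => p pla; rewrite -hsum sumnE (big_rem p) //=; exact: leq_addr.
have hcol := sum_col hb.
have := @esym_chain W m0 x (V :\ x) 0 (col la 0) hW xS; rewrite esym_in0 mul1r setD1K //.
apply=> [j hj|].
  by apply: hS => //; rewrite /tail_cols subnn hcol hsum; move: hj; clear; lia.
apply: hS; first exact: subsetDl.
move: hcol; rewrite hsum cV big_ltn // => e.
by rewrite /tail_cols subSnn add0n e ltnSn.
Qed.

Lemma hyp_perm W m0 V la la' : perm_eq la la' -> spanning_hyp W m0 V la -> spanning_hyp W m0 V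
  la'.
Proof.
move=> hp [h1 h2 h3 h4]; split=> //; first by rewrite -(perm_sumn hp).
move=> S d SV hd; apply: h4 => //; congr (_ < _ + _)%N: hd.
by apply: eq_bigr => j _; rewrite (col_perm _ hp).
Qed.

(** The module is filtered by powers of one variable. The layer of exponent r has at most (|V| - 1)!
    la_r / prod la_i! generators by induction, and the la_r add up to |V|. *)
Lemma spanning_bound W m0 V la : spanning_hyp W m0 V la ->
  exists2 B, spanned W m0 B & (size B * \prod_(p <- la) p`! <= #|V|`!)%N.
Proof.
move: {2}#|V| (erefl #|V|) => N; elim: N W m0 V la => [|N IH] W m0 V la hV hyp.
  exists [:: m0].
    by move/eqP: hV hyp; rewrite cards_eq0 => /eqP ->; apply: spanning_base.
  case: hyp => _; rewrite hV => hs _ _; rewrite mul1n big1_seq // => p /andP[_ pla].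
  suff -> : p = 0%N by [].
  by apply/eqP; rewrite -leqn0 -hs sumnE (big_rem p) //= leq_addr.
have [x xV] : exists x, x \in V by apply/card_gt0P; rewrite hV.
(* Removing a box may leave the rows unsorted, while [step_hyp] wants them weakly decreasing. *)
move/permEl: (perm_sort geq la) => hp; rewrite -(perm_big _ hp) /=.
have {hp}hyp : spanning_hyp W m0 V (sort geq la) by apply: hyp_perm hyp; rewrite perm_sym.
have sla : sorted geq (sort geq la) by apply: sort_sorted => ? ?; apply: leq_total.
move: (sort geq la) sla hyp => {}la sla hyp.
set L := (\prod_(p <- la) p`!)%N; set k := col la 0.
have kla i : (i < k)%N -> (i < size la)%N /\ (0 < nth 0%N la i)%N.
  move=> hi; split; first by apply: leq_trans hi _; apply: count_size.
  by rewrite lt0n; apply: contraTneq hi => e; rewrite -leqNgt; apply: col_sorted => //;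
    rewrite e.
have cV' : #|V :\ x| = N by have := cardsD1 x V; rewrite xV hV add1n => -[].
have [W0 WD WM] : is_ideal W by case: hyp.
have main i : (i <= k)%N -> exists2 B, spanned W ('X_x ^+ (k - i) * m0) B &
    (size B * L <= N`! * \sum_(k - i <= j < k) nth 0 la j)%N.
  elim: i => [|i IHi] hi.
    exists [::]; last by rewrite mul0n.
    move=> g; exists 0; first by exists (fun=> 0); rewrite big_ord0.
    by rewrite subr0 subn0; apply/WM/(top_power xV hyp).
  have [B sB cB] := IHi (ltnW hi); set r := (k - i.+1)%N.
  have er : (k - i = r.+1)%N by rewrite /r; lia.
  have rk : (r < k)%N by rewrite /r; lia.
  have [rl rp] := kla r rk.
  have [B' sB' cB'] := IH _ _ _ _ cV' (step_hyp sla xV rl rp hyp).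
  exists (B' ++ B).
    move=> g; have [f hf [h hh]] := sB' g; have [f' hf' wf'] := sB h.
    exists (f + f'); first exact: in_span_cat.
    rewrite er in wf'; rewrite opprD addrA.
    have -> : g * ('X_x ^+ r * m0) - f - f' = (g * ('X_x ^+ r * m0) - f - h * ('X_x ^+ r.+1 *
      m0))
      + (h * ('X_x ^+ r.+1 * m0) - f') by ring.
    exact: WD.
  rewrite size_cat mulnDl big_ltn // -er mulnDr; apply: leq_add => //.
  by rewrite /L (prod_decr rl rp) mulnCA mulnC leq_mul2r -cV' cB' orbT.
have [B sB cB] := main k (leqnn k); exists B.
  by rewrite subnn expr0 mul1r in sB.
apply: leq_trans cB _; rewrite subnn hV factS mulnC leq_mul2r; apply/orP; right.
case: hyp => _ hsum _ _; rewrite -hV -hsum sumnE [X in (_ <= X)%N](big_nth 0%N).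
have ks : (k <= size la)%N by apply: count_size.
by rewrite [X in (_ <= X)%N](big_cat_nat (n := k)) //= leq_addr.
Qed.

End Spanning.

(** * Major index tables *)

Lemma runs_cons x w : exists r rs, runs (x :: w) = (x :: r) :: rs.
Proof.
elim: w x => [|y w IH] x; first by exists [::], [::].
have [r [rs e]] := IH y; rewrite -[runs _]/(if runs (y :: w) is (y :: r) :: rs then
  if x < y then (x :: y :: r) :: rs else [:: x] :: (y :: r) :: rs else [:: [:: x]]) e.
by case: ifP => _; [exists (y :: r), rs|exists [::], ((y :: r) :: rs)].
Qed.

Lemma runs_find w p : uniq w -> p < size w ->
  size (runs w) - (find (fun r => nth 0 w p \in r) (runs w)).+1 =
  \sum_(p <= q < (size w).-1) (nth 0 w q.+1 < nth 0 w q).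
Proof.
elim: w p => // x [|y w] IH p; first by case: p => //= _ _; rewrite mem_head big_geq.
move=> /andP[xw uw]; have [r [rs e]] := runs_cons y w.
have -> : runs (x :: y :: w) = if x < y then (x :: y :: r) :: rs else [:: x] :: (y :: r) :: rs.
  by rewrite -[runs _]/(if runs (y :: w) is (y :: r) :: rs then
    if x < y then (x :: y :: r) :: rs else [:: x] :: (y :: r) :: rs else [:: [:: x]]) e.
case: p => [|p] hp.
  rewrite big_ltn // big_add1 /=; have := IH 0 uw isT; rewrite e /= mem_head /= subn1 /= => <-.
  have : x != y by apply: contraNneq xw => ->; rewrite mem_head.
  rewrite neq_ltn => /orP[h|h]; first by rewrite h ltnNge (ltnW h) /= mem_head subn1.
  by rewrite h ltnNge (ltnW h) /= mem_head subn1.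
rewrite [RHS]big_add1 /=; have := IH p uw hp; rewrite e /= => <-.
have nx : nth 0 (y :: w) p != x.
  by apply: contraNneq xw => <-; apply: mem_nth.
case: ifP => _ /=; first by rewrite (in_cons x)  (negPf nx).
by rewrite mem_seq1 (negPf nx).
Qed.

Section Majt.
Variables (n : nat).
Implicit Types s : 'S_n.

Lemma nth_one_line s (p : 'I_n) : nth 0 (one_line s) p = s p.
Proof. by rewrite (nth_map p) ?size_enum_ord // nth_ord_enum. Qed.

Lemma size_one_line s : size (one_line s) = n.
Proof. by rewrite size_map size_enum_ord. Qed.

Lemma uniq_one_line s : uniq (one_line s).
Proof. by rewrite map_inj_uniq ?enum_uniq // => i j /val_inj/perm_inj. Qed.

Definition descents s (p : nat) := \sum_(q < n | p <= q) gs_descent s q.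

Lemma gs_descentE s (q : 'I_n) : gs_descent s q =
  (q.+1 < n) && (nth 0 (one_line s) q.+1 < nth 0 (one_line s) q).
Proof.
rewrite nth_one_line; apply/existsP/andP => [[j /andP[/eqP e h]]|[hq h]].
  by rewrite -e nth_one_line ltn_ord.
by exists (Ordinal hq); rewrite eqxx -nth_one_line.
Qed.

Lemma majt_at s (p : 'I_n) : tnth (majt s) (s p) = descents s p.
Proof.
rewrite tnth_mktuple; have := @runs_find (one_line s) p (uniq_one_line s).
rewrite size_one_line nth_one_line => -> //; rewrite /descents [RHS]big_mkcond /=.
pose F q := if p <= q then (q.+1 < n) && (nth 0 (one_line s) q.+1 < nth 0 (one_line s) q) else
  false.
rewrite [RHS](eq_bigr (fun q : 'I_n => F q : nat)); last first.
  by move=> q _; rewrite gs_descentE /F; case: ifP.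
rewrite -(big_mkord xpredT (fun q => F q : nat)).
have pn := ltn_ord p.
have z1 : \sum_(0 <= q < p) F q = 0.
  by rewrite big_nat_cond big1 // => q /andP[/andP[_ hq] _]; rewrite /F leqNgt hq.
have z2 : \sum_(n.-1 <= q < n) F q = 0.
  rewrite big_nat_cond big1 // => q /andP[/andP[h1 h2] _].
  by rewrite /F (_ : (q.+1 < n) = false) ?if_same //; lia.
rewrite [RHS](big_cat_nat (n := p)) ?(ltnW pn) //= z1 add0n.
rewrite [RHS](big_cat_nat (n := n.-1)) ?leq_pred //=; last by lia.
rewrite z2 addn0.
rewrite big_nat_cond [RHS]big_nat_cond; apply: eq_bigr => q /andP[/andP[h1 h2] _].
by rewrite /F h1 (_ : q.+1 < n) //; lia.
Qed.

Lemma garsia_stantonE s : garsia_stanton s = ('X_[[multinom tnth (majt s) i | i < n]])%R.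
Proof.
rewrite (mpolyXE _ s) /garsia_stanton.
rewrite (eq_bigr (fun i : 'I_n => \prod_(j < n) (if (j <= i)%N then 'X_(s j) else 1))%R);
  last first.
  by move=> i _; rewrite big_mkcond.
rewrite exchange_big /=; apply: eq_bigr => j _; rewrite mnmE majt_at /descents.
rewrite -big_mkcondr /= -prodrXr big_mkcond [RHS]big_mkcond /=; apply: eq_bigr => i _.
by case: (j <= i); case: (gs_descent s i); rewrite ?expr1 ?expr0.
Qed.

Lemma descentsS s (p q : 'I_n) : q = p.+1 :> nat -> descents s p = (s q < s p) + descents s q.
Proof.
move=> e; rewrite /descents (bigD1 p) //=; congr (_ + _).
  congr nat_of_bool; apply/existsP/idP => [[j /andP[/eqP ej h]]|h]; last by exists q;
    rewrite e eqxx.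
  by rewrite (_ : q = j) //; apply: val_inj; rewrite /= e.
by apply: eq_bigl => i; rewrite e ltn_neqAle andbC eq_sym.
Qed.

Lemma descents_last s (p : 'I_n) : p.+1 = n -> descents s p = 0.
Proof.
move=> e; rewrite /descents big1 // => q hq; apply/eqP; rewrite eqb0.
by apply/existsP => -[j /andP[/eqP ej _]]; have := ltn_ord j; rewrite ej; lia.
Qed.

Local Notation bmaj s := (fun i => tnth (majt s) i).

Lemma majt_mate s i : 0 < bmaj s i -> exists j,
  (bmaj s j = bmaj s i /\ i < j) \/ ((bmaj s j).+1 = bmaj s i /\ j < i).
Proof.
rewrite -[i](permKV s); set p := (s^-1)%g i; rewrite majt_at => h.
have hp : p.+1 < n.
  rewrite ltn_neqAle ltn_ord andbT; apply: contraTneq h => e.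
  by rewrite descents_last.
pose q : 'I_n := Ordinal hp; exists (s q); rewrite !majt_at (@descentsS s p q) //.
have ne : s q != s p by rewrite (inj_eq (@perm_inj _ s)) -val_eqE /=; lia.
by move: ne; rewrite -val_eqE neq_ltn => /orP[h1|h1]; [right; rewrite h1|left;
  rewrite ltnNge (ltnW h1)].
Qed.

Lemma descents_mono s (p q : 'I_n) : p <= q -> descents s q <= descents s p.
Proof.
move=> pq; rewrite /descents big_mkcond [X in _ <= X]big_mkcond; apply: leq_sum => i _.
by case: ifP => // h; rewrite (leq_trans pq h).
Qed.

(** Entries further right have fewer descents after them, and equal numbers mean a common run, where
    values increase. So a permutation lists its values in decreasing [prec] order, and the table
    determines it. *)
Lemma prec_majt s (p q : 'I_n) : prec (bmaj s) (s q) (s p) = (p < q).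
Proof.
have main (i j : 'I_n) : i < j -> prec (bmaj s) (s j) (s i).
  move=> ij; rewrite /prec !majt_at; have := descents_mono s (ltnW ij).
  rewrite leq_eqVlt => /orP[/eqP e|-> //]; rewrite e eqxx orbC /=; apply/orP; left.
  move: {2}(j - i.+1) (leqnn (j - i.+1)) => d; elim: d i ij e => [|d IH] i ij e hd.
    have ej : j = i.+1 :> nat by lia.
    have := descentsS s ej; have : s i != s j by rewrite (inj_eq (@perm_inj _ s)) -val_eqE /=;
      lia.
    rewrite -val_eqE e /=; lia.
  have [ej|ne] := eqVneq (j : nat) i.+1; first by apply: IH => //; lia.
  have hk : i.+1 < n by have := ltn_ord j; lia.
  pose k : 'I_n := Ordinal hk; have kj : k < j by rewrite /=; lia.
  have h1 := descents_mono s (ltnW kj); have h2 := @descentsS s i k erefl.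
  have h3 : descents s j = descents s k by lia.
  apply: ltn_trans (IH k kj h3 _); last by rewrite /=; lia.
  have : s i != s k by rewrite (inj_eq (@perm_inj _ s)) -val_eqE /=; lia.
  rewrite -val_eqE /=; lia.
case: (ltngtP p q) => [/main //|/main h|/val_inj ->]; last exact: prec_irr.
by apply/negP => h'; have := prec_trans h h'; rewrite prec_irr.
Qed.

Lemma majt_inj s s' : majt s = majt s' -> s = s'.
Proof.
move=> e; apply/permP => p.
have rkE t : rk (bmaj t) (fun=> 0) (t p) = #|[set q : 'I_n | p < q]|.
  rewrite /rk -[RHS](card_imset _ (@perm_inj _ t)); apply: eq_card => i; rewrite inE eqxx /=.
  by rewrite -[i](permKV t) prec_majt mem_imset ?inE //; apply: perm_inj.
apply: (@rk_inj _ (bmaj s) (fun=> 0)) => //; rewrite rkE.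
by have := rkE s'; rewrite -e => <-.
Qed.

(** The values are listed by decreasing rank and compared with [b] from the right end. By [rk_slope]
    with a single colour, neighbours differ by at most one in [b], and by exactly one only at a
    descent. *)
Lemma majt_ex (b : 'I_n -> nat) :
  (forall i, 0 < b i -> exists j, (b j = b i /\ i < j) \/ ((b j).+1 = b i /\ j < i)) ->
  exists s, forall i, tnth (majt s) i = b i.
Proof.
move=> hb; pose r := rk b (fun=> 0).
have hm : forall j, 0 < b j -> exists2 j', (fun=> 0) j' = (fun=> 0) j :> nat &
    (b j' = b j /\ j < j') \/ ((b j').+1 = b j /\ j' < j).
  by move=> j /hb[j' h]; exists j'.
have rn j : r j < n.
  have := rk_bound b (fun=> 0) j; rewrite -/r => h; apply: leq_trans h _.
  by apply: leq_trans (max_card _) _; rewrite card_ord.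
pose pos j := rev_ord (Ordinal (rn j)).
have pos_inj : injective pos.
  move=> i j /rev_ord_inj/(congr1 val) /= e; exact: (@rk_inj _ b (fun=> 0)).
pose t := perm pos_inj; exists (t^-1)%g => i.
have tE j : t j + (r j).+1 = n :> nat.
  by rewrite permE /=; have := rn j; lia.
suff main d (p : 'I_n) : n - p <= d -> descents (t^-1)%g p = b ((t^-1)%g p).
  by rewrite -{1}[i](permK t) majt_at (main n) ?leq_subr // permK.
elim: d p => [|d IH] p hd; first by have := ltn_ord p; lia.
set j := (t^-1)%g p; have ep : p = t j by rewrite permKV.
have [e|ne] := eqVneq p.+1 n.
  rewrite descents_last //; apply/esym/eqP; rewrite -leqn0.
  have : r j = 0 by have := tE j; rewrite -ep; lia.
  by move=> <-; apply: a_le_rk hm j.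
have hq : p.+1 < n by have := ltn_ord p; lia.
pose q : 'I_n := Ordinal hq; rewrite (@descentsS _ p q) // -/j IH; last by rewrite /=; lia.
set j' := (t^-1)%g q; have eq : q = t j' by rewrite permKV.
have rj : r j = (r j').+1.
  by have := tE j; have := tE j'; rewrite -ep -eq /=; lia.
have pj : prec b j' j by rewrite -(@rk_ltE _ b (fun=> 0)) // -/r rj.
have [h1 h2] := @rk_slope _ b (fun=> 0) hm j' j erefl pj.
rewrite -/r rj in h1 h2; move: pj; rewrite /prec => pj.
have [e|e] : b j = b j' \/ b j = (b j').+1 by lia.
  by rewrite e ltnNge; lia.
by rewrite e h2 //; lia.
Qed.

End Majt.

Lemma descent_compP (b : seq nat) : descent_comp b <->
  forall i : 'I_(size b), 0 < nth 0 b i -> exists j : 'I_(size b),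
    (nth 0 b j = nth 0 b i /\ i < j) \/ ((nth 0 b j).+1 = nth 0 b i /\ j < i).
Proof.
split=> [/existsP[s /eqP e] i hi|/majt_ex[s hs]].
  by have := @majt_mate _ s i; rewrite (tnth_nth 0) e => /(_ hi)[j]; rewrite (tnth_nth 0) e;
    exists j.
apply/existsP; exists s; apply/eqP/(@eq_from_nth _ 0); rewrite size_tuple // => i hi.
by rewrite -(hs (Ordinal hi)) (tnth_nth 0).
Qed.

Lemma index_enum_lt n (A : {set 'I_n}) i j : i \in A -> j \in A ->
  (index i (enum A) < index j (enum A)) = (i < j).
Proof.
move=> iA jA; pose lt (x y : 'I_n) := x < y.
have s : sorted lt (enum A).
  rewrite -[enum A]/[seq x <- Finite.enum _ | x \in A] -enumT.
  apply: sorted_filter; first by move=> y x z; apply: ltn_trans.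
  have -> : sorted lt (enum 'I_n) = sorted ltn [seq val x | x <- enum 'I_n] by rewrite
    sorted_map.
  by rewrite val_enum_ord iota_ltn_sorted.
have tr : transitive lt by move=> y x z; apply: ltn_trans.
have main x y : x \in A -> y \in A -> index x (enum A) < index y (enum A) -> x < y.
  by move=> xA yA; apply: (sorted_ltn_index tr s); rewrite mem_enum.
apply/idP/idP => [|ij]; first exact: main.
case: ltngtP => // [h|e]; first by have := main _ _ jA iA h; lia.
by move: ij; rewrite -(nth_index i (_ : i \in enum A)) ?mem_enum // e nth_index ?mem_enum //
  ltnn.
Qed.

Lemma restr_descent_comp n (a : n.-tuple nat) (A : {set 'I_n}) : descent_comp (restr a A) <->
  forall i, i \in A -> 0 < tnth a i -> exists2 j, j \in A &
    (tnth a j = tnth a i /\ i < j) \/ ((tnth a j).+1 = tnth a i /\ j < i).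
Proof.
have sz : size (restr a A) = size (enum A) by rewrite size_map.
have nthE i : i \in A -> nth 0 (restr a A) (index i (enum A)) = tnth a i.
  by move=> iA; rewrite (nth_map i) ?index_mem ?nth_index ?mem_enum.
have idx i (iA : i \in A) : index i (enum A) < size (restr a A) by rewrite sz index_mem
  mem_enum.
have ex (p : 'I_(size (restr a A))) : exists2 i, i \in A & index i (enum A) = p.
  have hp : p < size (enum A) by rewrite -sz.
  case: (enum A) (enum_uniq A) (mem_enum A) hp => [//|x s'] u m hp.
  exists (nth x (x :: s') p); last by rewrite index_uniq.
  by rewrite -(m : _ =i _) mem_nth.
rewrite descent_compP; split=> h.
  move=> i iA hi; have := h (Ordinal (idx i iA)); rewrite /= nthE // => /(_ hi)[q].
  by have [j jA <-] := ex q; rewrite nthE // !index_enum_lt //; exists j.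
move=> p; have [i iA <-] := ex p; rewrite nthE // => hi; have [j jA hj] := h i iA hi.
by exists (Ordinal (idx j jA)); rewrite /= nthE // !index_enum_lt.
Qed.

Lemma descent_compsP n nu (a : n.-tuple nat) : sumn nu = n ->
  descent_comps nu a <-> mates nu (fun j => tnth a j).
Proof.
move=> hn; split.
  case/existsP=> A /andP[/and3P[/forallP dis /eqP cov /forallP sz] /forallP hA].
  have exk (j : 'I_n) : exists i, j \in A i.
    by have := in_setT j; rewrite -cov => /bigcupP[i _ h]; exists i.
  pose k j : 'I_(size nu) := xchoose (exk j).
  have kP i j : (k j == i) = (j \in A i).
    apply/eqP/idP => [<-|jA]; first exact: (xchooseP (exk j)).
    apply/eqP/negPn/negP => ne; have /forallP/(_ i)/implyP/(_ ne) := dis (k j).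
    by rewrite -setI_eq0 => /eqP/setP/(_ j); rewrite !inE jA (xchooseP (exk j)).
  exists (fun j => nat_of_ord (k j)).
    move=> c; case: (ltnP c (size nu)) => hc.
      rewrite -(eqP (sz (Ordinal hc))); apply: eq_card => j; rewrite inE -kP //.
    by rewrite nth_default //; apply: eq_card0 => j; rewrite inE; apply/eqP => e; move: hc;
      rewrite -e leqNgt ltn_ord.
  move=> j hj; have /restr_descent_comp/(_ j) := hA (k j).
  by rewrite -kP eqxx => /(_ isT hj)[j']; rewrite -kP => /eqP e h; exists j'; rewrite ?e.
move=> [k hk hm].
have kl j : k j < size nu.
  rewrite ltnNge; apply/negP => h; have /eqP := hk (k j); rewrite nth_default // cards_eq0.
  by move=> /eqP/setP/(_ j); rewrite !inE eqxx.
pose A : {ffun 'I_(size nu) -> {set 'I_n}} := [ffun i : 'I_(size nu) => [set j | k j == i]].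
apply/existsP; exists A; apply/andP; split; last first.
  apply/forallP => i; apply/restr_descent_comp => j; rewrite ffunE inE => /eqP e /hm[j' e' h].
  by exists j' => //; rewrite inE e' e.
apply/and3P; split.
- apply/forallP => i; apply/forallP => j; apply/implyP => ne.
  rewrite -setI_eq0; apply/eqP/setP => x; rewrite !ffunE !inE.
  by apply/negP => /andP[/eqP -> /eqP /val_inj e]; rewrite e eqxx in ne.
- apply/eqP/setP => j; rewrite inE; apply/bigcupP; exists (Ordinal (kl j)) => //.
  by rewrite ffunE inE.
by apply/forallP => i; rewrite ffunE hk.
Qed.

Lemma JmajP n nu (s : 'S_n) : sumn nu = n ->
  s \in Jmaj n nu <-> mates nu (fun j => tnth (majt s) j).
Proof. by move=> hn; rewrite inE; apply: descent_compsP. Qed.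

Lemma mates_majt n nu (a : 'I_n -> nat) : mates nu a -> exists s : 'S_n, forall i,
  tnth (majt s) i = a i.
Proof. by move=> [k _ h]; apply: majt_ex => i /h[j _ hj]; exists j. Qed.

Lemma card_Jmaj n nu K : sumn nu = n -> #|@mate_seqs K n nu| <= #|Jmaj n nu|.
Proof.
move=> hn; pose F (s : 'S_n) := [ffun i : 'I_n => inord (tnth (majt s) i) : 'I_K.+1].
apply: leq_trans (leq_imset_card F _); apply/subset_leq_card/subsetP => a;
  rewrite inE => /asboolP ha.
have [s hs] := mates_majt ha; apply/imsetP; exists s.
  by apply/JmajP => //; move: ha; congr mates; apply: funext => i; rewrite hs.
by apply/ffunP => i; rewrite ffunE hs inord_val.
Qed.

(** * The descent order *)

(** At the first difference the larger power outweighs everything that follows in [s], because [s]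
    has fewer than [K] terms and they decrease. *)
Lemma sum_pow_lt K (s t : seq nat) : size s = size t -> size s < K ->
  sorted geq s -> sorted geq t -> ((s : seqlexi nat) < (t : seqlexi nat))%O ->
  \sum_(x <- s) K ^ x < \sum_(x <- t) K ^ x.
Proof.
move=> + hs; elim: s t hs => [|x s IH] [|y t] //= hs [e] ss st.
rewrite ltxi_cons !big_cons => /andP[]; rewrite !leEnat leq_eqVlt => /orP[/eqP exy|xy _].
  by subst y; rewrite leqnn /= ltn_add2l; apply: IH => //;
    [lia|apply: path_sorted ss|apply: path_sorted st].
apply: leq_trans (leq_addr _ _).
have hb : \sum_(z <- s) K ^ z <= size s * K ^ x.
  have : all (fun z => z <= x) s.
    move: ss; rewrite path_sortedE; last by move=> ? ? ? h1 h2; apply: leq_trans h2 h1.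
    by case/andP.
  elim: (s) => [|z u IHu] /=; first by rewrite big_nil.
  move=> /andP[zx hu]; rewrite big_cons mulSn leq_add ?IHu // leq_pexp2l //; lia.
apply: (@leq_trans (K ^ x.+1)); last by rewrite leq_pexp2l //; lia.
rewrite expnS; have : (size s).+2 * K ^ x <= K * K ^ x by rewrite leq_mul2r hs orbT.
have : 0 < K ^ x by rewrite expn_gt0; lia.
rewrite !mulSn; lia.
Qed.

Lemma lexi_first (s t : seq nat) j : size s = size t -> j < size s ->
  (forall i, i < j -> nth 0 t i = nth 0 s i) -> nth 0 s j < nth 0 t j ->
  ((s : seqlexi nat) < (t : seqlexi nat))%O.
Proof.
elim: s t j => [|x s IH] [|y t] [|j] //= [e] hj hi h; rewrite ltxi_cons !leEnat.
  by rewrite (ltnW h) leqNgt h.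
have exy := hi 0 isT; rewrite /= in exy; rewrite exy leqnn /=.
by apply: (IH _ j) => // i ij; apply: (hi i.+1).
Qed.

Section DesOrder.
Variable n : nat.
Implicit Types m a b c : 'X_{1..n}.

Definition decr_sort m : seqlexi nat := sort geq m.

Lemma des_leE a b : des_le a b =
  (decr_sort a < decr_sort b)%O || (decr_sort a == decr_sort b) && ((a : seqlexi nat) <= (b :
    seqlexi nat))%O.
Proof. by []. Qed.

Lemma des_refl a : des_le a a.
Proof. by rewrite des_leE eqxx lexx orbT. Qed.

Lemma des_trans b a c : des_le a b -> des_le b c -> des_le a c.
Proof.
rewrite !des_leE => /orP[h|/andP[/eqP -> h]] /orP[h'|/andP[/eqP e h']].
- by rewrite (lt_trans h h').
- by rewrite -e h.
- by rewrite h'.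
- by rewrite e eqxx (le_trans h h') orbT.
Qed.

Lemma des_total a b : des_le a b || des_le b a.
Proof.
rewrite !des_leE; case: (ltgtP (decr_sort a) (decr_sort b)) => //= _; exact: le_total.
Qed.

Lemma power_sum_decr_sort m : power_sum m = \sum_(x <- decr_sort m) n.+1 ^ x.
Proof.
rewrite /decr_sort (perm_big _ (permEl (perm_sort _ _))) /= /power_sum big_tuple.
by apply: eq_bigr => i _; rewrite mnm_tnth.
Qed.

Lemma decr_sort_sorted m : sorted geq (decr_sort m).
Proof. by apply: sort_sorted => x y; apply: leq_total. Qed.

Lemma size_decr_sort m : size (decr_sort m) = n.
Proof. by rewrite size_sort size_tuple. Qed.

Lemma des_power_sum a b : des_le a b -> power_sum a <= power_sum b.
Proof.
rewrite des_leE !power_sum_decr_sort => /orP[h|/andP[/eqP -> _] //].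
by apply/ltnW/sum_pow_lt; rewrite ?decr_sort_sorted ?size_decr_sort.
Qed.

Lemma decr_sort_perm_mon (a : 'X_{1..n}) (s : 'S_n) : decr_sort (perm_mon a s) = decr_sort a.
Proof.
rewrite /decr_sort; apply/perm_sortP => //; first by move=> x y; apply: leq_total.
- by move=> y x z h1 h2; apply: leq_trans h2 h1.
- by move=> x y /andP[h1 h2]; apply/eqP; rewrite eqn_leq; apply/andP.
by apply/tuple_permP; exists s.
Qed.

Lemma des_lex_first a b (j : 'I_n) : decr_sort a = decr_sort b -> (forall i : 'I_n,
  i < j -> a i = b i) ->
  b j < a j -> ~~ des_le a b.
Proof.
move=> e hi hj; rewrite des_leE e ltxx eqxx /= -ltNge.
apply: (@lexi_first _ _ j); rewrite ?size_tuple //; last by rewrite -!(mnm_nth 0).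
by move=> i ij; have := hi (Ordinal (ltn_trans ij (ltn_ord j))) ij; rewrite !(mnm_nth 0).
Qed.

Lemma des_max (X : eqType) (r : seq X) (F : X -> 'X_{1..n}) : r != [::] ->
  exists2 x, x \in r & forall y, y \in r -> des_le (F y) (F x).
Proof.
elim: r => // x [|y r] IH _; first by exists x; rewrite ?inE // => z; rewrite inE => /eqP ->;
  apply: des_refl.
have [z zr hz] := IH isT; have [h|h] := orP (des_total (F x) (F z)).
  exists z; first by rewrite in_cons zr orbT.
  by move=> u; rewrite in_cons => /orP[/eqP ->|/hz].
exists x; rewrite ?mem_head // => u; rewrite in_cons => /orP[/eqP ->|/hz hu];
  first exact: des_refl.
exact: des_trans hu h.
Qed.

End DesOrder.

(** * Young subgroups *)

Section Blocks.
Variables (n : nat) (mu : seq nat).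
Hypothesis hmu : is_weak_comp n mu.

(** Counting the blocks that end at or before [j] gives the right index also in the presence of
    empty blocks. *)
Definition block_idx (j : nat) : nat := \sum_(i < size mu) (sumn (take i.+1 mu) <= j).

Lemma block_idx_mono i j : i <= j -> block_idx i <= block_idx j.
Proof. by move=> ij; apply: leq_sum => b _; case: (leqP _ i) => // h;
  rewrite (leq_trans h ij). Qed.

Lemma sumn_take_mono i j : i <= j -> sumn (take i mu) <= sumn (take j mu).
Proof.
move=> ij; rewrite -[X in _ <= sumn X](cat_take_drop i) sumn_cat take_takel //; exact: leq_addr.
Qed.

Lemma block_idx_eq (j : 'I_n) (i : 'I_(size mu)) : j \in block n mu i -> block_idx j = i.
Proof.
rewrite inE => /andP[h1 h2]; rewrite /block_idx -[RHS](card_ord i) -sum1_card.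
rewrite (big_ord_widen (size mu) (fun=> 1)) ?(ltnW (ltn_ord i)) // [RHS]big_mkcond /=.
apply: eq_bigr => b _; case: (ltnP b i) => hb.
  by rewrite (leq_trans (sumn_take_mono hb) h1).
by rewrite leqNgt (leq_trans h2) //; apply: sumn_take_mono.
Qed.

Lemma block_ex (j : 'I_n) : exists i : 'I_(size mu), j \in block n mu i.
Proof.
have hj : j < sumn mu by rewrite (eqP hmu).
have ex : exists k, j < sumn (take k mu) by exists (size mu); rewrite take_size.
have [[|k] hk kmin] := ex_minnP ex; first by rewrite take0 in hk.
have ksz : k < size mu.
  rewrite ltnNge; apply/negP => h; have := kmin k; rewrite take_oversize // => /(_ hj); lia.
by exists (Ordinal ksz); rewrite inE hk andbT leqNgt; apply/negP => /kmin; rewrite ltnn.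
Qed.

Lemma block_idxP (j : 'I_n) (i : 'I_(size mu)) : (j \in block n mu i) = (block_idx j == i).
Proof.
apply/idP/eqP => [/block_idx_eq //|e].
have [k jk] := block_ex j.
by rewrite (_ : i = k) //; apply: val_inj; rewrite /= -e (block_idx_eq jk).
Qed.

Lemma youngP (w : 'S_n) : reflect (forall j : 'I_n,
  block_idx (w j) = block_idx j) (w \in young n mu).
Proof.
rewrite inE; apply: (iffP forallP) => [h j|h i].
  have [b jb] := block_ex j; have /eqP e := h b.
  have : w j \in w @: block n mu b by rewrite imset_f.
  by rewrite e block_idxP (block_idx_eq jb) => /eqP.
rewrite eqEcard (card_imset _ (@perm_inj _ w)) leqnn andbT.
by apply/subsetP => _ /imsetP[j + ->]; rewrite !block_idxP h.
Qed.

Definition increasing (m : 'I_n -> nat) :=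
  forall i j : 'I_n, block_idx i = block_idx j -> i < j -> m i < m j.

(** By [prec_majt], the larger of two values comes first exactly when its table entry is strictly
    larger: at equal entries both lie in one run. *)
Lemma rev_shufflesP (s : 'S_n) :
  s \in rev_shuffles n mu <-> increasing (fun j => tnth (majt s) j).
Proof.
rewrite inE; split=> [/forallP h i j bij ij|h].
  have [b ib] := block_ex i; have jb : j \in block n mu b by rewrite block_idxP -bij
    -block_idxP.
  move/forallP/(_ ((s^-1)%g i))/forallP/(_ ((s^-1)%g j)) : (h b); rewrite !permKV ib jb !andbT.
  have := prec_majt s ((s^-1)%g j) ((s^-1)%g i); rewrite !permKV /prec.
  have ne : (s^-1)%g i != (s^-1)%g j.
    by rewrite (inj_eq (@perm_inj _ _)) -val_eqE /=; lia.
  move: ne; rewrite -val_eqE /= neq_ltn => /orP[-> _ /=|-> + _]; first lia.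
  by case/orP => [//|/andP[_]]; lia.
apply/forallP => b; apply/forallP => p; apply/forallP => q; apply/implyP => /and3P[pq pb qb].
have := prec_majt s p q; rewrite pq /prec.
have ne : s q != s p by rewrite (inj_eq (@perm_inj _ _)) -val_eqE /=; lia.
have e : block_idx (s p) = block_idx (s q) by rewrite (block_idx_eq pb) (block_idx_eq qb).
move: ne; rewrite -val_eqE /= neq_ltn => /orP[//|lt].
by have := h _ _ e lt; lia.
Qed.

(** Such an [r] preserves the order within blocks and between blocks, hence is increasing. *)
Lemma increasing_perm (m m' : 'I_n -> nat) (r : 'S_n) : increasing m -> increasing m' ->
  (forall j, block_idx (r j) = block_idx j) -> (forall j, m j = m' (r j)) -> r = 1%g.
Proof.
move=> hm hm' hr e.
have mono (i j : 'I_n) : i < j -> r i < r j.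
  move=> ij; have := block_idx_mono (ltnW ij); rewrite leq_eqVlt => /orP[/eqP b|b].
    have := hm i j b ij; rewrite !e => lt; case: (ltngtP (r i) (r j)) => // h.
      by have := hm' (r j) (r i) _ h; rewrite !hr b => /(_ erefl); lia.
    by move: lt; rewrite (val_inj h) ltnn.
  rewrite ltnNge; apply/negP => /block_idx_mono; rewrite !hr; lia.
apply/permP => i; rewrite perm1; apply/eqP/negPn/negP => ne.
pose P (k : nat) := [exists j : 'I_n, (j == k :> nat) && (r j != j)].
have exP : exists k, P k by exists i; apply/existsP; exists i; rewrite eqxx.
have [k /existsP[j /andP[/eqP ek nj]] kmin] := ex_minnP exP.
have fix_lt (x : 'I_n) : x < j -> r x = x.
  move=> xj; apply/eqP/negPn/negP => nx; have := kmin x; rewrite -ek leqNgt xj => h.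
  have Px : P x by apply/existsP; exists x; rewrite eqxx.
  by have := h Px.
have gt (x : 'I_n) : x != j -> (forall y : 'I_n, y < j -> y != x) -> j < x.
  by move=> xj h; rewrite ltnNge leq_eqVlt; apply/negP => /orP[h'|/h]; rewrite ?eqxx //;
    case/eqP: xj; apply/val_inj/eqP.
have g1 : j < r j.
  by apply: gt => // y yj; rewrite -(fix_lt y yj) (inj_eq (@perm_inj _ r)) -val_eqE /=; lia.
have g2 : j < (r^-1)%g j.
  apply: gt; first by apply: contraNneq nj => h; rewrite -{1}h permKV.
  move=> y yj; apply/eqP => h; have := fix_lt y yj; rewrite {1}h permKV => h2.
  by rewrite -h2 ltnn in yj.
by have := mono _ _ g2; rewrite permKV; lia.
Qed.

End Blocks.

(** * Leading monomials and bases *)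

Definition gs_mon n (s : 'S_n) : 'X_{1..n} := [multinom tnth (majt s) i | i < n].

Lemma gs_monE n (s : 'S_n) i : gs_mon s i = tnth (majt s) i.
Proof. by rewrite mnmE. Qed.

Lemma gs_mon_inj n : injective (@gs_mon n).
Proof.
move=> s t e; apply: majt_inj; apply: eq_from_tnth => i.
by rewrite -!gs_monE e.
Qed.

Lemma perm_first n (r : 'S_n) : r != 1%g -> exists2 j : 'I_n, j < r j & forall i : 'I_n,
  i < j -> r i = i.
Proof.
move=> r1; have exj : exists k, [exists j : 'I_n, (j == k :> nat) && (r j != j)].
  have /existsP[j nj] : [exists j, r j != j].
    apply: contraNT r1; rewrite negb_exists => /forallP h; apply/eqP/permP => j.
    by rewrite perm1; apply/eqP; have := h j; rewrite negbK.
  by exists j; apply/existsP; exists j; rewrite eqxx.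
have [k /existsP[j /andP[/eqP ek nj]] kmin] := ex_minnP exj.
have fix_lt (i : 'I_n) : i < j -> r i = i.
  move=> ij; apply/eqP; apply: contraTT ij => ni; rewrite -leqNgt ek; apply: kmin.
  by apply/existsP; exists i; rewrite eqxx.
exists j => //; rewrite ltn_neqAle eq_sym val_eqE nj /= leqNgt; apply/negP => h.
by have := fix_lt _ h => /perm_inj e; rewrite e eqxx in nj.
Qed.

Lemma perm_mon1 n (m : 'X_{1..n}) : perm_mon m 1%g = m.
Proof. by apply/mnmP => i; rewrite mnmE perm1. Qed.

Section Leading.
Variables (n : nat) (la : seq nat).
Hypothesis hla : is_partition n la.
Local Notation nu := (conj_part la).
Local Notation J := (Jmaj n nu).

Lemma sumn_nu : sumn nu = n.
Proof. by case/and3P: hla => sla _ /eqP <-; apply: sumn_conj_part. Qed.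

Lemma gs_mon_mates s : s \in J -> mates nu (gs_mon s).
Proof.
move=> /(JmajP _ sumn_nu); congr mates; apply: funext => i; by rewrite gs_monE.
Qed.

(** In the functional of a = [gs_mon s], a permutation r other than 1 moves some first index j to a
    later one of the same group, where [a] is larger. Thus a o r lies above a and is absent from
    [f], and the coefficient of a alone must vanish. *)
Lemma lead_notin_J s f : s \in J -> f \in tanisaki_ideal n la -> ~ is_des_leading (gs_mon s) f.
Proof.
move=> sJ fI [ms hm]; have [grp hg hL] := tanisaki_functional hla (gs_mon_mates sJ).
have := hL f fI (fun m mf => des_power_sum (hm m mf)).
rewrite (bigD1 1%g) /=; last by apply/forallP => j; rewrite perm1.
rewrite odd_perm1 expr0 mul1r perm_mon1 big1 ?addr0 => [/eqP|r /andP[/forallP hr r1]].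
  by apply/negP; rewrite -mcoeff_msupp.
apply/eqP; rewrite mulf_eq0 signr_eq0 /= -[_ == _]negbK -mcoeff_msupp; apply/negP => /hm.
apply/negP; have [j jr fj] := perm_first r1.
apply: (@des_lex_first _ _ _ j); first exact: decr_sort_perm_mon.
  by move=> i ij; rewrite mnmE fj.
by rewrite [perm_mon _ _ _]mnmE; apply: hg => //; rewrite (eqP (hr j)).
Qed.

Variable mu : seq nat.
Hypothesis hmu : is_weak_comp n mu.
Local Notation block_idx := (block_idx mu).

Lemma perm_actX (w : 'S_n) (m : 'X_{1..n}) : perm_act w 'X_[m] = ('X_[perm_mon m w^-1])%R.
Proof.
rewrite /perm_act comp_mpolyX (mpolyXE _ w); apply: eq_bigr => i _.
by rewrite tnth_mktuple mnmE permK.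
Qed.

Lemma increasing_gs s : s \in rev_shuffles n mu <-> increasing mu (gs_mon s).
Proof.
rewrite (rev_shufflesP hmu); split=> h i j bij ij.
  by rewrite !gs_monE; apply: h.
by rewrite -!gs_monE; apply: h.
Qed.

Lemma mcoeff_antisym (c : 'S_n -> rat) (A : {set 'S_n}) m :
  ((\sum_(s in A) c s *: antisym mu (garsia_stanton s))@_m =
  \sum_(s in A) c s * \sum_(w in young n mu) (-1) ^+ w * (perm_mon (gs_mon s) w^-1 == m)%:R)%R.
Proof.
rewrite raddf_sum /=; apply: eq_bigr => s _; rewrite mcoeffZ; congr (_ * _)%R.
rewrite raddf_sum /=; apply: eq_bigr => w _.
by rewrite mcoeffZ garsia_stantonE perm_actX mcoeffX.
Qed.

(* b is a o t sorted inside the blocks, and is lexicographically above a unless t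
   preserves the blocks. *)
Lemma sorted_above (grp : 'I_n -> nat * nat) (a b : 'X_{1..n}) (t w : 'S_n) :
  (forall i j, grp i = grp j -> i < j -> a i < a j) ->
  increasing mu a -> increasing mu b -> (forall j, grp (t j) = grp j) ->
  (forall j, block_idx (w j) = block_idx j) -> (forall j, b j = a (t (w j))) -> des_le b a ->
  forall j, block_idx (t j) = block_idx j.
Proof.
move=> ha ia ib gt hw hb dba.
have [|] := boolP [exists i, block_idx ((t^-1)%g i) != block_idx i]; last first.
  rewrite negb_exists => /forallP h j; have := h (t j); rewrite permK negbK => /eqP -> //.
case/existsP=> x0 nx0; exfalso.
have [i0 bi0 imin] := @arg_minnP _ x0 (fun i => block_idx ((t^-1)%g i) != block_idx i) val nx0.
pose s i := t (w i).
have si : injective s by move=> i j /perm_inj/perm_inj.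
have above (i : 'I_n) : i <= i0 -> i < s i -> a i < a (s i).
  move=> ii0 lt; have [e|ne] := eqVneq (block_idx (s i)) (block_idx i);
    first exact: ia (esym e) lt.
  pose y := w i; have by_ : block_idx y = block_idx i by apply: hw.
  pose B := [set j : 'I_n | (block_idx j == block_idx i) && (grp j == grp y)].
  have [y' y'B y't] : exists2 y', y' \in B & y' \notin t @: B.
    have : ~~ (B \subset t @: B).
      apply/negP => h; have /eqP e : B == t @: B.
        by rewrite eqEcard h (card_imset _ (@perm_inj _ t)) leqnn.
      have : t y \in B by rewrite e imset_f // inE by_ !eqxx.
      by rewrite inE -/(s i) (negPf ne).
    by case/subsetPn=> y' h1 h2; exists y'.
  move: (y'B); rewrite inE => /andP[/eqP by' /eqP gy'].
  have ny' : block_idx ((t^-1)%g y') != block_idx y'.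
    apply: contra y't => /eqP e; apply/imsetP; exists ((t^-1)%g y'); last by rewrite permKV.
    by rewrite inE e by' eqxx -gt permKV gy' eqxx.
  have iy' : i <= y' by apply: leq_trans ii0 (imin _ ny').
  have lt2 : y' < s i.
    rewrite ltnNge; apply/negP => h; have := block_idx_mono mu h;
      have := block_idx_mono mu (ltnW lt).
    by move: ne; rewrite by'; lia.
  have h1 : a y' < a (s i) by apply: ha lt2; rewrite gy' /s gt.
  apply: leq_ltn_trans h1; move: iy'; rewrite leq_eqVlt => /orP[/eqP/val_inj -> //|h].
  by apply/ltnW/ia.
have ge (i : 'I_n) : (forall y : 'I_n, y < i -> s y = y) -> i <= s i.
  move=> h; rewrite leqNgt; apply/negP => lt; have := h _ lt => /si e.
  by rewrite e ltnn in lt.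
(* Otherwise the preimage x of [i] under [s] lies in the block of [i] and to its right, with
   [b x = a i] smaller than [b i], although [b] increases on blocks. *)
have fixed_step (i : 'I_n) : i < i0 -> (forall y : 'I_n, y < i -> s y = y) -> s i = i.
  move=> ii0 h; apply/eqP/negPn/negP => ne.
  have lt : i < s i by rewrite ltn_neqAle ge // andbT eq_sym.
  pose x := (w^-1)%g ((t^-1)%g i); have sx : s x = i by rewrite /s /x !permKV.
  have bx : block_idx x = block_idx i.
    rewrite -[LHS]hw /x permKV; apply/eqP/negPn/negP => /imin; rewrite leqNgt ii0 //.
  have ix : i < x.
    rewrite ltnNge leq_eqVlt; apply/negP => /orP[/eqP/val_inj e|/h].
      by rewrite -{1}e sx eqxx in ne.
    by rewrite sx => e; rewrite {1}e sx eqxx in ne.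
  have h1 := ib _ _ (esym bx) ix; have h2 := above i (ltnW ii0) lt.
  by move: h1; rewrite !hb -/(s x) -/(s i) sx; lia.
have fixed (i : 'I_n) : i < i0 -> s i = i.
  move: {2}(val i) (leqnn i) => d; elim: d i => [|d IH] i hd ii0.
    by apply: fixed_step => // y; lia.
  by apply: fixed_step => // y yi; apply: IH; lia.
have := dba; apply/negP; apply: (@des_lex_first _ _ _ i0).
- have -> : b = perm_mon a (w * t)%g by apply/mnmP => j; rewrite mnmE permM hb.
  exact: decr_sort_perm_mon.
- by move=> i ii0; rewrite hb -/(s i) fixed.
rewrite hb; apply: above => //; rewrite ltn_neqAle ge // andbT.
apply: contraNneq bi0 => /val_inj e.
by rewrite {1}e /s permK hw.
Qed.

(** The functional belongs to the largest monomial with a nonzero coefficient. Each group-preserving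
    [t] contributes that coefficient if it preserves the blocks, the two signs cancelling, and 0
    otherwise by [sorted_above]; so the total is a positive multiple of it. *)
Lemma antisym_independent (c : 'S_n -> rat) :
  (\sum_(s in J :&: rev_shuffles n mu) c s *: antisym mu (garsia_stanton s))%R
     \in tanisaki_ideal n la ->
  forall s, s \in J :&: rev_shuffles n mu -> c s = 0%R.
Proof.
set A := J :&: _; set f := (\sum_(s in A) _)%R => fI s1 s1A; apply/eqP/negPn/negP => cs1.
pose r := [seq s <- enum A | c s != 0%R].
have rP s : (s \in r) = (s \in A) && (c s != 0%R) by rewrite mem_filter mem_enum andbC.
have rn : r != [::] by apply/eqP => e; have := rP s1; rewrite e s1A cs1.
have [s0 s0r smax] := des_max (@gs_mon n) rn; set a := gs_mon s0 in smax.
move: (s0r); rewrite rP inE => /andP[/andP[s0J s0S] cs0].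
have ia : increasing mu a by apply/increasing_gs.
have mcf m : (f@_m = \sum_(s in A) c s * \sum_(w in young n mu) (-1) ^+ w * (perm_mon (gs_mon s)
  w^-1 == m)%:R)%R.
  exact: mcoeff_antisym.
have supp m : m \in msupp f -> exists s w, [/\ s \in r,
  w \in young n mu & m = perm_mon (gs_mon s) w^-1].
  rewrite mcoeff_msupp mcf => nz.
  have [s sA hs] : exists2 s, s \in A & (c s * \sum_(w in young n mu) (-1) ^+ w * (perm_mon
    (gs_mon s) w^-1 == m)%:R != 0)%R.
    apply/exists_inP; apply: contraNT nz => /exists_inPn h; rewrite big1 // => s /h.
    by rewrite negbK => /eqP.
  move: hs; rewrite mulf_eq0 negb_or => /andP[cs hs].
  have [w wy hw] : exists2 w, w \in young n mu & ((-1) ^+ w * (perm_mon (gs_mon s) w^-1 == m)%:R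
    != 0 :> rat)%R.
    apply/exists_inP; apply: contraNT hs => /exists_inPn h; rewrite big1 // => w /h.
    by rewrite negbK => /eqP.
  exists s, w; split=> //; first by rewrite rP sA.
  by move: hw; case: (perm_mon (gs_mon s) w^-1 =P m) => [->|]; rewrite // mulr0 eqxx.
have [grp hg hL] := tanisaki_functional hla (gs_mon_mates s0J).
have hp m : m \in msupp f -> power_sum m <= power_sum a.
  move=> /supp[s [w [sr _ ->]]]; rewrite power_sum_decr_sort decr_sort_perm_mon
    -power_sum_decr_sort.
  exact/des_power_sum/smax.
have contrib (t : 'S_n) : (forall j, grp (t j) = grp j) ->
    ((-1) ^+ t * f@_(perm_mon a t) = (t \in young n mu)%:R * c s0)%R.
  move=> gt; case: (boolP (t \in young n mu)) => ty; last first.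
    rewrite mul0r; apply/eqP; rewrite mulf_eq0 signr_eq0 /= -[_ == _]negbK -mcoeff_msupp.
    apply/negP => /supp[s [w [sr /(youngP hmu) hw e]]]; case/negP: ty; apply/(youngP hmu).
    apply: (@sorted_above grp a (gs_mon s) t w) => //.
    - by apply/increasing_gs; move: sr; rewrite rP inE => /andP[/andP[]].
    - by move=> j; have /mnmP/(_ (w j)) := e; rewrite !mnmE permK => ->.
    - exact: smax.
  have key s w : s \in r -> w \in young n mu ->
     (perm_mon (gs_mon s) w^-1 == perm_mon a t) = (s == s0) && (w == t^-1)%g.
    move=> sr /(youngP hmu) hw; apply/eqP/andP => [e|[/eqP -> /eqP ->]]; last by rewrite invgK.
    have e2 j : gs_mon s j = a ((w * t)%g j).
      by have /mnmP/(_ (w j)) := e; rewrite !mnmE permK permM.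
    have wt1 : (w * t = 1)%g.
      apply: (@increasing_perm n mu hmu (gs_mon s) a (w * t)%g _ ia _ e2) => [|j].
        by apply/increasing_gs; move: sr; rewrite rP inE => /andP[/andP[]].
      by rewrite permM (youngP hmu _ ty) hw.
    split; last by rewrite -(mulgK t w) wt1 mul1g.
    apply/eqP/gs_mon_inj/mnmP => j; by rewrite e2 wt1 perm1.
  have tVy : (t^-1)%g \in young n mu.
    by apply/(youngP hmu) => j; rewrite -{2}[j](permKV t) (youngP hmu _ ty).
  rewrite mcf (bigD1 s0) /=; last by rewrite inE s0J s0S.
  rewrite [X in (_ + X)%R]big1 ?addr0 => [|s /andP[sA ne]]; last first.
    have [->|cs] := eqVneq (c s) 0%R; first by rewrite mul0r.
    rewrite big1 ?mulr0 // => w wy; rewrite key ?rP ?sA // (negPf ne) mulr0 //.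
  rewrite (bigD1 (t^-1)%g) //= big1 ?addr0 => [|w /andP[wy ne]]; last first.
    by rewrite key // (negPf ne) andbF mulr0.
  by rewrite key // !eqxx mulr1 odd_permV [(c s0 * _)%R]mulrC signrMK mul1r.
have := hL f fI hp; rewrite (eq_bigr (fun t => (t \in young n mu)%:R * c s0)%R); last first.
  by move=> t /forallP h; apply: contrib => j; apply/eqP.
rewrite -mulr_suml => /eqP; rewrite mulf_eq0 (negPf cs0) orbF.
rewrite -natr_sum pnatr_eq0 (bigD1 1%g) /=; last by apply/forallP => j; rewrite perm1.
rewrite (_ : _ \in _ = true) //; by apply/(youngP hmu) => j; rewrite perm1.
Qed.

End Leading.

Local Open Scope ring_scope.

Lemma independent_spans (V : lmodType rat) (k r : nat) (B : 'I_k -> V) (v : 'I_r -> V) :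
  (forall w, exists c : 'I_k -> rat, w = \sum_i c i *: B i) ->
  (forall c : 'I_r -> rat, \sum_i c i *: v i = 0 -> forall i, c i = 0) -> (k <= r)%N ->
  forall w, exists c : 'I_r -> rat, w = \sum_i c i *: v i.
Proof.
move=> hB hv kr; have [C hC] := choice (fun i => hB (v i)).
pose M := \matrix_(i < r, j < k) C i j.
have free : row_free M.
  apply/row_freeP; apply/row_freeP; rewrite -kermx_eq0; apply/eqP/row_matrixP => i.
  rewrite row0; set u := row i _.
  have uM : u *m M = 0 by rewrite -row_mul mulmx_ker row0.
  apply/rowP => j; rewrite [RHS]mxE; apply: (hv (fun j => u 0 j)).
  under eq_bigr => l _ do rewrite hC scaler_sumr.
  rewrite exchange_big big1 // => l _ /=.
  under eq_bigr do rewrite scalerA.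
  rewrite -scaler_suml; have /rowP/(_ l) := uM; rewrite !mxE => e.
  by rewrite (eq_bigr (fun x => u 0 x * M x l)) ?e ?scale0r // => x _; rewrite [M _ _]mxE.
have full : row_full M.
  by rewrite /row_full eqn_leq rank_leq_col /=; move: free; rewrite /row_free => /eqP ->.
move=> w; have [c hc] := hB w; pose P := pinvmx M.
exists (fun s => \sum_i c i * P i s).
under [RHS]eq_bigr => s _ do rewrite scaler_suml.
rewrite exchange_big hc; apply: eq_bigr => i _ /=.
under eq_bigr do rewrite -scalerA.
rewrite -scaler_sumr; congr (_ *: _).
under eq_bigr => s _ do rewrite hC scaler_sumr.
rewrite exchange_big /=.
have key j : \sum_s P i s *: (C s j *: B j) = (i == j)%:R *: B j.
  under eq_bigr do rewrite scalerA.
  rewrite -scaler_suml; congr (_ *: _); have : (P *m M) i j = (i == j)%:R.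
    by rewrite mulVpmx // mxE.
  by rewrite mxE => <-; apply: eq_bigr => s _; rewrite [M _ _]mxE.
under eq_bigr do rewrite key.
rewrite (bigD1 i) //= eqxx scale1r big1 ?addr0 // => j ji.
by rewrite eq_sym (negPf ji) scale0r.
Qed.

(** * The basis of R_la and the leading monomials *)

Section Assembly.
Variables (n : nat) (la : seq nat).
Hypothesis hla : is_partition n la.
Local Notation nu := (conj_part la).
Local Notation J := (Jmaj n nu).
Local Notation cl := (@gp_class n la).

Lemma cl0 f : cl f = 0 <-> f \in tanisaki_ideal n la.
Proof. by rewrite -(raddf0 (@gp_class n la)) gp_classP subr0. Qed.

Lemma gs_independent (c : 'S_n -> rat) :
  \sum_(s in J) c s *: garsia_stanton s \in tanisaki_ideal n la ->
  forall s, s \in J -> c s = 0.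
Proof.
set f := \sum_(s in J) _ => fI s sJ; apply/eqP; apply: contraT => cs.
have mc t : t \in J -> f@_(gs_mon t) = c t.
  move=> tJ; rewrite raddf_sum (bigD1 t) //= big1 ?addr0 => [|u /andP[_ ut]].
    by rewrite mcoeffZ garsia_stantonE mcoeffX eqxx mulr1.
  rewrite mcoeffZ garsia_stantonE mcoeffX (_ : (_ == _) = false) ?mulr0 //.
  by apply/negP => /eqP/gs_mon_inj e; rewrite e eqxx in ut.
have f0 : msupp f != [::].
  by apply: contraNneq cs => e; rewrite -mc // -[_ == _]negbK -mcoeff_msupp e.
have [m mf mmax] := des_max id f0.
have [t tJ em] : exists2 t, t \in J & m = gs_mon t.
  have [[t /andP[tJ /eqP em]]|h] := pselect (exists t, (t \in J) && (m == gs_mon t));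
    first by exists t.
  move: mf; rewrite mcoeff_msupp raddf_sum big1 ?eqxx // => t tJ /=.
  rewrite mcoeffZ garsia_stantonE mcoeffX (_ : (_ == _) = false) ?mulr0 //.
  by apply/negP => /eqP e; case: h; exists t; rewrite tJ -e eqxx.
by case: (lead_notin_J hla tJ fI); rewrite -em.
Qed.

Lemma gp_bound : exists2 B : seq {mpoly rat[n]}, (size B <= #|J|)%N &
  forall w : garsia_procesi n la, exists c : 'I_(size B) -> rat, w = \sum_i c i *: cl B`_i.
Proof.
have [sla nz /eqP hn] := and3P hla.
have hyp : spanning_hyp (fun f => f \in tanisaki_ideal n la) 1 setT la.
  split.
  - split; first exact: rpred0.
      by move=> f g; apply: rpredD.
    by move=> h f /asboolP hf; apply/asboolP/ideal_genMl.
  - by rewrite cardsT card_ord.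
  - by move=> y; rewrite inE.
  move=> S d _ hd; rewrite mulr1; apply/asboolP; exists [:: (1, esym_in S d)].
  split; last by rewrite big_seq1 mul1r.
  move=> q; rewrite inE => /eqP ->; exists S, d; split=> //; move: hd.
  rewrite cardsT card_ord /tail_cols /tanisaki_p; congr (_ < _ + _)%N.
  by apply: eq_bigr => i _; rewrite nth_conj_part.
have [B sB cB] := spanning_bound hyp; exists B.
  rewrite cardsT card_ord in cB.
  have L0 : (0 < \prod_(p <- la) p`!)%N by rewrite prodn_gt0 // => p; apply: fact_gt0.
  rewrite -(leq_pmul2r L0); apply: leq_trans cB (leq_trans (card_mate_seqs_ge hla) _).
  by rewrite leq_mul2r card_Jmaj ?orbT // sumn_conj_part.
move=> w; have := gp_reprK w; set g := (X in gp_class _ X) => <-.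
have [f [c ->]] := sB g; rewrite mulr1 => /gp_classP ->; exists c.
by rewrite linear_sum; apply: eq_bigr => i _; rewrite linearZ.
Qed.

Lemma gs_spans (w : garsia_procesi n la) :
  exists c : 'S_n -> rat, w = \sum_(s in J) c s *: cl (garsia_stanton s).
Proof.
have [B sB hB] := gp_bound.
have sumE (c : 'S_n -> rat) : \sum_(s in J) c s *: cl (garsia_stanton s) =
    \sum_(i < #|J|) c (enum_val i) *: cl (garsia_stanton (enum_val i)).
  by rewrite big_enum_val.
have [|c hc] := @independent_spans _ _ _ _ (fun i : 'I_#|J| =>
  cl (garsia_stanton (enum_val i))) hB _ sB w.
  move=> c h i; have sJ := enum_valP i.
  pose c' s := c (enum_rank_in sJ s).
  have := @gs_independent c' _ _ sJ; rewrite /c' enum_valK_in; apply.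
  apply/cl0; rewrite linear_sum /=; under eq_bigr do rewrite linearZ /=.
  rewrite sumE -[RHS]h; apply: eq_bigr => j _; by rewrite /c' enum_valK_in.
have [i0|e0] := pickP (@predT 'I_#|J|).
  move=> _; have sJ := enum_valP i0; exists (fun s => c (enum_rank_in sJ s)).
  by rewrite sumE hc; apply: eq_bigr => j _; rewrite enum_valK_in.
by exists (fun=> 0); rewrite sumE hc !big_pred0.
Qed.

Lemma gp_class_sum (c : 'S_n -> rat) (A : {set 'S_n}) (F : 'S_n -> {mpoly rat[n]}) :
  cl (\sum_(s in A) c s *: F s) = \sum_(s in A) c s *: cl (F s).
Proof. by rewrite linear_sum; apply: eq_bigr => s _; rewrite linearZ. Qed.

(** If [m] is not itself a basis monomial, the relation expressing it lies in the ideal, so its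
    leading monomial is not in the basis by [lead_notin_J] and can only be [m]. *)
Lemma normal_form (m : 'X_{1..n}) : exists2 c : 'S_n -> rat,
  'X_[m] - \sum_(s in J) c s *: garsia_stanton s \in tanisaki_ideal n la &
  forall s, s \in J -> c s != 0 -> des_le (gs_mon s) m.
Proof.
have [[t /andP[tJ /eqP ->]]|nJ] := pselect (exists t, (t \in J) && (m == gs_mon t)).
  exists (fun s => (s == t)%:R); last first.
    by move=> s _; have [->|_] := eqVneq s t => [_|]; [apply: des_refl|rewrite eqxx].
  rewrite (bigD1 t) //= big1 ?addr0 => [|u /andP[_ /negPf ->]]; last by rewrite scale0r.
  by rewrite eqxx scale1r garsia_stantonE subrr rpred0.
have [c hc] := gs_spans (cl 'X_[m]); exists c => [|s sJ cs].
  by apply/gp_classP; rewrite gp_class_sum.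
set f := 'X_[m] - \sum_(s in J) c s *: garsia_stanton s.
have fI : f \in tanisaki_ideal n la by apply/gp_classP; rewrite gp_class_sum.
have mm t : t \in J -> (gs_mon t == m) = false.
  by move=> tJ; apply/negP => /eqP e; case: nJ; exists t; rewrite tJ e eqxx.
have fm : f@_m = 1.
  rewrite mcoeffB mcoeffX eqxx raddf_sum big1 ?subr0 // => t tJ /=.
  by rewrite mcoeffZ garsia_stantonE mcoeffX mm ?mulr0.
have fs t : t \in J -> f@_(gs_mon t) = - c t.
  move=> tJ; rewrite mcoeffB mcoeffX eq_sym mm // sub0r raddf_sum (bigD1 t) //= big1 ?addr0.
    by rewrite mcoeffZ garsia_stantonE mcoeffX eqxx mulr1.
  move=> u /andP[_ ut]; rewrite mcoeffZ garsia_stantonE mcoeffX (_ : (_ == _) = false) ?mulr0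
    //.
  by apply/negP => /eqP/gs_mon_inj e; rewrite e eqxx in ut.
have [|x xf xmax] := @des_max n _ (msupp f) id.
  by apply/eqP => e; move: (mcoeff_msupp f m); rewrite e fm oner_eq0.
suff <- : x = m by apply: xmax; rewrite mcoeff_msupp fs // oppr_eq0.
have [[t /andP[tJ /eqP e]]|nx] := pselect (exists t, (t \in J) && (x == gs_mon t)).
  by case: (lead_notin_J hla tJ fI); rewrite -e.
apply/eqP; apply: contraT => xm; move: xf.
rewrite mcoeff_msupp mcoeffB mcoeffX (eq_sym m) (negPf xm) raddf_sum big1 ?subr0 ?eqxx // =>
  t tJ /=.
rewrite mcoeffZ garsia_stantonE mcoeffX (_ : (_ == _) = false) ?mulr0 //.
by apply/negP => /eqP e; case: nx; exists t; rewrite tJ -e eqxx.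
Qed.

Lemma leading_monomials (m : 'X_{1..n}) :
  (exists f : {mpoly rat[n]}, [/\ f \in tanisaki_ideal n la, f != 0 & is_des_leading m f])
  <-> (forall s, s \in J -> garsia_stanton s <> 'X_[m]).
Proof.
split=> [[f [fI _ hf]] s sJ e|h].
  have em : m = gs_mon s.
    have : ('X_[gs_mon s] : {mpoly rat[n]})@_m = 1 by rewrite -garsia_stantonE e mcoeffX eqxx.
    by rewrite mcoeffX; case: eqP => // _ /eqP; rewrite eq_sym oner_eq0.
  by apply: (lead_notin_J hla sJ fI); rewrite -em.
have mm t : t \in J -> (gs_mon t == m) = false.
  by move=> tJ; apply/negP => /eqP e; apply: (h t tJ); rewrite garsia_stantonE -e.
have [c fI hc] := normal_form m; set f := _ - _ in fI; exists f.
have fm : f@_m = 1.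
  rewrite mcoeffB mcoeffX eqxx raddf_sum big1 ?subr0 // => t tJ /=.
  by rewrite mcoeffZ garsia_stantonE mcoeffX mm ?mulr0.
split=> //; first by apply: contraTneq (oner_neq0 rat) => e; rewrite -fm e mcoeff0 eqxx.
split=> [|m' ]; first by rewrite mcoeff_msupp fm oner_neq0.
rewrite mcoeff_msupp mcoeffB mcoeffX; have [->|ne] := eqVneq m m'; first by rewrite des_refl.
rewrite sub0r oppr_eq0 raddf_sum => nz.
have [s sJ hs] : exists2 s, s \in J & (c s *: garsia_stanton s)@_m' != 0.
  apply/exists_inP; apply: contraNT nz => /exists_inPn hx; rewrite big1 // => s /hx.
  by rewrite negbK => /eqP.
move: hs; rewrite mcoeffZ garsia_stantonE mcoeffX; case: (gs_mon s =P m') => [<-|];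
  last by rewrite mulr0 eqxx.
by rewrite mulr1; apply: hc.
Qed.

End Assembly.

(** * The basis of the antisymmetrized module *)

Section Antisymmetric.
Variables (n : nat) (la mu : seq nat).
Hypotheses (hla : is_partition n la) (hmu : is_weak_comp n mu).
Local Notation J := (Jmaj n (conj_part la)).
Local Notation cl := (@gp_class n la).
Local Notation A := (J :&: rev_shuffles n mu).

Lemma antisym_sum (B : {set 'S_n}) (c : 'S_n -> rat) (F : 'S_n -> {mpoly rat[n]}) :
  antisym mu (\sum_(s in B) c s *: F s) = \sum_(s in B) c s *: antisym mu (F s).
Proof.
have pE w : perm_act w (\sum_(s in B) c s *: F s) = \sum_(s in B) c s *: perm_act w (F s).
  by rewrite /perm_act raddf_sum; apply: eq_bigr => s _; rewrite /= comp_mpolyZ.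
rewrite /antisym; under eq_bigr do rewrite pE scaler_sumr.
rewrite exchange_big; apply: eq_bigr => s _; rewrite scaler_sumr; apply: eq_bigr => w _.
by rewrite !scalerA mulrC.
Qed.

Lemma antisym_tperm (u v : 'I_n) (m : 'X_{1..n}) : u != v -> block_idx mu u = block_idx mu v ->
  antisym mu 'X_[m] = - antisym mu 'X_[perm_mon m (tperm u v)].
Proof.
move=> uv buv; have ty : tperm u v \in young n mu.
  by apply/(youngP hmu) => j; case: tpermP => [->|->|].
rewrite /antisym (reindex_inj (mulgI (tperm u v))) -sumrN /=; apply: eq_big => [w|w _].
  apply/(youngP hmu)/(youngP hmu) => h j.
    have := h (tperm u v j); rewrite permM tpermK => ->; exact: (youngP hmu _ ty).
  by rewrite permM h; apply: (youngP hmu _ ty).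
rewrite odd_permM odd_tperm uv signr_addb expr1 mulN1r scaleNr !perm_actX.
congr (- (_ *: 'X_[_])); apply/mnmP => j.
by rewrite !mnmE invMg tpermV permM.
Qed.

Definition antisym_span (u : garsia_procesi n la) :=
  exists c : 'S_n -> rat, u = \sum_(s in A) c s *: cl (antisym mu (garsia_stanton s)).

Lemma antisym_span0 : antisym_span 0.
Proof. by exists (fun=> 0); rewrite big1 // => s _; rewrite scale0r. Qed.

Lemma antisym_spanD u v : antisym_span u -> antisym_span v -> antisym_span (u + v).
Proof.
move=> [c ->] [d ->]; exists (fun s => c s + d s).
by rewrite -big_split; apply: eq_bigr => s _; rewrite scalerDl.
Qed.

Lemma antisym_spanZ x u : antisym_span u -> antisym_span (x *: u).
Proof.
move=> [c ->]; exists (fun s => x * c s).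
by rewrite scaler_sumr; apply: eq_bigr => s _; rewrite scalerA.
Qed.

Lemma antisym_span_sum (c : 'S_n -> rat) F : (forall s,
  s \in J -> c s != 0 -> antisym_span (F s)) ->
  antisym_span (\sum_(s in J) c s *: F s).
Proof.
move=> h; apply: (big_ind antisym_span) => [||s sJ];
  [exact: antisym_span0|exact: antisym_spanD|].
by have [->|cs] := eqVneq (c s) 0; [rewrite scale0r;
  apply: antisym_span0|apply/antisym_spanZ/h].
Qed.

Lemma cl_antisym_normal f (c : 'S_n -> rat) :
  f - \sum_(s in J) c s *: garsia_stanton s \in tanisaki_ideal n la ->
  cl (antisym mu f) = \sum_(s in J) c s *: cl (antisym mu (garsia_stanton s)).
Proof. by move=> /gp_classP e; rewrite -gp_antisymE e gp_antisymE antisym_sum gp_class_sum. Qed.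

(** If [s] is not a reverse shuffle, two places u < v of one block have entries that do not
    increase. Equal entries make the antisymmetrization vanish; otherwise exchanging them costs a
    sign and lowers the monomial, whose normal form involves only smaller basis monomials. The
    induction counts the basis monomials not above that of [s]. *)
Lemma antisym_span_gs s : s \in J -> antisym_span (cl (antisym mu (garsia_stanton s))).
Proof.
pose D s := [set s' in J | des_le (gs_mon s') (gs_mon s)].
have inD x y : (x \in D y) = (x \in J) && des_le (gs_mon x) (gs_mon y) by rewrite in_set.
move: {2}#|D s| (leqnn #|D s|) => d; elim: d s => [|d IH] s hd sJ.
  by move: hd; rewrite leqn0 cards_eq0 => /eqP/setP/(_ s); rewrite inD sJ des_refl in_set0.
have [/existsP[u /existsP[v /and3P[/eqP buv uv bvu]]]|hinc] :=
    boolP [exists u : 'I_n, exists v : 'I_n, [&& block_idx mu u == block_idx mu v,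
      (u < v)%N & (gs_mon s v <= gs_mon s u)%N]]; last first.
  have sA : s \in A.
    rewrite in_setI sJ; apply/(increasing_gs hmu) => i j bij ij; rewrite ltnNge;
      apply: contra hinc => h.
    by apply/existsP; exists i; apply/existsP; exists j; rewrite bij eqxx ij.
  exists (fun t => (t == s)%:R); rewrite (bigD1 s) //= eqxx scale1r big1 ?addr0 // =>
    t /andP[_ /negPf ->].
  by rewrite scale0r.
have nuv : u != v by rewrite -val_eqE neq_ltn uv.
have e := antisym_tperm (gs_mon s) nuv buv; set m' := perm_mon _ _ in e.
move: bvu; rewrite leq_eqVlt => /orP[/eqP eb|lt].
  have em : m' = gs_mon s.
    by apply/mnmP => j; rewrite [LHS]mnmE; case: tpermP => [->|->|].
  move/eqP: e; rewrite em -addr_eq0 -mulr2n -scaler_nat scaler_eq0 pnatr_eq0 /= => /eqP e.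
  by rewrite garsia_stantonE e raddf0; apply: antisym_span0.
have [c hc cle] := normal_form hla m'.
have -> : cl (antisym mu (garsia_stanton s)) = (-1) *: cl (antisym mu 'X_[m']).
  by rewrite garsia_stantonE e scaleN1r raddfN.
apply: antisym_spanZ; rewrite (cl_antisym_normal hc).
have nle : ~~ des_le (gs_mon s) m'.
  apply: (@des_lex_first _ _ _ u); first by rewrite decr_sort_perm_mon.
    by move=> i iu; rewrite [RHS]mnmE tpermD // -val_eqE /=; lia.
  by rewrite [X in (X < _)%N]mnmE tpermL.
have le : des_le m' (gs_mon s) by have := des_total m' (gs_mon s); rewrite (negPf nle) orbF.
apply: antisym_span_sum => s' s'J cs'; apply: IH => //; rewrite -ltnS; apply: leq_trans hd.
have le' := cle s' s'J cs'.
apply: proper_card; apply/properP; split.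
  apply/subsetP => x; rewrite !inD => /andP[-> h].
  exact: des_trans h (des_trans le' le).
exists s; rewrite !inD sJ ?des_refl //=; apply: contra nle => h.
exact: des_trans h le'.
Qed.

Lemma gp_antisym_basis :
  is_basis_of (fun u : garsia_procesi n la =>
    exists v : garsia_procesi n la, u = gp_antisym mu v)
    A (fun s => cl (antisym mu (garsia_stanton s))).
Proof.
split.
- by move=> s _; exists (cl (garsia_stanton s)); rewrite gp_antisymE.
- move=> c h; apply: (antisym_independent hla hmu); apply/cl0.
  by rewrite gp_class_sum.
move=> _ [v ->]; have [c ->] := gs_spans hla v.
rewrite -gp_class_sum gp_antisymE antisym_sum gp_class_sum.
by apply: antisym_span_sum => s sJ _; apply: antisym_span_gs.
Qed.

End Antisymmetric.

Theorem theoremA (n : nat) (la : seq nat) (hla : is_partition n la) :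
  [/\ is_basis_of (fun _ : garsia_procesi n la => True)
        (Jmaj n (conj_part la))
        (fun s => gp_class la (garsia_stanton s)),
      forall m : 'X_{1..n},
        (exists f : {mpoly rat[n]},
           [/\ f \in tanisaki_ideal n la, f != 0 & is_des_leading m f])
        <-> (forall s, s \in Jmaj n (conj_part la) -> garsia_stanton s <> 'X_[m])
    & forall mu : seq nat, is_weak_comp n mu ->
        is_basis_of
          (fun u : garsia_procesi n la =>
             exists v : garsia_procesi n la, u = gp_antisym mu v)
          (Jmaj n (conj_part la) :&: rev_shuffles n mu)
          (fun s => gp_class la (antisym mu (garsia_stanton s)))].
Proof.
split; [split=> // | exact: leading_monomials | by move=> mu hmu; apply: gp_antisym_basis].
  by move=> c h; apply: (gs_independent hla); apply/cl0; rewrite gp_class_sum.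
by move=> w _; apply: gs_spans.
Qed.
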